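(* There exists $\delta>0$ such that for every $\mu>0$ the following holds. Let $b_0\in C^3([-\pi,\pi])$ satisfy $\int_{-\pi}^{\pi}b_0(x)\,dx=0$ and $$\|b_0-\mu\cos(\cdot)\|_{C^3([-\pi,\pi])}\le \delta\mu .$$ Then the unique $C^3$ solution $b$ of the nonlocal equation $$\partial_\tau b+\Big(\int_{-\pi}^x b(\tau,\bar x)\,d\bar x\Big)\partial_x b-b^2+\frac1\pi\int_{-\pi}^{\pi}b^2\,dx=\frac1\pi\Big(\int_0^\tau\int_{-\pi}^{\pi}b^2(\bar\tau,x)\,dx\,d\bar\tau\Big)\,b,\qquad x\in[-\pi,\pi],$$ with $\int_{-\pi}^\pi b(\tau,x)\,dx=0$ and $b(0,\cdot)=b_0$, blows up in finite time $\tau^*$ for some $\tau^*>0$. Moreover it can be decomposed as $$b(\tau,x)=\frac{1}{\tau^*-\tau}\cos(x)+\tilde b(\tau,x),$$ where $\|\tilde b(\tau)\|_{C^1([-\pi,\pi])}\lesssim(\tau^*-\tau)^{-3/4}$ for $\tau\in[0,\tau^* )$ (i.e. bounded by a constant times $(\tau^*-\tau)^{-3/4}$).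
   Context: This equation describes the infinite-energy solutions of the 2D incompressible porous medium equation with stream function $y f(\tau,x)$, $f(\tau,x)=\int_{-\pi}^x b(\tau,\bar x)d\bar x$. Solutions are required to satisfy the mean-free condition $\int_{-\pi}^\pi b(\tau,x)dx=0$ for all $\tau$. *)

(* Defs.v *)
From Stdlib Require Import Reals.
From Coquelicot Require Import Coquelicot.
Open Scope R_scope.

Definition Ix (x : R) : Prop := - PI <= x <= PI.
Definition It (T t : R) : Prop := 0 <= t < T.

Definition has_deriv_in (D : R -> Prop) (f : R -> R) (x l : R) : Prop :=
  forall eps : R, 0 < eps -> exists del : R, 0 < del /\
    forall y : R, D y -> Rabs (y - x) < del ->
      Rabs (f y - f x - l * (y - x)) <= eps * Rabs (y - x).

Definition cont_in (D : R -> Prop) (f : R -> R) : Prop :=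
  forall x : R, D x -> forall eps : R, 0 < eps -> exists del : R, 0 < del /\
    forall y : R, D y -> Rabs (y - x) < del -> Rabs (f y - f x) < eps.

Definition cont2_in (D1 D2 : R -> Prop) (g : R -> R -> R) : Prop :=
  forall s x : R, D1 s -> D2 x -> forall eps : R, 0 < eps ->
    exists del : R, 0 < del /\
    forall s' x' : R, D1 s' -> D2 x' -> Rabs (s' - s) < del ->
      Rabs (x' - x) < del -> Rabs (g s' x' - g s x) < eps.

Definition deriv_chain (D : R -> Prop) (k : nat) (f : R -> R)
    (fs : nat -> R -> R) : Prop :=
  (forall x, D x -> fs 0%nat x = f x) /\
  (forall i : nat, (i <= k)%nat -> cont_in D (fs i)) /\
  (forall i : nat, (i < k)%nat -> forall x, D x ->
      has_deriv_in D (fs i) x (fs (S i) x)).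

Definition Ck (k : nat) (f : R -> R) : Prop :=
  exists fs : nat -> R -> R, deriv_chain Ix k f fs.

(* f belongs to C^k([-pi,pi]) and
   ||f||_{C^k([-pi,pi])} := sum_{i=0}^k sup_{[-pi,pi]} |f^(i)| <= M. *)
Definition Ck_norm_le (k : nat) (f : R -> R) (M : R) : Prop :=
  exists fs : nat -> R -> R, deriv_chain Ix k f fs /\
  exists Ms : nat -> R, sum_f_R0 Ms k <= M /\
    forall i : nat, (i <= k)%nat -> forall x, Ix x -> Rabs (fs i x) <= Ms i.

Definition is_solution (T : R) (b : R -> R -> R) : Prop :=
  exists bt bx1 bx2 bx3 : R -> R -> R,
    cont2_in (It T) Ix b /\ cont2_in (It T) Ix bt /\
    cont2_in (It T) Ix bx1 /\ cont2_in (It T) Ix bx2 /\ cont2_in (It T) Ix bx3 /\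
    (forall t x, It T t -> Ix x ->
       has_deriv_in Ix (fun y => b t y) x (bx1 t x) /\
       has_deriv_in Ix (fun y => bx1 t y) x (bx2 t x) /\
       has_deriv_in Ix (fun y => bx2 t y) x (bx3 t x) /\
       has_deriv_in (It T) (fun s => b s x) t (bt t x)) /\
    (forall t, It T t -> RInt (fun y => b t y) (- PI) PI = 0) /\
    (forall t x, It T t -> Ix x ->
       bt t x + RInt (fun y => b t y) (- PI) x * bx1 t x - (b t x) ^ 2
       + / PI * RInt (fun y => (b t y) ^ 2) (- PI) PI
       = / PI * RInt (fun s => RInt (fun y => (b s y) ^ 2) (- PI) PI) 0 t
         * b t x).

(* Main.v *)
Require Import Defs.
From Stdlib Require Import Reals Lra Lia ClassicalEpsilon.
From Coquelicot Require Import Coquelicot.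
Open Scope R_scope.

(** In Lagrangian variables the equation is explicitly solvable. Let [eta] be the
    flow of [f], [eta_a] its derivative in the label [a], and
    [J(t) = (int_0^t int b^2) / pi]. Then [psi = 1 / eta_a] satisfies
    [psi'' = (J psi)'], hence [psi' = J psi - b0(a)], and with
    [K = exp (int_0^t J)] and the new time [s], [ds/dt = 1 / K], one gets
    [psi = K (1 - s b0(a))]. Since [eta] maps [-pi, pi] onto itself,
    [K(s) = (1 / 2 pi) int da / (1 - s b0(a))], so that everything is explicit:
    [b = - J + b0(a) / (K (1 - s b0(a)))] and [b_x = b0'(a) / (1 - s b0(a))].

    The blow-up occurs at [s = 1 / M], [M = max b0], where
    [int ds K(s)] converges because the maximum is nondegenerate. Near it
    [1 - s b0(a)] is close to [sg^2 + c (a - a0)^2] with [sg^2 = 1 - s M]; the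
    flow map is then close to [theta = 2 atan (sqrt c (a - a0) / sg)] and [b_x] to
    [- sin theta / (t^* - t)], with relative error [O(sqrt sg)], while
    [t^* - t] is comparable to [sg]. As [b] and [cos] have mean zero, the bound on
    the derivative of the remainder controls the remainder itself.

    Uniqueness follows from an energy estimate for the difference of two solutions
    and of their memory terms [J]. *)

(** * Calculus *)

(** The clock [s] arises as follows: since [psi(0) = 1] and [J(0) = 0], dividing
    [psi' = J psi - b0(a)] by [K], which solves [K' = J K], leaves [(psi / K)' = - b0(a) / K].
    Closeness to [mu cos] is what controls the maximum of [b0]: an interior point, negative second
    derivative, a quadratic gap to all other values. These requirements scale linearly in [mu], so
    one [delta], here [1/8], serves every [mu]. The coefficient of [cos x] does not depend on the
    curvature [k] of the peak. With [r^2 = k / (2 M)] the slope has amplitude close to [M r / sg],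
    while [t^* - t] is close to [sg / (M r)]; the two are reciprocal. A relative error [sqrt sg] in
    both yields a remainder of order [(t^* - t)^(-1/2)], which is weakened to the exponent [-3/4]
    only at the very end. The technical obstacle is that data and solutions are known on a closed
    space interval and a half-open time interval, with one-sided derivatives at the ends. Data are
    therefore continued to C^3 functions on the line, and solutions are turned into continuous
    functions on the plane by clamping. *)

Lemma continuous_eps (f : R -> R) (x : R) :
  continuous f x <->
  forall eps, 0 < eps -> exists d, 0 < d /\
    forall y, Rabs (y - x) < d -> Rabs (f y - f x) < eps.
Proof.
  split.
  - intros H eps He.
    destruct (proj1 (filterlim_locally f (f x)) H (mkposreal eps He)) as [d Hd].
    exists d; split; [apply cond_pos | exact Hd].
  - intros H. apply filterlim_locally. intros eps.
    destruct (H eps (cond_pos eps)) as [d [Hd H']].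
    exists (mkposreal d Hd). exact H'.
Qed.

Lemma cont_plus (f g : R -> R) x :
  continuous f x -> continuous g x -> continuous (fun y => f y + g y) x.
Proof. apply (continuous_plus (V := R_NormedModule)). Qed.
Lemma cont_opp (f : R -> R) x :
  continuous f x -> continuous (fun y => - f y) x.
Proof. apply (continuous_opp (V := R_NormedModule)). Qed.
Lemma cont_minus (f g : R -> R) x :
  continuous f x -> continuous g x -> continuous (fun y => f y - g y) x.
Proof. apply (continuous_minus (V := R_NormedModule)). Qed.
Lemma cont_mult (f g : R -> R) x :
  continuous f x -> continuous g x -> continuous (fun y => f y * g y) x.
Proof. apply (continuous_mult (K := R_AbsRing)). Qed.
Lemma cont_pow (f : R -> R) n x :
  continuous f x -> continuous (fun y => f y ^ n) x.
Proof.
  intros H. induction n as [|n IH]; simpl.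
  - apply continuous_const.
  - now apply cont_mult.
Qed.
Lemma cont_inv (f : R -> R) x :
  continuous f x -> f x <> 0 -> continuous (fun y => / f y) x.
Proof. apply continuous_Rinv_comp. Qed.
Lemma cont_comp (f g : R -> R) x :
  continuous g x -> continuous f (g x) -> continuous (fun y => f (g y)) x.
Proof. apply continuous_comp. Qed.
Lemma is_derive_cont (f : R -> R) x l : is_derive f x l -> continuous f x.
Proof. intros H. apply (ex_derive_continuous f). now exists l. Qed.

Lemma is_derive_extR (f g : R -> R) (x l : R) :
  (forall y : R, f y = g y) -> is_derive f x l -> is_derive g x l.
Proof. apply is_derive_ext. Qed.

Lemma is_derive_const_plus (k : R) (f : R -> R) (x l : R) :
  is_derive f x l -> is_derive (fun y => k + f y) x l.
Proof.
  intros H. replace l with (0 + l) by ring.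
  apply (is_derive_plus (K := R_AbsRing) (V := R_NormedModule) (fun _ => k) f); auto.
  apply (is_derive_const (K := R_AbsRing) (V := R_NormedModule)).
Qed.

Lemma is_derive_minusR (f g : R -> R) (x l m : R) :
  is_derive f x l -> is_derive g x m -> is_derive (fun y => f y - g y) x (l - m).
Proof. apply (is_derive_minus (K := R_AbsRing) (V := R_NormedModule)). Qed.

Lemma is_derive_plusR (f g : R -> R) (x l m : R) :
  is_derive f x l -> is_derive g x m -> is_derive (fun y => f y + g y) x (l + m).
Proof. apply (is_derive_plus (K := R_AbsRing) (V := R_NormedModule)). Qed.

Lemma is_derive_compR (f g : R -> R) (x l m : R) :
  is_derive f (g x) l -> is_derive g x m -> is_derive (fun y => f (g y)) x (m * l).
Proof. apply (is_derive_comp (K := R_AbsRing) (V := R_NormedModule)). Qed.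

Lemma ex_RInt_cont (f : R -> R) a b :
  (forall x, continuous f x) -> ex_RInt f a b.
Proof. intros H. apply (ex_RInt_continuous (V := R_CompleteNormedModule)). auto. Qed.

Lemma is_derive_RInt_cont (f : R -> R) a x :
  (forall y, continuous f y) -> is_derive (fun z => RInt f a z) x (f x).
Proof.
  intros H. apply (is_derive_RInt f _ a).
  - apply filter_forall. intros y. apply (RInt_correct (V := R_CompleteNormedModule)).
    now apply ex_RInt_cont.
  - apply H.
Qed.

Lemma RInt_Chasles_cont (f : R -> R) a b c :
  (forall x, continuous f x) -> RInt f a c = RInt f a b + RInt f b c.
Proof.
  intros H. symmetry.
  apply (RInt_Chasles (V := R_CompleteNormedModule)); now apply ex_RInt_cont.
Qed.

Lemma RInt_plus_cont (f g : R -> R) a b :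
  (forall x, continuous f x) -> (forall x, continuous g x) ->
  RInt (fun x => f x + g x) a b = RInt f a b + RInt g a b.
Proof.
  intros Hf Hg.
  apply (RInt_plus (V := R_CompleteNormedModule)); now apply ex_RInt_cont.
Qed.

Lemma RInt_scal_cont (f : R -> R) l a b :
  (forall x, continuous f x) -> RInt (fun x => l * f x) a b = l * RInt f a b.
Proof.
  intros Hf.
  apply (RInt_scal (V := R_CompleteNormedModule)); now apply ex_RInt_cont.
Qed.

Lemma RInt_le_cont (f g : R -> R) a b :
  a <= b -> (forall x, continuous f x) -> (forall x, continuous g x) ->
  (forall x, a < x < b -> f x <= g x) -> RInt f a b <= RInt g a b.
Proof.
  intros Hab Hf Hg H.
  apply RInt_le; try apply ex_RInt_cont; auto.
Qed.

Lemma RInt_FTC (f f' : R -> R) a b :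
  a <= b ->
  (forall x, a <= x <= b -> is_derive f x (f' x)) ->
  (forall x, a <= x <= b -> continuous f' x) ->
  RInt f' a b = f b - f a.
Proof.
  intros Hab H1 H2.
  apply (is_RInt_unique (V := R_CompleteNormedModule)).
  apply (is_RInt_derive (V := R_CompleteNormedModule) f f');
    intros x Hx; rewrite Rmin_left, Rmax_right in Hx by lra; auto.
Qed.

Lemma RInt_const_R (c a b : R) : RInt (fun _ => c) a b = (b - a) * c.
Proof. apply (RInt_const (V := R_CompleteNormedModule)). Qed.

(** Composing with this 1-Lipschitz projection makes a function that is continuous on [[a, b]]
    continuous on the whole line, so that integrals and derivatives of integrals need no side
    conditions. *)
Definition clamp (a b x : R) : R := Rmax a (Rmin b x).

Lemma clamp_in a b x : a <= b -> a <= clamp a b x <= b.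
Proof. unfold clamp, Rmax, Rmin. intros. destruct (Rle_dec b x), (Rle_dec _ _); lra. Qed.

Lemma clamp_id a b x : a <= x <= b -> clamp a b x = x.
Proof.
  unfold clamp, Rmax, Rmin. intros.
  destruct (Rle_dec b x); [replace b with x in * by lra|]; destruct (Rle_dec _ _); lra.
Qed.

Lemma clamp_lip a b x y : a <= b -> Rabs (clamp a b y - clamp a b x) <= Rabs (y - x).
Proof.
  intros H. unfold clamp.
  apply Rle_trans with (Rabs (Rmin b y - Rmin b x)).
  - unfold Rmax, Rabs. destruct (Rle_dec a (Rmin b x)), (Rle_dec a (Rmin b y));
      repeat destruct (Rcase_abs _); lra.
  - unfold Rmin, Rabs. destruct (Rle_dec b x), (Rle_dec b y);
      repeat destruct (Rcase_abs _); lra.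
Qed.

Lemma Ix_clamp x : Ix (clamp (- PI) PI x).
Proof. apply clamp_in. generalize PI_RGT_0; lra. Qed.

Lemma cont_in_clamp (f : R -> R) x :
  cont_in Ix f -> continuous (fun y => f (clamp (- PI) PI y)) x.
Proof.
  intros Hf. apply continuous_eps. intros eps He.
  destruct (Hf _ (Ix_clamp x) eps He) as [d [Hd H]].
  exists d; split; auto. intros y Hy. apply H; [apply Ix_clamp|].
  eapply Rle_lt_trans; [apply clamp_lip; generalize PI_RGT_0; lra | exact Hy].
Qed.

Lemma continuous_eps_within (D : R -> Prop) (f : R -> R) x :
  continuous f x -> forall eps, 0 < eps -> exists del, 0 < del /\
    forall y, D y -> Rabs (y - x) < del -> Rabs (f y - f x) < eps.
Proof.
  intros Hf eps He. destruct (proj1 (continuous_eps f x) Hf eps He) as [d [Hd H]].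
  exists d; auto.
Qed.

Lemma cont2_in_clamp (T t1 : R) (g : R -> R -> R) t x :
  0 <= t1 < T -> cont2_in (It T) Ix g ->
  continuity_2d_pt (fun s y => g (clamp 0 t1 s) (clamp (- PI) PI y)) t x.
Proof.
  intros Ht Hg eps.
  assert (HT : forall s, It T (clamp 0 t1 s)).
  { intros s. generalize (clamp_in 0 t1 s ltac:(lra)). unfold It. lra. }
  destruct (Hg _ _ (HT t) (Ix_clamp x) eps (cond_pos eps)) as [d [Hd H]].
  exists (mkposreal d Hd). intros s y Hs Hy. simpl in *.
  apply H; auto using Ix_clamp;
    (eapply Rle_lt_trans; [apply clamp_lip; generalize PI_RGT_0; lra | assumption]).
Qed.

Lemma continuity_2d_snd (g : R -> R -> R) t x :
  continuity_2d_pt g t x -> continuous (g t) x.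
Proof.
  intros H. apply continuous_eps. intros eps He.
  destruct (H (mkposreal eps He)) as [d Hd]. exists d. split; [apply cond_pos|].
  intros y Hy. apply Hd; auto. rewrite Rminus_eq_0, Rabs_R0. apply cond_pos.
Qed.

Lemma continuity_2d_fst (g : R -> R -> R) t x :
  continuity_2d_pt g t x -> continuous (fun s => g s x) t.
Proof.
  intros H. apply continuous_eps. intros eps He.
  destruct (H (mkposreal eps He)) as [d Hd]. exists d. split; [apply cond_pos|].
  intros y Hy. apply Hd; auto. rewrite Rminus_eq_0, Rabs_R0. apply cond_pos.
Qed.

(** Uniform continuity with tolerance 1 gives a step [e]. Walking from the corner [(a, c)] in steps
    of length at most [e / 2] in each variable changes [g] by less than 1 each time, and finitely
    many steps reach every point of the rectangle. *)
Lemma bounded_2d (g : R -> R -> R) a b c d :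
  a <= b -> c <= d -> (forall s x, continuity_2d_pt g s x) ->
  exists L, 0 < L /\
    forall s x, a <= s <= b -> c <= x <= d -> Rabs (g s x) <= L.
Proof.
  intros Hab Hcd Hg.
  destruct (uniform_continuity_2d g a b c d (fun s x _ _ => Hg s x) (mkposreal 1 Rlt_0_1))
    as [e He]. simpl in He.
  assert (Hn : forall n : nat, forall s x, a <= s <= b -> c <= x <= d ->
    s - a <= INR n * (e / 2) -> x - c <= INR n * (e / 2) ->
    Rabs (g s x) <= Rabs (g a c) + INR n).
  { induction n as [|n IH]; intros s x Hs Hx H1 H2.
    - simpl in H1, H2. replace s with a by lra. replace x with c by lra. simpl; lra.
    - rewrite S_INR in *.
      assert (Hpos := pos_INR n).
      assert (He0 := cond_pos e).
      assert (Q : forall lo v, lo <= v -> v - lo <= (INR n + 1) * (e / 2) ->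
        exists v', lo <= v' <= v /\ v' - lo <= INR n * (e / 2) /\ Rabs (v - v') < e).
      { intros lo v Hv Hve. exists (Rmax lo (v - e / 2)).
        unfold Rmax; destruct (Rle_dec _ _); repeat split; try lra; try nra;
          rewrite Rabs_right; lra. }
      destruct (Q a s ltac:(lra) H1) as [s' [A1 [A2 A3]]].
      destruct (Q c x ltac:(lra) H2) as [x' [B1 [B2 B3]]].
      assert (D := He s' x' s x ltac:(lra) ltac:(lra) Hs Hx A3 B3).
      assert (D' := IH s' x' ltac:(lra) ltac:(lra) A2 B2).
      assert (T := Rabs_triang (g s x - g s' x') (g s' x')).
      replace (g s x - g s' x' + g s' x') with (g s x) in T by ring. lra. }
  destruct (INR_unbounded ((b - a + (d - c)) / (e / 2))) as [n Hnn].
  assert (He0 := cond_pos e).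
  assert (b - a + (d - c) <= INR n * (e / 2)).
  { apply Rlt_le. apply Rmult_lt_reg_r with (/ (e / 2)).
    - apply Rinv_0_lt_compat; lra.
    - rewrite Rmult_assoc, Rinv_r by lra. lra. }
  exists (Rabs (g a c) + INR n + 1). split.
  - generalize (Rabs_pos (g a c)) (pos_INR n); lra.
  - intros s x Hs Hx. generalize (Hn n s x Hs Hx ltac:(lra) ltac:(lra)). lra.
Qed.

Lemma is_derive_eps (f : R -> R) (x l : R) :
  is_derive f x l <->
  forall eps, 0 < eps -> exists d, 0 < d /\
    forall y, Rabs (y - x) < d ->
      Rabs (f y - f x - l * (y - x)) <= eps * Rabs (y - x).
Proof.
  split.
  - intros [_ H] eps He.
    destruct (H x (fun P HP => HP) (mkposreal eps He)) as [d Hd].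
    exists d; split; [apply cond_pos|]. intros y Hy. specialize (Hd y Hy).
    unfold norm, minus, plus, opp, scal in Hd; simpl in Hd.
    unfold abs, mult in Hd; simpl in Hd. unfold mult in Hd; simpl in Hd.
    replace (f y - f x - l * (y - x)) with (f y + - f x + - ((y + - x) * l)) by ring.
    exact Hd.
  - intros H. split; [apply is_linear_scal_l|].
    intros z Hz eps. apply (is_filter_lim_locally_unique (V := AbsRing_NormedModule R_AbsRing)) in Hz. subst z.
    destruct (H eps (cond_pos eps)) as [d [Hd H']].
    exists (mkposreal d Hd). intros y Hy. specialize (H' y Hy).
    unfold norm, minus, plus, opp, scal; simpl.
    unfold abs, mult; simpl. unfold mult; simpl.
    replace (f y + - f x + - ((y + - x) * l)) with (f y - f x - l * (y - x)) by ring.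
    exact H'.
Qed.

Lemma is_derive_has_deriv_in (D : R -> Prop) f x l :
  is_derive f x l -> has_deriv_in D f x l.
Proof.
  intros H eps He. destruct (proj1 (is_derive_eps f x l) H eps He) as [d [Hd H']].
  exists d; split; auto.
Qed.

Lemma has_deriv_in_interior a b f x l :
  a < x < b -> has_deriv_in (fun y => a <= y <= b) f x l -> is_derive f x l.
Proof.
  intros Hx H. apply is_derive_eps. intros eps He.
  destruct (H eps He) as [d [Hd H']].
  exists (Rmin d (Rmin (x - a) (b - x))). split.
  - repeat apply Rmin_glb_lt; lra.
  - intros y Hy.
    assert (A := Rmin_l d (Rmin (x - a) (b - x))).
    assert (B := Rmin_r d (Rmin (x - a) (b - x))).
    assert (B1 := Rmin_l (x - a) (b - x)).
    assert (B2 := Rmin_r (x - a) (b - x)).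
    apply H'; [|lra]. apply Rabs_lt_between' in Hy. lra.
Qed.

Lemma has_deriv_in_sub (D D' : R -> Prop) f x l :
  (forall y, D' y -> D y) -> has_deriv_in D f x l -> has_deriv_in D' f x l.
Proof.
  intros S H eps He. destruct (H eps He) as [d [Hd H']]. exists d; auto.
Qed.

Lemma has_deriv_in_ext (D : R -> Prop) f g x l :
  D x -> (forall y, D y -> f y = g y) -> has_deriv_in D f x l -> has_deriv_in D g x l.
Proof.
  intros Dx E H eps He. destruct (H eps He) as [d [Hd H']]. exists d; split; auto.
  intros y Dy Hy. rewrite <- !E; auto.
Qed.

Lemma mvt_is_derive (f f' : R -> R) a b :
  a < b -> (forall x, a < x < b -> is_derive f x (f' x)) ->
  (forall x, a <= x <= b -> continuous f x) ->
  exists c, a <= c <= b /\ f b - f a = f' c * (b - a).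
Proof.
  intros Hab H1 H2.
  destruct (MVT_gen f a b f') as [c [Hc E]].
  - intros x Hx. rewrite Rmin_left, Rmax_right in Hx by lra. auto.
  - intros x Hx. rewrite Rmin_left, Rmax_right in Hx by lra.
    apply continuity_pt_filterlim. now apply H2.
  - rewrite Rmin_left, Rmax_right in Hc by lra. now exists c.
Qed.

Lemma nonincreasing_of_derive (f f' : R -> R) a b :
  a <= b -> (forall x, a < x < b -> is_derive f x (f' x) /\ f' x <= 0) ->
  (forall x, a <= x <= b -> continuous f x) -> f b <= f a.
Proof.
  intros Hab H1 H2.
  destruct (Req_dec a b) as [->|Hne]; [lra|].
  (* [f'] is meaningless at the endpoints, which the mean value theorem does not exclude. *)
  destruct (mvt_is_derive f
    (fun x => if Rlt_dec a x then if Rlt_dec x b then f' x else 0 else 0) a b) as [c [Hc E]].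
  - lra.
  - intros x Hx. destruct (Rlt_dec a x), (Rlt_dec x b); try lra. now apply H1.
  - auto.
  - destruct (Rlt_dec a c), (Rlt_dec c b); try (rewrite Rmult_0_l in E; lra).
    assert (f' c <= 0) by (apply H1; lra). nra.
Qed.

(* [y * exp (- C t)] is nonincreasing. *)
Lemma gronwall_zero (y y' : R -> R) C t1 :
  (forall t, 0 <= t <= t1 -> continuous y t) ->
  (forall t, 0 < t < t1 -> is_derive y t (y' t) /\ y' t <= C * y t) ->
  (forall t, 0 <= t <= t1 -> 0 <= y t) -> y 0 = 0 ->
  forall t, 0 <= t <= t1 -> y t = 0.
Proof.
  intros Hc Hd Hp H0 t Ht.
  assert (E : y t * exp (- C * t) <= y 0 * exp (- C * 0)).
  { apply (nonincreasing_of_derive (fun s => y s * exp (- C * s))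
      (fun s => y' s * exp (- C * s) + y s * (- C * exp (- C * s)))).
    - lra.
    - intros s Hs. destruct (Hd s) as [D B]; [lra|]. split.
      + apply (Derive.is_derive_mult y (fun s => exp (- C * s))); auto.
        auto_derive; auto; ring.
      + generalize (exp_pos (- C * s)). nra.
    - intros s Hs. apply (cont_mult y (fun s => exp (- C * s))).
      + apply Hc; lra.
      + apply (ex_derive_continuous (fun s => exp (- C * s))). auto_derive; auto. }
  rewrite H0, Rmult_0_l in E.
  generalize (exp_pos (- C * t)) (Hp t Ht). nra.
Qed.

(** * Inverse and implicit functions of one variable *)

Lemma strictly_increasing_antideriv (n : R -> R) a u v :
  (forall x, continuous n x) -> (forall x, 0 < n x) -> u < v ->
  RInt n a u < RInt n a v.
Proof.
  intros Hc Hn Huv. rewrite (RInt_Chasles_cont n a u v) by auto.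
  generalize (RInt_gt_0 n u v Huv (fun x _ => Hn x) (fun x _ => Hc x)). lra.
Qed.

(** A left inverse is all that a choice operator provides directly. On values strictly between [F u]
    and [F v] the intermediate value theorem supplies a preimage, which makes [g] a right inverse
    there. *)
Lemma inverse_between (F g : R -> R) u v y :
  (forall x, continuous F x) -> (forall x, g (F x) = x) ->
  u <= v -> F u < y < F v -> u < g y < v /\ F (g y) = y.
Proof.
  intros Hc Hg Huv Hy.
  destruct (IVT_gen F u v y) as [x [Hx E]].
  - intros x. apply continuity_pt_filterlim. apply Hc.
  - rewrite Rmin_left, Rmax_right; lra.
  - rewrite Rmin_left, Rmax_right in Hx by lra.
    rewrite <- E, Hg. repeat split; auto; destruct Hx as [[?|?] [?|?]]; subst; lra.
Qed.

Lemma inverse_continuous (F g : R -> R) x :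
  (forall x, continuous F x) -> (forall u v, u < v -> F u < F v) ->
  (forall x, g (F x) = x) -> continuous g (F x).
Proof.
  intros Hc Hi Hg. apply continuous_eps. intros eps He. rewrite Hg.
  assert (A := Hi (x - eps) x ltac:(lra)). assert (B := Hi x (x + eps) ltac:(lra)).
  exists (Rmin (F x - F (x - eps)) (F (x + eps) - F x)). split.
  - apply Rmin_glb_lt; lra.
  - intros y Hy.
    assert (M1 := Rmin_l (F x - F (x - eps)) (F (x + eps) - F x)).
    assert (M2 := Rmin_r (F x - F (x - eps)) (F (x + eps) - F x)).
    apply Rabs_lt_between' in Hy.
    destruct (inverse_between F g (x - eps) (x + eps) y) as [G _]; auto; try lra.
    apply Rabs_lt_between'. lra.
Qed.

Lemma inverse_right_inverse (F g : R -> R) x :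
  (forall x, continuous F x) -> (forall u v, u < v -> F u < F v) ->
  (forall x, g (F x) = x) -> locally (F x) (fun y => F (g y) = y).
Proof.
  intros Hc Hi Hg.
  assert (A := Hi (x - 1) x ltac:(lra)). assert (B := Hi x (x + 1) ltac:(lra)).
  assert (P : 0 < Rmin (F x - F (x - 1)) (F (x + 1) - F x)) by (apply Rmin_glb_lt; lra).
  exists (mkposreal _ P). intros y Hy. simpl in Hy.
  assert (M1 := Rmin_l (F x - F (x - 1)) (F (x + 1) - F x)).
  assert (M2 := Rmin_r (F x - F (x - 1)) (F (x + 1) - F x)).
  apply Rabs_lt_between' in Hy.
  apply (inverse_between F g (x - 1) (x + 1)); auto; lra.
Qed.

(** Only continuity of [a] is assumed. Linearizing [H] along the curve gives
    [q (a s - a s0) = (r' - p) (s - s0)] up to a small multiple of both increments; a first use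
    shows [a] to be Lipschitz at [s0], and a second one, with the increment of [a] now absorbed,
    gives the derivative. *)
Lemma implicit_derive (H : R -> R -> R) (a r : R -> R) s0 p q r' :
  differentiable_pt_lim H s0 (a s0) p q -> q <> 0 -> continuous a s0 ->
  locally s0 (fun s => H s (a s) = r s) -> is_derive r s0 r' ->
  is_derive a s0 ((r' - p) / q).
Proof.
  intros Hd Hq Hc He Hr.
  assert (E0 := locally_singleton _ _ He).
  assert (Hq' : 0 < Rabs q) by now apply Rabs_pos_lt.
  assert (K : forall e, 0 < e -> exists d, 0 < d /\ forall s, Rabs (s - s0) < d ->
    Rabs ((r' - p) * (s - s0) - q * (a s - a s0))
      <= e * (2 * Rabs (s - s0) + Rabs (a s - a s0))).
  { intros e Hpos.
    destruct (Hd (mkposreal e Hpos)) as [d1 D1]. simpl in D1.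
    destruct (proj1 (continuous_eps a s0) Hc d1 (cond_pos d1)) as [d2 [P2 D2]].
    destruct (proj1 (is_derive_eps r s0 r') Hr e Hpos) as [d3 [P3 D3]].
    destruct He as [d4 D4].
    exists (Rmin (Rmin d1 d2) (Rmin d3 d4)). split.
    - repeat apply Rmin_glb_lt; auto; apply cond_pos.
    - intros s Hs.
      assert (Hs1 : Rabs (s - s0) < d1 /\ Rabs (s - s0) < d2 /\ Rabs (s - s0) < d3
                    /\ Rabs (s - s0) < d4).
      { repeat split; (eapply Rlt_le_trans; [exact Hs|]).
        - eapply Rle_trans; apply Rmin_l.
        - eapply Rle_trans; [apply Rmin_l|apply Rmin_r].
        - eapply Rle_trans; [apply Rmin_r|apply Rmin_l].
        - eapply Rle_trans; [apply Rmin_r|apply Rmin_r]. }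
      destruct Hs1 as [S1 [S2 [S3 S4]]].
      specialize (D1 s (a s) S1 (D2 s S2)). specialize (D3 s S3).
      rewrite (D4 s S4) in D1. rewrite E0 in D1.
      assert (M : Rmax (Rabs (s - s0)) (Rabs (a s - a s0))
                  <= Rabs (s - s0) + Rabs (a s - a s0)).
      { generalize (Rabs_pos (s - s0)) (Rabs_pos (a s - a s0)).
        intros; apply Rmax_lub; lra. }
      replace ((r' - p) * (s - s0) - q * (a s - a s0)) with
        ((r s - r s0 - (p * (s - s0) + q * (a s - a s0)))
         - (r s - r s0 - r' * (s - s0))) by ring.
      eapply Rle_trans; [apply Rabs_triang|]. rewrite Rabs_Ropp.
      assert (e * Rmax (Rabs (s - s0)) (Rabs (a s - a s0))
              <= e * (Rabs (s - s0) + Rabs (a s - a s0)))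
        by (apply Rmult_le_compat_l; lra).
      lra. }
  apply is_derive_eps. intros eps Heps.
  (* The Lipschitz constant obtained from [K] with tolerance [|q| / 2]: half of [|q| |a s - a s0|]
     is absorbed on the left. *)
  set (C := (Rabs (r' - p) + Rabs q) / (Rabs q / 2)).
  assert (HC : 0 <= C).
  { apply Rmult_le_pos; [generalize (Rabs_pos (r' - p)); lra|].
    apply Rlt_le, Rinv_0_lt_compat; lra. }
  destruct (K (Rabs q / 2) ltac:(lra)) as [d1 [P1 D1]].
  assert (He2 : 0 < eps * Rabs q / (2 + C)).
  { apply Rdiv_lt_0_compat; [|lra]. nra. }
  destruct (K _ He2) as [d2 [P2 D2]].
  exists (Rmin d1 d2). split; [now apply Rmin_glb_lt|].
  intros s Hs.
  specialize (D1 s (Rlt_le_trans _ _ _ Hs (Rmin_l _ _))).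
  specialize (D2 s (Rlt_le_trans _ _ _ Hs (Rmin_r _ _))).
  assert (L : Rabs (a s - a s0) <= C * Rabs (s - s0)).
  { assert (T := Rabs_triang_inv (q * (a s - a s0)) ((r' - p) * (s - s0))).
    rewrite (Rabs_minus_sym (q * _)), !Rabs_mult in T.
    apply Rmult_le_reg_l with (Rabs q / 2); [lra|].
    replace (Rabs q / 2 * (C * Rabs (s - s0)))
      with ((Rabs (r' - p) + Rabs q) * Rabs (s - s0)).
    2:{ unfold C. field. lra. }
    lra. }
  apply Rmult_le_reg_l with (Rabs q); auto.
  rewrite <- Rabs_mult.
  replace (q * (a s - a s0 - (r' - p) / q * (s - s0)))
    with (- ((r' - p) * (s - s0) - q * (a s - a s0))) by (field; auto).
  rewrite Rabs_Ropp. eapply Rle_trans; [exact D2|].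
  apply Rle_trans with (eps * Rabs q / (2 + C) * ((2 + C) * Rabs (s - s0))).
  - apply Rmult_le_compat_l; lra.
  - right. field. lra.
Qed.

Lemma differentiable_id_snd (F : R -> R) x l :
  is_derive F x l -> forall y, differentiable_pt_lim (fun _ a => F a) y x 0 l.
Proof.
  intros H y eps. destruct (proj1 (is_derive_eps F x l) H eps (cond_pos eps)) as [d [Hd D]].
  exists (mkposreal d Hd). intros u v Hu Hv. simpl in *.
  rewrite Rmult_0_l, Rplus_0_l. eapply Rle_trans; [apply D; auto|].
  apply Rmult_le_compat_l; [apply Rlt_le, cond_pos|apply Rmax_r].
Qed.

Lemma inverse_derive (F g : R -> R) x l :
  (forall x, continuous F x) -> (forall u v, u < v -> F u < F v) ->
  (forall x, g (F x) = x) -> is_derive F x l -> l <> 0 ->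
  is_derive g (F x) (/ l).
Proof.
  intros Hc Hi Hg Hd Hl.
  replace (/ l) with ((1 - 0) / l) by (field; auto).
  apply (implicit_derive (fun _ a => F a) g (fun y => y)); auto.
  - rewrite Hg. now apply differentiable_id_snd.
  - now apply inverse_continuous.
  - now apply inverse_right_inverse.
  - apply (is_derive_id (K := R_AbsRing)).
Qed.

(** * Continuation of C^k functions from the interval to the line *)

Lemma deriv_chain_tail D k f fs :
  deriv_chain D (S k) f fs -> deriv_chain D k (fs 1%nat) (fun i => fs (S i)).
Proof.
  intros [H0 [H1 H2]]. split; [auto|split].
  - intros i Hi. apply H1; lia.
  - intros i Hi. apply H2; lia.
Qed.

(** Derivatives at the endpoints are one-sided, so the mean value theorem is applied to the clamped
    function: it is differentiable inside and continuous up to the endpoints, which suffices. *)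
Lemma zero_derive_Ix (h : R -> R) :
  (forall x, Ix x -> has_deriv_in Ix h x 0) -> forall x, Ix x -> h x = h 0.
Proof.
  intros H x Hx.
  assert (P := PI_RGT_0).
  assert (Hc : cont_in Ix h).
  { intros y Hy eps He. destruct (H y Hy 1 Rlt_0_1) as [d [Hd D]].
    exists (Rmin d eps). split; [now apply Rmin_glb_lt|].
    intros z Hz Hzy.
    specialize (D z Hz (Rlt_le_trans _ _ _ Hzy (Rmin_l _ _))).
    rewrite Rmult_0_l, Rminus_0_r in D.
    generalize (Rmin_r d eps). lra. }
  assert (E : forall u v, - PI <= u -> u < v -> v <= PI -> h v = h u).
  { intros u v Hu Huv Hv.
    destruct (mvt_is_derive (fun y => h (clamp (- PI) PI y)) (fun _ => 0) u v) as [c [_ E]].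
    - auto.
    - intros y Hy.
      apply (has_deriv_in_interior (- PI) PI); [lra|].
      apply (has_deriv_in_ext Ix h); [unfold Ix; lra| |apply H; unfold Ix; lra].
      intros z Hz. now rewrite clamp_id.
    - intros y _. now apply cont_in_clamp.
    - rewrite !clamp_id in E by lra. lra. }
  unfold Ix in Hx.
  destruct (Rtotal_order x 0) as [L|[->|L]]; auto.
  - symmetry. apply E; lra.
  - apply E; lra.
Qed.

Lemma has_deriv_in_minus D f g x l m :
  has_deriv_in D f x l -> has_deriv_in D g x m ->
  has_deriv_in D (fun y => f y - g y) x (l - m).
Proof.
  intros Hf Hg eps He.
  destruct (Hf (eps / 2) ltac:(lra)) as [d1 [P1 D1]].
  destruct (Hg (eps / 2) ltac:(lra)) as [d2 [P2 D2]].
  exists (Rmin d1 d2). split; [now apply Rmin_glb_lt|].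
  intros y Dy Hy.
  specialize (D1 y Dy (Rlt_le_trans _ _ _ Hy (Rmin_l _ _))).
  specialize (D2 y Dy (Rlt_le_trans _ _ _ Hy (Rmin_r _ _))).
  replace (f y - g y - (f x - g x) - (l - m) * (y - x)) with
    ((f y - f x - l * (y - x)) - (g y - g x - m * (y - x))) by ring.
  eapply Rle_trans; [apply Rabs_triang|]. rewrite Rabs_Ropp. lra.
Qed.

(** The highest derivative is continued by constants, and the lower ones are recovered by
    integrating from 0. On [Ix] each primitive agrees with the original since the derivatives agree
    and so do the values at 0. *)
Lemma deriv_chain_extension k f fs :
  deriv_chain Ix k f fs ->
  exists es : nat -> R -> R,
    (forall i x, (i < k)%nat -> is_derive (es i) x (es (S i) x)) /\
    (forall i x, (i <= k)%nat -> continuous (es i) x) /\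
    (forall i x, (i <= k)%nat -> Ix x -> es i x = fs i x).
Proof.
  revert f fs. induction k as [|k IH]; intros f fs H.
  - exists (fun _ x => fs 0%nat (clamp (- PI) PI x)). split; [|split].
    + intros i x Hi; lia.
    + intros i x _. apply cont_in_clamp. apply H; lia.
    + intros i x Hi Hx. replace i with 0%nat by lia. now rewrite clamp_id.
  - destruct (IH _ _ (deriv_chain_tail _ _ _ _ H)) as [es [E1 [E2 E3]]].
    set (e0 := fun x => fs 0%nat 0 + RInt (es 0%nat) 0 x).
    assert (D0 : forall x, is_derive e0 x (es 0%nat x)).
    { intros x. apply is_derive_const_plus.
      apply is_derive_RInt_cont. intros y. apply E2; lia. }
    exists (fun i => match i with O => e0 | S j => es j end). split; [|split].
    + intros [|i] x Hi; [apply D0 | apply E1; lia].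
    + intros [|i] x Hi; [eapply is_derive_cont, D0 | apply E2; lia].
    + intros [|i] x Hi Hx; [|apply (E3 i x); auto; lia].
      assert (Z : e0 x - fs 0%nat x = e0 0 - fs 0%nat 0).
      { apply (zero_derive_Ix (fun y => e0 y - fs 0%nat y)); auto.
        intros y Hy. replace 0 with (es 0%nat y - fs 1%nat y).
        2:{ rewrite (E3 0%nat y) by (auto; lia). ring. }
        apply has_deriv_in_minus; [now apply is_derive_has_deriv_in|].
        apply H; auto; lia. }
      unfold e0 in Z at 2. rewrite RInt_point in Z. unfold zero in Z; simpl in Z. lra.
Qed.

(** * The explicit solution *)

Lemma continuous_pt (f : R -> R) x : continuous f x <-> continuity_pt f x.
Proof. symmetry. apply continuity_pt_filterlim. Qed.

(** The increment splits into a change of the parameter, bounded by the uniform distance of [g s]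
    and [g s0] on a compact interval times its length, and a change of the upper limit at fixed
    [s0]. The length [l] dominates [|a - lo|] for all [a] within 1 of [a0]. *)
Lemma RInt_continuity_2d (g : R -> R -> R) lo s0 a0 :
  locally s0 (fun s => forall x, continuous (g s) x) ->
  (forall x, continuity_2d_pt g s0 x) ->
  continuity_2d_pt (fun s a => RInt (g s) lo a) s0 a0.
Proof.
  intros Hl Hg eps.
  assert (Hg0 : forall x, continuous (g s0) x) by (intros; now apply continuity_2d_snd).
  set (l := Rabs (a0 - lo) + 1).
  assert (Pl : 1 <= l) by (unfold l; generalize (Rabs_pos (a0 - lo)); lra).
  assert (He : 0 < eps / (2 * l)).
  { apply Rdiv_lt_0_compat; [apply cond_pos|lra]. }
  destruct (uniform_continuity_2d_1d' g (lo - l) (lo + l) s0 (fun x _ => Hg x)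
    (mkposreal _ He)) as [d1 D1]. simpl in D1.
  destruct Hl as [d2 D2].
  destruct (proj1 (continuous_eps _ _)
    (is_derive_cont _ _ _ (is_derive_RInt_cont (g s0) lo a0 Hg0)) (eps / 2)) as [d3 [P3 D3]].
  { generalize (cond_pos eps); lra. }
  assert (P : 0 < Rmin (Rmin d1 d2) (Rmin d3 1)).
  { repeat apply Rmin_glb_lt; auto using cond_pos; lra. }
  exists (mkposreal _ P). intros s a Hs Ha. simpl in Hs, Ha.
  assert (M1 := Rmin_l (Rmin d1 d2) (Rmin d3 1)).
  assert (M2 := Rmin_r (Rmin d1 d2) (Rmin d3 1)).
  assert (M3 := Rmin_l d1 d2). assert (M4 := Rmin_r d1 d2).
  assert (M5 := Rmin_l d3 1). assert (M6 := Rmin_r d3 1).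
  assert (Hgs : forall x, continuous (g s) x) by (apply D2; apply Rlt_le_trans with (1 := Hs); lra).
  specialize (D3 a ltac:(lra)).
  assert (V : Rabs ((RInt (g s) lo a - RInt (g s0) lo a) - (RInt (g s) lo lo - RInt (g s0) lo lo))
              <= eps / (2 * l) * Rabs (a - lo)).
  { apply (bounded_variation (fun z => RInt (g s) lo z - RInt (g s0) lo z)
      (fun z => g s z - g s0 z)).
    intros t Ht. split.
    - apply (is_derive_minus (K := R_AbsRing) (V := R_NormedModule)
        (fun z => RInt (g s) lo z) (fun z => RInt (g s0) lo z));
        now apply is_derive_RInt_cont.
    - left.
      assert (T : Rabs (a - lo) <= l).
      { unfold l. replace (a - lo) with ((a - a0) + (a0 - lo)) by ring.
        eapply Rle_trans; [apply Rabs_triang|]. lra. }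
      assert (T' : lo - l <= t <= lo + l).
      { apply Rabs_le_between'. lra. }
      apply Rabs_lt_between' in Hs. generalize (cond_pos d1); intro.
      apply D1; auto; try lra. rewrite Rminus_eq_0, Rabs_R0. lra. }
  rewrite !RInt_point in V. unfold zero in V; simpl in V.
  assert (W : eps / (2 * l) * Rabs (a - lo) <= eps / 2).
  { replace (eps / 2) with (eps / (2 * l) * l) by (field; lra).
    apply Rmult_le_compat_l; [lra|].
    unfold l. replace (a - lo) with ((a - a0) + (a0 - lo)) by ring.
    eapply Rle_trans; [apply Rabs_triang|]. lra. }
  replace (RInt (g s) lo a - RInt (g s0) lo a0) with
    ((RInt (g s) lo a - RInt (g s0) lo a - (0 - 0)) + (RInt (g s0) lo a - RInt (g s0) lo a0)) by ring.
  eapply Rle_lt_trans; [apply Rabs_triang|]. lra.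
Qed.

Lemma continuous_RInt_param (g : R -> R -> R) a b t :
  (forall s x, continuity_2d_pt g s x) -> continuous (fun s => RInt (g s) a b) t.
Proof.
  intros Hg. apply (continuity_2d_fst (fun s z => RInt (g s) a z)).
  apply RInt_continuity_2d; auto.
  apply filter_forall. intros s x. now apply continuity_2d_snd.
Qed.

Lemma continuity_2d_of_fst (f : R -> R) t x :
  continuous f t -> continuity_2d_pt (fun s _ => f s) t x.
Proof.
  intros H. apply (continuity_1d_2d_pt_comp f (fun s _ => s)).
  - now apply continuous_pt.
  - apply continuity_2d_pt_id1.
Qed.

Lemma continuity_2d_comp1 (f : R -> R) (g : R -> R -> R) t x :
  continuous f (g t x) -> continuity_2d_pt g t x ->
  continuity_2d_pt (fun s y => f (g s y)) t x.
Proof.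
  intros H. apply continuity_1d_2d_pt_comp. now apply continuous_pt.
Qed.

Lemma continuity_2d_comp2 (F g h : R -> R -> R) t x :
  continuity_2d_pt F (g t x) (h t x) -> continuity_2d_pt g t x -> continuity_2d_pt h t x ->
  continuity_2d_pt (fun s y => F (g s y) (h s y)) t x.
Proof.
  intros HF Hg Hh eps. destruct (HF eps) as [d D].
  destruct (Hg d) as [d1 D1]. destruct (Hh d) as [d2 D2].
  assert (P : 0 < Rmin d1 d2) by (apply Rmin_glb_lt; apply cond_pos).
  exists (mkposreal _ P). intros s y Hs Hy. simpl in *.
  assert (M1 := Rmin_l d1 d2). assert (M2 := Rmin_r d1 d2).
  apply D; [apply D1 | apply D2]; lra.
Qed.

Lemma continuity_2d_pow (f : R -> R -> R) n t x :
  continuity_2d_pt f t x -> continuity_2d_pt (fun s y => f s y ^ n) t x.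
Proof.
  intros H. induction n as [|n IH]; simpl.
  - apply continuity_2d_pt_const.
  - now apply continuity_2d_pt_mult.
Qed.

Lemma continuity_2d_div (f g : R -> R -> R) t x :
  continuity_2d_pt f t x -> continuity_2d_pt g t x -> g t x <> 0 ->
  continuity_2d_pt (fun s y => f s y / g s y) t x.
Proof.
  intros Hf Hg H. apply continuity_2d_pt_mult; auto. now apply continuity_2d_pt_inv.
Qed.

(* Coquelicot leaves equations at projections of canonical structures, which [ring] and
   [field] do not recognize as [R]. *)
Ltac eqR := match goal with |- @eq _ ?a ?b => change (@eq R a b) end.

Ltac cont2 := repeat first
  [ solve [auto] | apply continuity_2d_pt_const | apply continuity_2d_pt_id1 | apply continuity_2d_pt_id2
  | apply continuity_2d_div | apply continuity_2d_pow | apply continuity_2d_pt_plus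
  | apply continuity_2d_pt_minus | apply continuity_2d_pt_mult | apply continuity_2d_pt_opp ].

(** * The explicit formulas in the variables [s] and [x] *)

Section Explicit.

Variables (b0 b1 b2 b3 : R -> R) (M B : R).
Hypothesis Hb0 : forall x, is_derive b0 x (b1 x).
Hypothesis Hb1 : forall x, is_derive b1 x (b2 x).
Hypothesis Hb2 : forall x, is_derive b2 x (b3 x).
Hypothesis Hb3 : forall x, continuous b3 x.
Hypothesis HMB : forall x, Ix x -> - B <= b0 x <= M.

Let c x := b0 (clamp (- PI) PI x).

(** An open set of parameters on which [- B <= b0 <= M] forces [1 - s b0 > 0]. It also contains
    negative values, so that the initial parameter 0 is interior and two-sided derivatives are
    available there. *)
Definition admissible s := s * M < 1 /\ - s * B < 1.

Lemma admissible_locally s : admissible s -> locally s admissible.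
Proof.
  intros [H1 H2].
  assert (C1 : continuous (fun s => 1 - s * M) s).
  { apply (ex_derive_continuous (fun s => 1 - s * M)). auto_derive; auto. }
  assert (C2 : continuous (fun s => 1 + s * B) s).
  { apply (ex_derive_continuous (fun s => 1 + s * B)). auto_derive; auto. }
  apply filter_and.
  - assert (L : locally s (fun y => 0 < 1 - y * M)) by
      (apply (C1 (fun z => 0 < z)); apply (open_gt 0); lra).
    revert L. apply filter_imp. intros y Hy. lra.
  - assert (L : locally s (fun y => 0 < 1 + y * B)) by
      (apply (C2 (fun z => 0 < z)); apply (open_gt 0); lra).
    revert L. apply filter_imp. intros y Hy. lra.
Qed.

Lemma denominator_pos s x : admissible s -> Ix x -> 0 < 1 - s * b0 x.
Proof.
  intros [H1 H2] Hx. destruct (HMB x Hx).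
  destruct (Rle_dec 0 s); nra.
Qed.

Lemma clamped_denominator_pos s x : admissible s -> 0 < 1 - s * c x.
Proof. intros. apply denominator_pos; auto. apply Ix_clamp. Qed.

Lemma b0_cont x : continuous b0 x.
Proof. eapply is_derive_cont, Hb0. Qed.

Lemma c_cont x : continuous c x.
Proof.
  apply cont_in_clamp. intros y _ eps He.
  destruct (proj1 (continuous_eps b0 y) (b0_cont y) eps He) as [d [Hd D]].
  exists d; auto.
Qed.

Lemma c_id x : Ix x -> c x = b0 x.
Proof. intros. unfold c. now rewrite clamp_id. Qed.

Let g (n : nat) s x := c x ^ n * (/ (1 - s * c x)) ^ S n.

(** Apart from the factor [n!], these are the successive [s]-derivatives of the integral of
    [1 / (1 - s b0)]. Everything in the solution is a combination of [Phi 0], [Phi 1], [Phi 2] and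
    the data at the label. *)
Definition Phi (n : nat) (s a : R) : R := RInt (g n s) (- PI) a.

Lemma g_cont2 n s x : admissible s -> continuity_2d_pt (g n) s x.
Proof.
  intros Hs. unfold g.
  assert (C : continuity_2d_pt (fun _ y => c y) s x).
  { apply (continuity_2d_comp1 c (fun _ y => y)); [apply c_cont|apply continuity_2d_pt_id2]. }
  apply continuity_2d_pt_mult; [now apply continuity_2d_pow|].
  apply continuity_2d_pow. apply continuity_2d_pt_inv.
  - cont2.
  - generalize (clamped_denominator_pos s x Hs); lra.
Qed.

Lemma g_cont n s x : admissible s -> continuous (g n s) x.
Proof. intros Hs. now apply continuity_2d_snd, g_cont2. Qed.

Lemma g_ds n s x : admissible s ->
  is_derive (fun s => g n s x) s (INR (S n) * g (S n) s x).
Proof.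
  intros Hs. unfold g.
  assert (P := clamped_denominator_pos s x Hs).
  replace (INR (S n) * (c x ^ S n * (/ (1 - s * c x)) ^ S (S n))) with
    (c x ^ n * (INR (S n) * (- - c x / (1 - s * c x) ^ 2) * (/ (1 - s * c x)) ^ n)).
  - apply is_derive_scal. apply (is_derive_pow (fun s => / (1 - s * c x)) (S n)).
    apply (is_derive_inv (fun s => 1 - s * c x)); [|lra].
    auto_derive; auto; ring.
  - rewrite !(pow_inv (1 - s * c x)), <- !tech_pow_Rmult. field.
    split; [apply pow_nonzero|]; lra.
Qed.

Lemma Phi_da n s a : admissible s -> is_derive (Phi n s) a (g n s a).
Proof. intros Hs. apply is_derive_RInt_cont. intros; now apply g_cont. Qed.

Lemma Phi_ds n s a : admissible s ->
  is_derive (fun s => Phi n s a) s (INR (S n) * Phi (S n) s a).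
Proof.
  intros Hs. assert (L := admissible_locally s Hs).
  unfold Phi.
  replace (INR (S n) * RInt (g (S n) s) (- PI) a)
    with (RInt (fun t => Derive (fun u => g n u t) s) (- PI) a).
  2:{ rewrite <- RInt_scal_cont by (intros; now apply g_cont).
      apply (RInt_ext (V := R_CompleteNormedModule)). intros x _.
      apply is_derive_unique. now apply g_ds. }
  apply (is_derive_RInt_param (g n)).
  - revert L. apply filter_imp. intros y Hy t _. eexists. now apply g_ds.
  - intros t _.
    apply (continuity_2d_pt_ext_loc (fun u v => INR (S n) * g (S n) u v)).
    + destruct L as [d D]. exists d. intros u v Hu _.
      symmetry. apply is_derive_unique. apply g_ds. now apply D.
    + apply continuity_2d_pt_mult; [apply continuity_2d_pt_const|]. now apply g_cont2.
  - revert L. apply filter_imp. intros y Hy. apply ex_RInt_cont.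
    intros; now apply g_cont.
Qed.

Lemma Phi_cont2 n s a : admissible s -> continuity_2d_pt (Phi n) s a.
Proof.
  intros Hs. apply RInt_continuity_2d.
  - generalize (admissible_locally s Hs). apply filter_imp. intros y Hy x.
    now apply g_cont.
  - intros x. now apply g_cont2.
Qed.

Lemma Phi_cont n s a : admissible s -> continuous (fun s => Phi n s a) s.
Proof. intros Hs. eapply is_derive_cont. now apply Phi_ds. Qed.

Lemma Phi_differentiable s a : admissible s ->
  differentiable_pt_lim (Phi 0) s a (Phi 1 s a) (g 0 s a).
Proof.
  intros Hs.
  assert (F : filterdiff (fun u : R * R => Phi 0 (fst u) (snd u)) (locally (s, a))
    (fun u : R * R => plus (scal (fst u) (Phi 1 s a)) (scal (snd u) (g 0 s a)))).
  { apply (is_derive_filterdiff (Phi 0) s a (Phi 1) (g 0 s a)).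
    - destruct (admissible_locally s Hs) as [d D]. exists d. intros [u v] [Hu Hv]. simpl in *.
      replace (Phi 1 u v) with (INR 1 * Phi 1 u v) by (simpl; ring).
      apply Phi_ds. now apply D.
    - now apply Phi_da.
    - apply (proj1 (continuity_2d_pt_filterlim _ _ _)). now apply Phi_cont2. }
  apply filterdiff_differentiable_pt_lim. simpl.
  eapply filterdiff_ext_lin; [exact F|].
  intros [u v]; unfold plus, scal; simpl; unfold mult; simpl; ring.
Qed.

(** This normalization makes the flow send [PI] to [PI]. [K1] and [K2] are the first two
    derivatives; the factor 2 from differentiating [Phi 1] accounts for the denominator [PI] in
    [K2]. *)
Definition K s := Phi 0 s PI / (2 * PI).
Definition K1 s := Phi 1 s PI / (2 * PI).
Definition K2 s := Phi 2 s PI / PI.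

Lemma K_derive s : admissible s -> is_derive K s (K1 s).
Proof.
  intros Hs. unfold K, K1. generalize PI_RGT_0; intro.
  replace (Phi 1 s PI / (2 * PI)) with (/ (2 * PI) * (INR 1 * Phi 1 s PI)) by (simpl; field; lra).
  apply (is_derive_extR (fun s => / (2 * PI) * Phi 0 s PI)); [intros; field; lra|].
  apply is_derive_scal. now apply Phi_ds.
Qed.

Lemma K1_derive s : admissible s -> is_derive K1 s (K2 s).
Proof.
  intros Hs. unfold K1, K2. generalize PI_RGT_0; intro.
  replace (Phi 2 s PI / PI) with (/ (2 * PI) * (INR 2 * Phi 2 s PI)) by (simpl; field; lra).
  apply (is_derive_extR (fun s => / (2 * PI) * Phi 1 s PI)); [intros; field; lra|].
  apply is_derive_scal. now apply Phi_ds.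
Qed.

Lemma K2_cont s : admissible s -> continuous K2 s.
Proof.
  intros Hs. unfold K2. apply cont_mult; [now apply Phi_cont|apply continuous_const].
Qed.

Lemma g0_pos s x : admissible s -> 0 < g 0 s x.
Proof.
  intros Hs. unfold g. simpl. rewrite Rmult_1_l, Rmult_1_r.
  apply Rinv_0_lt_compat. now apply clamped_denominator_pos.
Qed.

Lemma Phi0_increasing s u v : admissible s -> u < v -> Phi 0 s u < Phi 0 s v.
Proof.
  intros Hs. apply strictly_increasing_antideriv.
  - intros; now apply g_cont.
  - intros; now apply g0_pos.
Qed.

Lemma Phi_start n s : Phi n s (- PI) = 0.
Proof. unfold Phi. now rewrite RInt_point. Qed.

Lemma K_pos s : admissible s -> 0 < K s.
Proof.
  intros Hs. unfold K. generalize PI_RGT_0; intro. apply Rdiv_lt_0_compat; [|lra].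
  rewrite <- (Phi_start 0 s). apply Phi0_increasing; auto. lra.
Qed.

(* The Lagrangian flow map and its inverse; [s] is the reparametrized time. *)
Definition flow s a := - PI + Phi 0 s a / K s.
Definition label s x := epsilon (inhabits 0) (fun a => flow s a = x).

Lemma flow_increasing s u v : admissible s -> u < v -> flow s u < flow s v.
Proof.
  intros Hs Huv. unfold flow.
  assert (P := Phi0_increasing s u v Hs Huv). assert (Q := K_pos s Hs).
  apply Rplus_lt_compat_l. apply Rmult_lt_compat_r; auto. now apply Rinv_0_lt_compat.
Qed.

Lemma flow_da s a : admissible s -> is_derive (flow s) a (g 0 s a / K s).
Proof.
  intros Hs. unfold flow.
  replace (g 0 s a / K s) with (/ K s * g 0 s a) by (field; generalize (K_pos s Hs); lra).
  apply is_derive_const_plus.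
  apply (is_derive_extR (fun a => / K s * Phi 0 s a)).
  - intros; unfold Rdiv; ring.
  - apply is_derive_scal. now apply Phi_da.
Qed.

Lemma flow_cont s a : admissible s -> continuous (flow s) a.
Proof. intros Hs. eapply is_derive_cont. now apply flow_da. Qed.

(** The position [flow s a] is in the range of the flow, so the choice does return a preimage, and
    strict monotonicity leaves only one. *)
Lemma label_flow s a : admissible s -> label s (flow s a) = a.
Proof.
  intros Hs. unfold label.
  assert (E := epsilon_spec (inhabits 0) (fun a' => flow s a' = flow s a)
    (ex_intro _ a eq_refl)). simpl in E.
  set (a' := epsilon _ _) in *. clearbody a'.
  destruct (Rtotal_order a' a) as [L|[L|L]]; auto;
    apply (flow_increasing s) in L; auto; lra.
Qed.

Lemma flow_start s : flow s (- PI) = - PI.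
Proof. unfold flow. rewrite Phi_start. unfold Rdiv. ring. Qed.

Lemma flow_end s : admissible s -> flow s PI = PI.
Proof.
  intros Hs. unfold flow. replace (Phi 0 s PI) with (2 * PI * K s).
  - field. generalize (K_pos s Hs); lra.
  - unfold K. field. generalize PI_RGT_0; lra.
Qed.

Lemma flow_between s u v x : admissible s -> u <= v -> flow s u < x < flow s v ->
  u < label s x < v /\ flow s (label s x) = x.
Proof.
  intros Hs. apply inverse_between.
  - intros; now apply flow_cont.
  - intros; now apply label_flow.
Qed.

Lemma label_start s : admissible s -> label s (- PI) = - PI.
Proof. intros. rewrite <- (flow_start s) at 1. now apply label_flow. Qed.
Lemma label_end s : admissible s -> label s PI = PI.
Proof. intros. rewrite <- (flow_end s) at 1 by auto. now apply label_flow. Qed.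

Lemma label_spec s x : admissible s -> Ix x ->
  Ix (label s x) /\ flow s (label s x) = x.
Proof.
  intros Hs Hx. assert (P := PI_RGT_0).
  destruct (Req_dec x (- PI)) as [->|H1].
  { rewrite label_start, flow_start by auto. unfold Ix; lra. }
  destruct (Req_dec x PI) as [->|H2].
  { rewrite label_end, flow_end by auto. unfold Ix; lra. }
  unfold Ix in *.
  destruct (flow_between s (- PI) PI x) as [Q1 Q2]; auto; [lra| |].
  - rewrite flow_start, flow_end by auto. lra.
  - split; auto; lra.
Qed.

Lemma Phi0_label s x : admissible s -> Ix x -> Phi 0 s (label s x) = K s * (x + PI).
Proof.
  intros Hs Hx. destruct (label_spec s x Hs Hx) as [_ E]. unfold flow in E.
  assert (Q := K_pos s Hs). rewrite <- E at 2. field. lra.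
Qed.

Lemma label_dx s x : admissible s -> Ix x ->
  is_derive (label s) x (K s * (1 - s * b0 (label s x))).
Proof.
  intros Hs Hx. destruct (label_spec s x Hs Hx) as [I E].
  assert (Q := K_pos s Hs). assert (D := denominator_pos s _ Hs I).
  assert (G : g 0 s (label s x) = / (1 - s * b0 (label s x))).
  { unfold g. rewrite c_id by auto. simpl. ring. }
  set (a := label s x) in *. rewrite <- E.
  replace (K s * (1 - s * b0 a)) with (/ (g 0 s a / K s)) by (rewrite G; field; lra).
  apply inverse_derive.
  - intros; now apply flow_cont.
  - intros; now apply flow_increasing.
  - intros; now apply label_flow.
  - now apply flow_da.
  - rewrite G. apply Rgt_not_eq. apply Rdiv_lt_0_compat; auto. now apply Rinv_0_lt_compat.
Qed.

Lemma flow_cont_s s a : admissible s -> continuous (fun s => flow s a) s.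
Proof.
  intros Hs. unfold flow. apply cont_plus; [apply continuous_const|].
  apply cont_mult; [now apply Phi_cont|]. apply cont_inv.
  - eapply is_derive_cont. now apply K_derive.
  - generalize (K_pos s Hs); lra.
Qed.

(** The particles with labels [a - eps] and [a + eps] lie at distance at least [m] from [x], on
    opposite sides. If they move by less than [m / 2] and [x'] stays within [m / 2] of [x], then
    [x'] remains between them, and its label between theirs. *)
Lemma label_cont2 s x : admissible s -> Ix x -> continuity_2d_pt label s x.
Proof.
  intros Hs Hx eps. destruct (label_spec s x Hs Hx) as [_ E].
  set (a := label s x) in *. assert (He := cond_pos eps).
  assert (L1 := flow_increasing s (a - eps) a Hs ltac:(lra)).
  assert (L2 := flow_increasing s a (a + eps) Hs ltac:(lra)).
  set (m := Rmin (flow s a - flow s (a - eps)) (flow s (a + eps) - flow s a)).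
  assert (Pm : 0 < m) by (apply Rmin_glb_lt; lra).
  assert (m1 : m <= flow s a - flow s (a - eps)) by apply Rmin_l.
  assert (m2 : m <= flow s (a + eps) - flow s a) by apply Rmin_r.
  destruct (admissible_locally s Hs) as [d0 D0].
  destruct (proj1 (continuous_eps _ _) (flow_cont_s s (a - eps) Hs) (m / 2) ltac:(lra))
    as [d1 [P1 D1]].
  destruct (proj1 (continuous_eps _ _) (flow_cont_s s (a + eps) Hs) (m / 2) ltac:(lra))
    as [d2 [P2 D2]].
  assert (P : 0 < Rmin (Rmin d0 d1) (Rmin d2 (m / 2))).
  { repeat apply Rmin_glb_lt; auto using cond_pos; lra. }
  exists (mkposreal _ P). intros s' x' Hs' Hx'. simpl in Hs', Hx'.
  assert (M1 := Rmin_l (Rmin d0 d1) (Rmin d2 (m / 2))).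
  assert (M2 := Rmin_r (Rmin d0 d1) (Rmin d2 (m / 2))).
  assert (M3 := Rmin_l d0 d1). assert (M4 := Rmin_r d0 d1).
  assert (M5 := Rmin_l d2 (m / 2)). assert (M6 := Rmin_r d2 (m / 2)).
  specialize (D1 s' ltac:(lra)). specialize (D2 s' ltac:(lra)).
  assert (A' : admissible s') by (apply D0; apply Rlt_le_trans with (1 := Hs'); lra).
  apply Rabs_lt_between' in D1. apply Rabs_lt_between' in D2.
  apply Rabs_lt_between' in Hx'.
  destruct (flow_between s' (a - eps) (a + eps) x' A') as [Q _]; [lra|lra|].
  apply Rabs_lt_between'. lra.
Qed.

(** Implicit differentiation of [Phi 0 s (label s x) = K s * (x + PI)] at fixed [x]. *)
Lemma label_ds s x : admissible s -> Ix x ->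
  is_derive (fun s => label s x) s
    ((K1 s * (x + PI) - Phi 1 s (label s x)) * (1 - s * b0 (label s x))).
Proof.
  intros Hs Hx. destruct (label_spec s x Hs Hx) as [I _].
  assert (D := denominator_pos s _ Hs I).
  assert (G : g 0 s (label s x) = / (1 - s * b0 (label s x))).
  { unfold g. rewrite c_id by auto. simpl. ring. }
  replace ((K1 s * (x + PI) - Phi 1 s (label s x)) * (1 - s * b0 (label s x)))
    with ((K1 s * (x + PI) - Phi 1 s (label s x)) / g 0 s (label s x))
    by (rewrite G; field; lra).
  apply (implicit_derive (Phi 0) (fun s => label s x) (fun s => K s * (x + PI))).
  - now apply Phi_differentiable.
  - rewrite G. apply Rinv_neq_0_compat. lra.
  - apply (continuity_2d_fst label). now apply label_cont2.
  - generalize (admissible_locally s Hs). apply filter_imp. intros y Hy.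
    now apply Phi0_label.
  - apply (is_derive_extR (fun s => (x + PI) * K s)); [intros; ring|].
    rewrite (Rmult_comm (K1 s)). apply is_derive_scal. now apply K_derive.
Qed.

(* [J = (int_0^t int b^2) / pi] and [I = (int b^2) / pi] in the paper. *)
Definition J s := K1 s / K s ^ 2.
Definition I s := K2 s / K s ^ 3 - 2 * J s ^ 2.

Definition den s x := 1 - s * b0 (label s x).
Definition u s x := - J s + b0 (label s x) / (K s * den s x).
Definition u1 s x := b1 (label s x) / den s x.
Definition u2 s x := K s * (b2 (label s x) + s * b1 (label s x) ^ 2 / den s x).
Definition u3 s x := K s ^ 2 *
  (b3 (label s x) * den s x + 2 * s * b1 (label s x) * b2 (label s x)
   + s ^ 2 * b1 (label s x) ^ 3 / den s x).
(** The stream function coefficient, that is the integral of [u] from [- PI]: passing to labels by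
    [dx = da / (K (1 - s b0(a)))] turns the second term of [u] into [Phi 1 / K^2]. *)
Definition F s x := (Phi 1 s (label s x) - K1 s * (x + PI)) / K s ^ 2.

Lemma den_pos s x : admissible s -> Ix x -> 0 < den s x.
Proof. intros. apply denominator_pos; auto. now apply label_spec. Qed.

Lemma label_comp_dx (f f' : R -> R) s x : admissible s -> Ix x ->
  (forall y, is_derive f y (f' y)) ->
  is_derive (fun x => f (label s x)) x (f' (label s x) * (K s * den s x)).
Proof.
  intros Hs Hx Hf. rewrite Rmult_comm.
  apply (is_derive_comp (K := R_AbsRing) (V := R_NormedModule) f (label s)); auto.
  now apply label_dx.
Qed.

Lemma den_dx s x : admissible s -> Ix x ->
  is_derive (den s) x (- s * (b1 (label s x) * (K s * den s x))).
Proof.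
  intros Hs Hx. unfold den at 1.
  replace (- s * (b1 (label s x) * (K s * den s x)))
    with (0 - s * (b1 (label s x) * (K s * den s x))) by ring.
  apply (is_derive_minusR (fun _ => 1) (fun x => s * b0 (label s x))).
  - apply (is_derive_const (K := R_AbsRing) (V := R_NormedModule)).
  - apply is_derive_scal. now apply label_comp_dx.
Qed.

Lemma u_dx s x : admissible s -> Ix x -> is_derive (u s) x (u1 s x).
Proof.
  intros Hs Hx. assert (D := den_pos s x Hs Hx). assert (Q := K_pos s Hs).
  assert (E0 := label_comp_dx b0 b1 s x Hs Hx Hb0). assert (E1 := den_dx s x Hs Hx).
  (* The quotient rule produces the factor [den + s b0], which equals 1; this is why [u1] has a
     single power of [den] and no [K]. *)
  assert (V : s * b0 (label s x) = 1 - den s x) by (unfold den; ring).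
  unfold u, u1. evar_last.
  - apply is_derive_const_plus, is_derive_div; [exact E0| |].
    + apply is_derive_scal. exact E1.
    + apply Rgt_not_eq. now apply Rmult_lt_0_compat.
  - transitivity (b1 (label s x) * (K s * den s x) ^ 2 * (den s x + s * b0 (label s x))
      / (den s x * (K s * den s x) ^ 2)); [field; lra|].
    rewrite V. field. lra.
Qed.

Lemma u1_dx s x : admissible s -> Ix x -> is_derive (u1 s) x (u2 s x).
Proof.
  intros Hs Hx. assert (D := den_pos s x Hs Hx). assert (Q := K_pos s Hs).
  unfold u1, u2. evar_last.
  - apply is_derive_div.
    + now apply (label_comp_dx b1 b2).
    + now apply den_dx.
    + lra.
  - simpl. eqR. field. lra.
Qed.

Lemma u2_dx s x : admissible s -> Ix x -> is_derive (u2 s) x (u3 s x).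
Proof.
  intros Hs Hx. assert (D := den_pos s x Hs Hx). assert (Q := K_pos s Hs).
  unfold u2, u3. evar_last.
  - apply is_derive_scal, is_derive_plusR.
    + now apply (label_comp_dx b2 b3).
    + apply is_derive_div.
      * apply is_derive_scal, is_derive_pow. now apply (label_comp_dx b1 b2).
      * now apply den_dx.
      * lra.
  - simpl. eqR. field. lra.
Qed.

Lemma Phi_label_dx n s x : admissible s -> Ix x ->
  is_derive (fun x => Phi n s (label s x)) x (b0 (label s x) ^ n * K s / den s x ^ n).
Proof.
  intros Hs Hx. assert (D := den_pos s x Hs Hx).
  destruct (label_spec s x Hs Hx) as [I _].
  evar_last.
  - apply (is_derive_compR (Phi n s) (label s)).
    + now apply Phi_da.
    + now apply label_dx.
  - fold (den s x). unfold g. rewrite c_id by auto. fold (den s x).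
    rewrite pow_inv, <- tech_pow_Rmult. eqR. field. split; [apply pow_nonzero|]; lra.
Qed.

Lemma F_dx s x : admissible s -> Ix x -> is_derive (F s) x (u s x).
Proof.
  intros Hs Hx. assert (D := den_pos s x Hs Hx). assert (Q := K_pos s Hs).
  unfold F, u, J.
  apply (is_derive_extR (fun x => / K s ^ 2 * (Phi 1 s (label s x) - K1 s * (x + PI)))).
  { intros; field; lra. }
  evar_last.
  - apply is_derive_scal, is_derive_minusR.
    + now apply Phi_label_dx.
    + apply is_derive_scal. apply (is_derive_plusR (fun x => x) (fun _ => PI)).
      * apply (is_derive_id (K := R_AbsRing)).
      * apply (is_derive_const (K := R_AbsRing) (V := R_NormedModule)).
  - unfold one, zero; simpl. eqR. field. lra.
Qed.

Lemma u_cont s x : admissible s -> Ix x -> continuous (u s) x.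
Proof. intros. eapply is_derive_cont. now apply u_dx. Qed.

Lemma RInt_u s x : admissible s -> Ix x -> RInt (fun y => u s y) (- PI) x = F s x.
Proof.
  intros Hs Hx. unfold Ix in Hx.
  rewrite (RInt_FTC (F s)).
  - unfold F at 2. rewrite label_start, Phi_start by auto.
    eqR. field. generalize (K_pos s Hs); lra.
  - lra.
  - intros y Hy. apply F_dx; auto. unfold Ix; lra.
  - intros y Hy. apply u_cont; auto. unfold Ix; lra.
Qed.

Lemma RInt_u_total s : admissible s -> RInt (fun y => u s y) (- PI) PI = 0.
Proof.
  intros Hs. generalize PI_RGT_0; intro.
  rewrite RInt_u by (auto; unfold Ix; lra).
  unfold F. rewrite label_end by auto. unfold K1. eqR. field.
  split; [|generalize (K_pos s Hs)]; lra.
Qed.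

Lemma RInt_u_sqr s : admissible s -> RInt (fun y => u s y ^ 2) (- PI) PI = PI * I s.
Proof.
  intros Hs. assert (P := PI_RGT_0). assert (Q := K_pos s Hs).
  (* Expanding the square of [- J + b0 / (K den)] gives three terms whose primitives in [x] are
     [x + PI], [Phi 1] and [Phi 2] at the label, by the same change of variables. *)
  rewrite (RInt_FTC (fun x => J s ^ 2 * (x + PI) - 2 * J s / K s ^ 2 * Phi 1 s (label s x)
                     + / K s ^ 3 * Phi 2 s (label s x))).
  - rewrite label_start, label_end, !Phi_start by auto.
    unfold I, J, K2, K1. eqR. field. lra.
  - lra.
  - intros x Hx. assert (Hx' : Ix x) by (unfold Ix; lra).
    assert (D := den_pos s x Hs Hx').
    evar_last.
    + apply is_derive_plusR; [apply is_derive_minusR|].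
      * apply is_derive_scal. apply (is_derive_plusR (fun x => x) (fun _ => PI)).
        -- apply (is_derive_id (K := R_AbsRing)).
        -- apply (is_derive_const (K := R_AbsRing) (V := R_NormedModule)).
      * apply is_derive_scal. now apply Phi_label_dx.
      * apply is_derive_scal. now apply Phi_label_dx.
    + unfold one, zero, u; simpl. eqR. field. lra.
  - intros x Hx. apply cont_pow, u_cont; auto.
Qed.

(** Since [dt = K ds], this says [dJ/dt = I]: the coefficient [J], defined through [K], is
    consistent with its role as the time integral of [I]. *)
Lemma J_derive s : admissible s -> is_derive J s (K s * I s).
Proof.
  intros Hs. assert (Q := K_pos s Hs). unfold J. evar_last.
  - apply is_derive_div.
    + now apply K1_derive.
    + apply is_derive_pow. now apply K_derive.
    + apply pow_nonzero. lra.
  - unfold I, J. simpl. eqR. field. lra.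
Qed.

Lemma I_cont s : admissible s -> continuous I s.
Proof.
  intros Hs. assert (Q := K_pos s Hs). unfold I. apply cont_minus.
  - apply cont_mult; [now apply K2_cont|]. apply cont_inv; [|apply pow_nonzero; lra].
    apply cont_pow. eapply is_derive_cont. now apply K_derive.
  - apply cont_mult; [apply continuous_const|]. apply cont_pow.
    eapply is_derive_cont. now apply J_derive.
Qed.

(** The nonlocal equation itself, multiplied by [dt/ds = K]. *)
Lemma u_ds s x : admissible s -> Ix x ->
  is_derive (fun s => u s x) s
    (K s * (u s x ^ 2 + J s * u s x - I s - F s x * u1 s x)).
Proof.
  intros Hs Hx. assert (D := den_pos s x Hs Hx). assert (Q := K_pos s Hs).
  assert (Hv : is_derive (fun s => b0 (label s x)) s
    ((K1 s * (x + PI) - Phi 1 s (label s x)) * den s x * b1 (label s x))).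
  { apply (is_derive_compR b0 (fun s => label s x)); auto. now apply label_ds. }
  assert (Hd : is_derive (fun s => den s x) s
    (0 - (1 * b0 (label s x) + s * ((K1 s * (x + PI) - Phi 1 s (label s x)) * den s x * b1 (label s x))))).
  { unfold den at 1. apply (is_derive_minusR (fun _ => 1) (fun s => s * b0 (label s x))).
    - apply (is_derive_const (K := R_AbsRing) (V := R_NormedModule)).
    - apply (Derive.is_derive_mult (fun s => s) (fun s => b0 (label s x))); auto. apply (is_derive_id (K := R_AbsRing)). }
  unfold u at 1.
  evar_last.
  - apply is_derive_plusR.
    + apply (is_derive_opp (K := R_AbsRing) (V := R_NormedModule)).
      now apply J_derive.
    + apply is_derive_div; [exact Hv| |].
      * apply (Derive.is_derive_mult K (fun s => den s x)); [now apply K_derive | exact Hd].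
      * apply Rgt_not_eq. now apply Rmult_lt_0_compat.
  - unfold opp; simpl. eqR. unfold u, u1, F, J.
    assert (V : s * b0 (label s x) = 1 - den s x) by (unfold den; ring).
    set (v := b0 (label s x)) in *. set (w := (K1 s * (x + PI) - Phi 1 s (label s x)) * den s x * b1 (label s x)).
    replace ((Phi 1 s (label s x) - K1 s * (x + PI)) / K s ^ 2 * (b1 (label s x) / den s x))
      with (- w / (K s ^ 2 * den s x ^ 2)) by (unfold w; field; lra).
    (* Here [w] carries the motion of the label and becomes the transport term. Its two occurrences
       combine with the factor [den + s v = 1]. *)
    replace (w * (K s * den s x) - v * (K1 s * den s x + K s * (0 - (1 * v + s * w))))
      with (w * K s * (den s x + s * v) - v * (K1 s * den s x - K s * v)) by ring.
    rewrite V. field. lra.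
Qed.

(** * Return to the original time, for any clock [S] with [S' = 1 / K(S)] *)

Section TimeChange.

Variables (S : R -> R) (T : R).
Hypothesis HT : 0 < T.
Hypothesis HS : forall t, It T t -> admissible (S t).
Hypothesis HSd : forall t, It T t -> is_derive S t (/ K (S t)).
Hypothesis HS0 : S 0 = 0.
Hypothesis Hmean : RInt b0 (- PI) PI = 0.

(** At [s = 0] the integrand of [Phi 0] is 1 and that of [Phi 1] is [b0], so [J 0] is the mean of
    [b0]. Its vanishing fixes both the initial value of [u] and the constant of integration of
    [J]. *)
Lemma K_zero_J_zero : K 0 = 1 /\ J 0 = 0.
Proof.
  assert (P := PI_RGT_0).
  assert (E : K 0 = 1).
  { unfold K, Phi. replace (RInt (g 0 0) (- PI) PI) with (2 * PI); [field; lra|].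
    rewrite (RInt_ext (V := R_CompleteNormedModule) (g 0 0) (fun _ => 1)).
    - rewrite RInt_const_R. ring.
    - intros x _. unfold g. simpl. field. }
  split; auto. unfold J. rewrite E. unfold K1, Phi.
  rewrite (RInt_ext (V := R_CompleteNormedModule) (g 1 0) b0).
  - rewrite Hmean. field. lra.
  - intros x Hx. rewrite Rmin_left, Rmax_right in Hx by lra.
    unfold g. rewrite c_id by (unfold Ix; lra). simpl. field.
Qed.

Lemma label_zero x : label 0 x = x.
Proof.
  assert (Hs : admissible 0) by (unfold admissible; lra).
  assert (E : flow 0 x = x).
  { unfold flow. rewrite (proj1 K_zero_J_zero). unfold Phi.
    rewrite (RInt_ext (V := R_CompleteNormedModule) (g 0 0) (fun _ => 1)).
    - rewrite RInt_const_R. field.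
    - intros y _. unfold g. simpl. field. }
  rewrite <- E at 1. now apply label_flow.
Qed.

Lemma u_initial x : u (S 0) x = b0 x.
Proof.
  destruct K_zero_J_zero as [EK EJ].
  unfold u, den. rewrite HS0, EK, EJ, label_zero. field.
Qed.

Lemma S_cont t : It T t -> continuous S t.
Proof. intros Ht. eapply is_derive_cont. now apply HSd. Qed.

Lemma time_comp (f f' : R -> R) t : It T t -> is_derive f (S t) (K (S t) * f' (S t)) ->
  is_derive (fun t => f (S t)) t (f' (S t)).
Proof.
  intros Ht Hf. replace (f' (S t)) with (/ K (S t) * (K (S t) * f' (S t))).
  - apply (is_derive_compR f S); auto.
  - field. generalize (K_pos (S t) (HS t Ht)). lra.
Qed.

Lemma RInt_RInt_u_sqr t : It T t ->
  RInt (fun s => RInt (fun y => u (S s) y ^ 2) (- PI) PI) 0 t = PI * J (S t).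
Proof.
  intros Ht.
  assert (HIt : forall s, 0 <= s <= t -> It T s) by (intros s Hs; unfold It in *; lra).
  rewrite (RInt_ext (V := R_CompleteNormedModule) _ (fun s => PI * I (S s))).
  - rewrite (RInt_FTC (fun s => PI * J (S s))).
    + rewrite HS0, (proj2 K_zero_J_zero). eqR. ring.
    + apply Ht.
    + intros s Hs. apply is_derive_scal. apply (time_comp J I); auto.
      apply J_derive. auto.
    + intros s Hs. apply cont_mult; [apply continuous_const|].
      apply (cont_comp I S); [apply S_cont | apply I_cont]; auto.
  - intros s Hs. destruct Ht. rewrite Rmin_left, Rmax_right in Hs by lra.
    apply RInt_u_sqr. apply HS, HIt. lra.
Qed.

Lemma cont2_in_pt (f : R -> R -> R) :
  (forall t x, It T t -> Ix x -> continuity_2d_pt f t x) -> cont2_in (It T) Ix f.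
Proof.
  intros H t x Ht Hx eps He. destruct (H t x Ht Hx (mkposreal eps He)) as [d D].
  exists d. split; [apply cond_pos|]. intros. now apply D.
Qed.

Lemma label_time_cont t x : It T t -> Ix x ->
  continuity_2d_pt (fun t x => label (S t) x) t x.
Proof.
  intros Ht Hx. apply (continuity_2d_comp2 label (fun t _ => S t) (fun _ x => x)).
  - apply label_cont2; auto.
  - apply continuity_2d_of_fst. now apply S_cont.
  - apply continuity_2d_pt_id2.
Qed.

Lemma comp_label_cont (f : R -> R) t x : It T t -> Ix x ->
  (forall y, continuous f y) -> continuity_2d_pt (fun t x => f (label (S t) x)) t x.
Proof.
  intros Ht Hx Hf. apply (continuity_2d_comp1 f (fun t x => label (S t) x)); auto.
  now apply label_time_cont.
Qed.

Lemma comp_time_cont (f : R -> R) t x : It T t -> continuous f (S t) ->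
  continuity_2d_pt (fun t _ => f (S t)) t x.
Proof.
  intros Ht Hf. apply continuity_2d_of_fst. apply cont_comp; auto. now apply S_cont.
Qed.

Lemma explicit_solution : is_solution T (fun t x => u (S t) x).
Proof.
  assert (CS : forall t x, It T t -> continuity_2d_pt (fun t _ => S t) t x).
  { intros. apply continuity_2d_of_fst. now apply S_cont. }
  assert (CK : forall t x, It T t -> continuity_2d_pt (fun t _ => K (S t)) t x).
  { intros. apply comp_time_cont; auto. eapply is_derive_cont, K_derive; auto. }
  assert (CJ : forall t x, It T t -> continuity_2d_pt (fun t _ => J (S t)) t x).
  { intros. apply comp_time_cont; auto. eapply is_derive_cont, J_derive; auto. }
  assert (CK1 : forall t x, It T t -> continuity_2d_pt (fun t _ => K1 (S t)) t x).
  { intros. apply comp_time_cont; auto. eapply is_derive_cont, K1_derive; auto. }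
  assert (CI : forall t x, It T t -> continuity_2d_pt (fun t _ => I (S t)) t x).
  { intros. apply comp_time_cont; auto. apply I_cont; auto. }
  assert (C0 : forall t x, It T t -> Ix x ->
    continuity_2d_pt (fun t x => b0 (label (S t) x)) t x).
  { intros. apply comp_label_cont; auto. intros; eapply is_derive_cont, Hb0. }
  assert (C1 : forall t x, It T t -> Ix x ->
    continuity_2d_pt (fun t x => b1 (label (S t) x)) t x).
  { intros. apply comp_label_cont; auto. intros; eapply is_derive_cont, Hb1. }
  assert (C2 : forall t x, It T t -> Ix x ->
    continuity_2d_pt (fun t x => b2 (label (S t) x)) t x).
  { intros. apply comp_label_cont; auto. intros; eapply is_derive_cont, Hb2. }
  assert (C3 : forall t x, It T t -> Ix x ->
    continuity_2d_pt (fun t x => b3 (label (S t) x)) t x).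
  { intros. apply comp_label_cont; auto. }
  assert (CP : forall t x, It T t -> Ix x ->
    continuity_2d_pt (fun t x => Phi 1 (S t) (label (S t) x)) t x).
  { intros t x Ht Hx.
    apply (continuity_2d_comp2 (Phi 1) (fun t _ => S t) (fun t x => label (S t) x)); auto.
    - apply Phi_cont2; auto.
    - now apply label_time_cont. }
  assert (CD : forall t x, It T t -> Ix x ->
    continuity_2d_pt (fun t x => den (S t) x) t x).
  { intros t x Ht Hx. unfold den. cont2. }
  assert (ND : forall t x, It T t -> Ix x -> den (S t) x <> 0).
  { intros t x Ht Hx. generalize (den_pos (S t) x (HS t Ht) Hx). lra. }
  assert (NK : forall t, It T t -> K (S t) <> 0).
  { intros t Ht. generalize (K_pos (S t) (HS t Ht)). lra. }
  assert (CU : forall t x, It T t -> Ix x -> continuity_2d_pt (fun t x => u (S t) x) t x).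
  { intros t x Ht Hx. unfold u. cont2. }
  assert (CU1 : forall t x, It T t -> Ix x -> continuity_2d_pt (fun t x => u1 (S t) x) t x).
  { intros t x Ht Hx. unfold u1. cont2. }
  exists (fun t x => u (S t) x ^ 2 + J (S t) * u (S t) x - I (S t) - F (S t) x * u1 (S t) x),
    (fun t x => u1 (S t) x), (fun t x => u2 (S t) x), (fun t x => u3 (S t) x).
  split; [|split; [|split; [|split; [|split; [|split; [|split]]]]]].
  - apply cont2_in_pt; auto.
  - apply cont2_in_pt. intros t x Ht Hx. unfold F. cont2; apply pow_nonzero; auto.
  - apply cont2_in_pt; auto.
  - apply cont2_in_pt. intros t x Ht Hx. unfold u2. cont2.
  - apply cont2_in_pt. intros t x Ht Hx. unfold u3. cont2.
  - intros t x Ht Hx. assert (A := HS t Ht). repeat split; apply is_derive_has_deriv_in.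
    + now apply u_dx.
    + now apply u1_dx.
    + now apply u2_dx.
    + apply (time_comp (fun s => u s x)
        (fun s => u s x ^ 2 + J s * u s x - I s - F s x * u1 s x)); auto.
      now apply u_ds.
  - intros t Ht. apply RInt_u_total; auto.
  - intros t x Ht Hx. rewrite RInt_u, RInt_u_sqr, RInt_RInt_u_sqr by auto.
    eqR. field. generalize PI_RGT_0; lra.
Qed.

End TimeChange.

End Explicit.

(** * Uniqueness *)

(** Clamped functions have corners at the endpoints, so the derivative is available only inside. The
    primitive minus [f] has zero derivative there and is compared in both directions by
    monotonicity. *)
Lemma RInt_FTC_open (f f' : R -> R) a b :
  a <= b -> (forall x, a < x < b -> is_derive f x (f' x)) ->
  (forall x, continuous f x) -> (forall x, continuous f' x) ->
  RInt f' a b = f b - f a.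
Proof.
  intros Hab H1 H2 H3.
  assert (Hi : forall x, is_derive (fun z => RInt f' a z) x (f' x))
    by (intros; now apply is_derive_RInt_cont).
  assert (Hic : forall x, continuous (fun z => RInt f' a z) x)
    by (intros; eapply is_derive_cont, Hi).
  assert (A := nonincreasing_of_derive (fun x => RInt f' a x - f x)
    (fun x => f' x - f' x) a b Hab).
  assert (B := nonincreasing_of_derive (fun x => f x - RInt f' a x)
    (fun x => f' x - f' x) a b Hab).
  assert (Z : RInt f' a a = 0) by exact (RInt_point (V := R_CompleteNormedModule) a f').
  cbv beta in A, B. rewrite Z in A, B.
  apply Rle_antisym.
  - assert (RInt f' a b - f b <= 0 - f a); [|lra].
    apply A.
    + intros x Hx. split; [apply is_derive_minusR; auto | lra].
    + intros x _. now apply cont_minus.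
  - assert (f b - RInt f' a b <= f a - 0); [|lra].
    apply B.
    + intros x Hx. split; [apply is_derive_minusR; auto | lra].
    + intros x _. now apply cont_minus.
Qed.

Lemma RInt_nonneg_cont (f : R -> R) a b :
  a <= b -> (forall x, continuous f x) -> (forall x, 0 <= f x) -> 0 <= RInt f a b.
Proof. intros. apply RInt_ge_0; auto. now apply ex_RInt_cont. Qed.

(** Cauchy-Schwarz against the constant 1, from the nonnegativity of the integral of [(f - l)^2]
    with [l] the mean of [f]. *)
Lemma RInt_sqr_le (f : R -> R) a b :
  a <= b -> (forall x, continuous f x) ->
  RInt f a b ^ 2 <= (b - a) * RInt (fun x => f x ^ 2) a b.
Proof.
  intros Hab Hf.
  destruct (Req_dec a b) as [->|Hne].
  { rewrite !RInt_point. unfold zero; simpl. lra. }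
  set (l := RInt f a b / (b - a)).
  assert (Hf2 : forall x, continuous (fun x => f x ^ 2) x) by (intros; now apply cont_pow).
  assert (H : 0 <= RInt (fun x => f x ^ 2 + (- 2 * l * f x + l ^ 2)) a b).
  { apply RInt_nonneg_cont; auto.
    - intros x. apply cont_plus; auto. apply cont_plus; [|apply continuous_const].
      apply cont_mult; auto. apply continuous_const.
    - intros x. replace (f x ^ 2 + (-2 * l * f x + l ^ 2)) with ((f x - l) ^ 2) by ring.
      apply pow2_ge_0. }
  rewrite (RInt_plus_cont (fun x => f x ^ 2) (fun x => - 2 * l * f x + l ^ 2)),
    (RInt_plus_cont (fun x => - 2 * l * f x) (fun _ => l ^ 2)), RInt_scal_cont,
    RInt_const_R in H; auto.
  - assert (E : RInt f a b = l * (b - a)) by (unfold l, Rdiv; rewrite Rmult_assoc, Rinv_l by lra; now rewrite Rmult_1_r).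
    rewrite E in H |- *. nra.
  - intros x. apply cont_mult; auto. apply continuous_const.
  - intros x. apply continuous_const.
  - intros x. apply cont_plus; [|apply continuous_const].
    apply cont_mult; auto. apply continuous_const.
Qed.

(* A solution restricted to a compact time interval [0, t1] and extended to the
   whole plane by clamping both arguments. *)
Record clamped_solution (t1 : R) (p pt px : R -> R -> R) : Prop := {
  cs_cont : forall s x, continuity_2d_pt p s x;
  cs_contt : forall s x, continuity_2d_pt pt s x;
  cs_contx : forall s x, continuity_2d_pt px s x;
  cs_dt : forall s x, 0 < s < t1 -> is_derive (fun s => p s x) s (pt s x);
  cs_dx : forall s x, - PI < x < PI -> is_derive (p s) x (px s x);
  cs_mean : forall s, RInt (p s) (- PI) PI = 0;
  cs_eq : forall s x, 0 <= s <= t1 -> Ix x ->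
    pt s x = p s x ^ 2 + / PI * RInt (fun s => RInt (fun y => p s y ^ 2) (- PI) PI) 0 s * p s x
      - / PI * RInt (fun y => p s y ^ 2) (- PI) PI - RInt (p s) (- PI) x * px s x }.

Lemma clamp_solution T b t1 : 0 <= t1 < T -> is_solution T b ->
  exists pt px,
    clamped_solution t1 (fun s x => b (clamp 0 t1 s) (clamp (- PI) PI x)) pt px.
Proof.
  intros Ht [bt [bx [bxx [bxxx [C0 [Ct [C1 [_ [_ [D [Hm He]]]]]]]]]]].
  assert (P := PI_RGT_0).
  assert (HT : forall s, It T (clamp 0 t1 s)).
  { intros s. generalize (clamp_in 0 t1 s ltac:(lra)). unfold It. lra. }
  exists (fun s x => bt (clamp 0 t1 s) (clamp (- PI) PI x)),
    (fun s x => bx (clamp 0 t1 s) (clamp (- PI) PI x)).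
  assert (EI : forall s x (f : R -> R), Ix x ->
    RInt (fun y => f (b s (clamp (- PI) PI y))) (- PI) x = RInt (fun y => f (b s y)) (- PI) x).
  { intros s x f Hx. unfold Ix in Hx.
    apply (RInt_ext (V := R_CompleteNormedModule)). intros y Hy.
    rewrite Rmin_left, Rmax_right in Hy by lra. rewrite clamp_id by lra. reflexivity. }
  assert (IP : Ix PI) by (unfold Ix; lra).
  split.
  - intros. apply (cont2_in_clamp T t1 b); auto.
  - intros. apply (cont2_in_clamp T t1 bt); auto.
  - intros. apply (cont2_in_clamp T t1 bx); auto.
  - intros s x Hs. rewrite (clamp_id 0 t1 s) by lra.
    apply (has_deriv_in_interior 0 t1); auto.
    apply (has_deriv_in_ext _ (fun s => b s (clamp (- PI) PI x))); [lra| |].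
    + intros y Hy. now rewrite (clamp_id 0 t1 y).
    + apply (has_deriv_in_sub (It T)); [unfold It; intros; lra|].
      apply D; [unfold It; lra|apply Ix_clamp].
  - intros s x Hx. rewrite (clamp_id (- PI) PI x) by lra.
    apply (has_deriv_in_interior (- PI) PI); auto.
    apply (has_deriv_in_ext _ (fun y => b (clamp 0 t1 s) y)); [lra| |].
    + intros y Hy. now rewrite (clamp_id (- PI) PI y).
    + apply D; [apply HT|unfold Ix; lra].
  - intros s. rewrite (EI _ _ (fun y => y)) by auto. apply Hm, HT.
  - intros s x Hs Hx. rewrite (clamp_id 0 t1 s), (clamp_id (- PI) PI x) by (auto; lra).
    rewrite (EI _ _ (fun y => y)), (EI _ _ (fun y => y ^ 2)) by auto.
    (* The memory integral runs over [[0, s]] with [s <= t1], where clamping the time changes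
       nothing. *)
    rewrite (RInt_ext (V := R_CompleteNormedModule)
      (fun s0 => RInt (fun y => b (clamp 0 t1 s0) (clamp (- PI) PI y) ^ 2) (- PI) PI)
      (fun s0 => RInt (fun y => b s0 y ^ 2) (- PI) PI)).
    + assert (E := He s x ltac:(unfold It; lra) Hx). unfold mult, plus in E; simpl in E.
      simpl. lra.
    + intros r Hr. rewrite Rmin_left, Rmax_right in Hr by lra.
      rewrite (clamp_id 0 t1 r) by lra. apply (EI _ _ (fun y => y ^ 2)); auto.
Qed.

(** * Energy estimate for the difference of two solutions *)

Section Energy.

Variables (t1 L : R) (p pt px q qt qx : R -> R -> R).
Hypothesis Ht1 : 0 <= t1.
Hypothesis Hp : clamped_solution t1 p pt px.
Hypothesis Hq : clamped_solution t1 q qt qx.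
Hypothesis Hinit : forall x, p 0 x = q 0 x.

Let Ip s := / PI * RInt (fun y => p s y ^ 2) (- PI) PI.
Let Iq s := / PI * RInt (fun y => q s y ^ 2) (- PI) PI.
Let Jp s := / PI * RInt (fun s => RInt (fun y => p s y ^ 2) (- PI) PI) 0 s.
Let Jq s := / PI * RInt (fun s => RInt (fun y => q s y ^ 2) (- PI) PI) 0 s.
Let w s x := p s x - q s x.
Let d s := Jp s - Jq s.
Let W (s : R) : R := RInt (fun x => w s x ^ 2) (- PI) PI.
Let phi (s x : R) : R := RInt (w s) (- PI) x.
Let Fq (s x : R) : R := RInt (q s) (- PI) x.

Hypothesis HL : 0 < L.
Hypothesis Lp : forall s x, 0 <= s <= t1 -> - PI <= x <= PI -> Rabs (p s x) <= L.
Hypothesis Lq : forall s x, 0 <= s <= t1 -> - PI <= x <= PI -> Rabs (q s x) <= L.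
Hypothesis Lx : forall s x, 0 <= s <= t1 -> - PI <= x <= PI -> Rabs (px s x) <= L.
Hypothesis LJ : forall s, 0 <= s <= t1 -> Rabs (Jp s) <= L.

Lemma slice_cont (f : R -> R -> R) s x :
  (forall s x, continuity_2d_pt f s x) -> continuous (f s) x.
Proof. intros. now apply continuity_2d_snd. Qed.

Lemma w_cont2 s x : continuity_2d_pt w s x.
Proof. apply continuity_2d_pt_minus; [apply (cs_cont _ _ _ _ Hp)|apply (cs_cont _ _ _ _ Hq)]. Qed.

Lemma sqr_RInt_cont (f : R -> R -> R) s :
  (forall s x, continuity_2d_pt f s x) ->
  continuous (fun s => RInt (fun y => f s y ^ 2) (- PI) PI) s.
Proof.
  intros Hf. apply (continuous_RInt_param (fun s y => f s y ^ 2)).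
  intros. now apply continuity_2d_pow.
Qed.

Lemma Jp_derive s : is_derive Jp s (Ip s).
Proof.
  apply (is_derive_scal (fun s => RInt (fun s => RInt (fun y => p s y ^ 2) (- PI) PI) 0 s)).
  apply (is_derive_RInt_cont (fun s => RInt (fun y => p s y ^ 2) (- PI) PI)).
  intros. apply sqr_RInt_cont, (cs_cont _ _ _ _ Hp).
Qed.

Lemma Jq_derive s : is_derive Jq s (Iq s).
Proof.
  apply (is_derive_scal (fun s => RInt (fun s => RInt (fun y => q s y ^ 2) (- PI) PI) 0 s)).
  apply (is_derive_RInt_cont (fun s => RInt (fun y => q s y ^ 2) (- PI) PI)).
  intros. apply sqr_RInt_cont, (cs_cont _ _ _ _ Hq).
Qed.

Lemma d_derive s : is_derive d s (Ip s - Iq s).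
Proof. apply is_derive_minusR; [apply Jp_derive|apply Jq_derive]. Qed.

Lemma W_derive s : 0 < s < t1 ->
  is_derive W s (RInt (fun x => 2 * w s x * (pt s x - qt s x)) (- PI) PI).
Proof.
  intros Hs.
  assert (Dw : forall r x, 0 < r < t1 ->
    is_derive (fun r => w r x ^ 2) r (2 * w r x * (pt r x - qt r x))).
  { intros r x Hr. replace (2 * w r x * (pt r x - qt r x))
      with (INR 2 * (pt r x - qt r x) * w r x ^ Init.Nat.pred 2) by (simpl; ring).
    apply (is_derive_pow (fun r => w r x)). apply is_derive_minusR.
    - now apply (cs_dt _ _ _ _ Hp).
    - now apply (cs_dt _ _ _ _ Hq). }
  assert (Lo : locally s (fun r => 0 < r < t1)).
  { apply (open_and (fun r => 0 < r) (fun r => r < t1)); auto.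
    - apply open_gt.
    - apply open_lt. }
  assert (Hc : forall r x, continuity_2d_pt (fun r x => 2 * w r x * (pt r x - qt r x)) r x).
  { intros r x. repeat apply continuity_2d_pt_mult.
    - apply continuity_2d_pt_const.
    - apply w_cont2.
    - apply continuity_2d_pt_minus; [apply (cs_contt _ _ _ _ Hp)|apply (cs_contt _ _ _ _ Hq)]. }
  replace (RInt (fun x => 2 * w s x * (pt s x - qt s x)) (- PI) PI)
    with (RInt (fun x => Derive (fun r => w r x ^ 2) s) (- PI) PI).
  2:{ apply (RInt_ext (V := R_CompleteNormedModule)). intros x _.
      apply is_derive_unique. now apply Dw. }
  apply (is_derive_RInt_param (fun r x => w r x ^ 2)).
  - revert Lo. apply filter_imp. intros r Hr x _. eexists. now apply Dw.
  - intros x _.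
    apply (continuity_2d_pt_ext_loc (fun r x => 2 * w r x * (pt r x - qt r x))); auto.
    destruct Lo as [e He]. exists e. intros r y Hr _. symmetry.
    apply is_derive_unique, Dw. now apply He.
  - apply filter_forall. intros r. apply ex_RInt_cont. intros x.
    apply cont_pow. now apply slice_cont, w_cont2.
Qed.

Lemma phi_sqr_le s x : Ix x -> phi s x ^ 2 <= 2 * PI * W s.
Proof.
  intros Hx. unfold Ix in Hx.
  assert (Hc : forall y, continuous (w s) y) by (intros; apply slice_cont, w_cont2).
  assert (Hc2 : forall y, continuous (fun y => w s y ^ 2) y) by (intros; now apply cont_pow).
  unfold phi, W. eapply Rle_trans; [apply RInt_sqr_le; auto; lra|].
  rewrite (RInt_Chasles_cont (fun y => w s y ^ 2) (- PI) x PI) by auto.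
  assert (0 <= RInt (fun y => w s y ^ 2) (- PI) x)
    by (apply RInt_nonneg_cont; auto using pow2_ge_0; lra).
  assert (0 <= RInt (fun y => w s y ^ 2) x PI)
    by (apply RInt_nonneg_cont; auto using pow2_ge_0; lra).
  nra.
Qed.

(** The integrand is the derivative of [Fq w^2], and [Fq] vanishes at both ends because [q] has mean
    zero. This removes the term that contains the derivative of [w], which the energy could not
    control. *)
Lemma transport_integral s :
  RInt (fun x => 2 * Fq s x * w s x * (px s x - qx s x) + q s x * w s x ^ 2) (- PI) PI = 0.
Proof.
  assert (P := PI_RGT_0).
  assert (Hw : forall y, continuous (w s) y) by (intros; apply slice_cont, w_cont2).
  assert (Hqc : forall y, continuous (q s) y) by (intros; apply slice_cont, (cs_cont _ _ _ _ Hq)).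
  assert (HF : forall y, is_derive (Fq s) y (q s y)) by (intros; now apply is_derive_RInt_cont).
  assert (HFc : forall y, continuous (Fq s) y) by (intros; eapply is_derive_cont, HF).
  rewrite (RInt_FTC_open (fun x => Fq s x * w s x ^ 2)).
  - unfold Fq. rewrite RInt_point, (cs_mean _ _ _ _ Hq). unfold zero; simpl. ring.
  - lra.
  - intros x Hx. evar_last.
    + apply (Derive.is_derive_mult (Fq s) (fun x => w s x ^ 2)); [apply HF|].
      apply is_derive_pow. apply is_derive_minusR.
      * now apply (cs_dx _ _ _ _ Hp).
      * now apply (cs_dx _ _ _ _ Hq).
    + simpl. eqR. unfold w. ring.
  - intros x. apply cont_mult; auto. now apply cont_pow.
  - intros x. apply cont_plus.
    + apply cont_mult; [apply cont_mult; auto; apply cont_mult; auto; apply continuous_const|].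
      apply cont_minus; apply slice_cont; [apply (cs_contx _ _ _ _ Hp)|apply (cs_contx _ _ _ _ Hq)].
    + apply cont_mult; auto. now apply cont_pow.
Qed.

Lemma RInt_w s x : phi s x = RInt (p s) (- PI) x - Fq s x.
Proof.
  assert (Hpc : forall y, continuous (p s) y) by (intros; apply slice_cont, (cs_cont _ _ _ _ Hp)).
  assert (Hqc : forall y, continuous (q s) y) by (intros; apply slice_cont, (cs_cont _ _ _ _ Hq)).
  unfold phi. rewrite (RInt_ext (V := R_CompleteNormedModule) (w s) (fun y => p s y + - 1 * q s y))
    by (intros; unfold w; simpl; eqR; ring).
  rewrite RInt_plus_cont, RInt_scal_cont; auto.
  - unfold Fq. eqR. ring.
  - intros y. apply cont_mult; auto. apply continuous_const.
Qed.

(** The difference [d] of the memory terms is not controlled by [W] at the same time. Adding [d^2]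
    to the energy closes the estimate, because [d'] is bounded by the [L^2] size of [w]. The two
    parts contribute the coefficients [11 + 4 PI^2] for [W] and [4 + 2 PI] for [d^2], and the
    constant of the statement dominates both. *)
Lemma energy_inequality s : 0 < s < t1 ->
  RInt (fun x => 2 * w s x * (pt s x - qt s x)) (- PI) PI + 2 * d s * (Ip s - Iq s)
  <= L * (15 + 2 * PI + 4 * PI ^ 2) * (W s + d s ^ 2).
Proof.
  intros Hs. assert (P := PI_RGT_0). assert (P3 : 1 < PI) by (generalize PI2_1; lra).
  assert (Hs' : 0 <= s <= t1) by lra.
  assert (Hw : forall y, continuous (w s) y) by (intros; apply slice_cont, w_cont2).
  assert (Hpc : forall y, continuous (p s) y) by (intros; apply slice_cont, (cs_cont _ _ _ _ Hp)).
  assert (Hqc : forall y, continuous (q s) y) by (intros; apply slice_cont, (cs_cont _ _ _ _ Hq)).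
  assert (Hpx : forall y, continuous (px s) y) by (intros; apply slice_cont, (cs_contx _ _ _ _ Hp)).
  assert (Hqx : forall y, continuous (qx s) y) by (intros; apply slice_cont, (cs_contx _ _ _ _ Hq)).
  assert (HFc : forall y, continuous (Fq s) y).
  { intros y. eapply is_derive_cont. now apply is_derive_RInt_cont. }
  assert (Hph : forall y, continuous (phi s) y).
  { intros y. eapply is_derive_cont. now apply is_derive_RInt_cont. }
  assert (Hw2 : forall y, continuous (fun y => w s y ^ 2) y) by (intros; now apply cont_pow).
  assert (Hcst : forall (k : R) (y : R), continuous (fun _ => k) y) by (intros; apply continuous_const).
  (* The integrand is split as [E - G - 2 (Ip - Iq) w], with [q w^2] added to [E] and to [G]. Then
     [G] integrates to zero by [transport_integral], the last term because [w] has mean zero, and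
     [E] contains no derivative of [w]. *)
  set (E := fun x => 2 * w s x * ((p s x + q s x) * w s x + Jp s * w s x + d s * q s x
                     - phi s x * px s x) + q s x * w s x ^ 2).
  assert (HE : forall y, continuous E y).
  { intros y. unfold E. apply cont_plus; [|now apply cont_mult].
    apply cont_mult; [now apply cont_mult|].
    apply cont_minus; [|now apply cont_mult].
    apply cont_plus; [|now apply cont_mult]. apply cont_plus; [|now apply cont_mult].
    apply cont_mult; auto. now apply cont_plus. }
  set (G := fun x => 2 * Fq s x * w s x * (px s x - qx s x) + q s x * w s x ^ 2).
  assert (HG : forall y, continuous G y).
  { intros y. unfold G. apply cont_plus; [|now apply cont_mult].
    apply cont_mult; [apply cont_mult; auto; now apply cont_mult|now apply cont_minus]. }
  rewrite (RInt_ext (V := R_CompleteNormedModule) _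
    (fun x => E x + (- 1 * G x + - 2 * (Ip s - Iq s) * w s x))).
  2:{ intros x Hx. rewrite Rmin_left, Rmax_right in Hx by lra.
      rewrite (cs_eq _ _ _ _ Hp s x), (cs_eq _ _ _ _ Hq s x) by (auto; unfold Ix; lra).
      fold (Jp s) (Jq s) (Ip s) (Iq s) (Fq s x). unfold E, G. rewrite RInt_w.
      unfold d, w. eqR. ring. }
  rewrite (RInt_plus_cont E), (RInt_plus_cont (fun x => - 1 * G x)), !RInt_scal_cont;
    auto; try (intros y; repeat first [solve [auto] | apply cont_plus | apply cont_mult]).
  unfold G at 1. rewrite transport_integral.
  fold (phi s PI). rewrite (RInt_w s PI). unfold Fq at 1.
  rewrite (cs_mean _ _ _ _ Hp), (cs_mean _ _ _ _ Hq).
  (* The coefficient 9 counts multiples of [L w^2]: 4 from [p + q], 2 from [Jp], 1 from each of the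
     two Young inequalities (with [d] and with [phi]), and 1 from [q w^2]. *)
  assert (A1 : RInt E (- PI) PI <=
    RInt (fun x => 9 * L * w s x ^ 2 + L * (d s ^ 2 + 2 * PI * W s)) (- PI) PI).
  { apply RInt_le_cont; auto; [lra| |].
    - intros y. apply cont_plus; auto. apply cont_mult; auto.
    - intros x Hx. unfold E.
      assert (B1 := Lp s x Hs' ltac:(lra)). assert (B2 := Lq s x Hs' ltac:(lra)).
      assert (B3 := Lx s x Hs' ltac:(lra)). assert (B4 := LJ s Hs').
      assert (B5 := phi_sqr_le s x ltac:(unfold Ix; lra)).
      apply Rabs_le_between in B1. apply Rabs_le_between in B2.
      apply Rabs_le_between in B3. apply Rabs_le_between in B4.
      assert (Y : forall a k m, - L <= k <= L -> 2 * a * m * k <= L * (a ^ 2 + m ^ 2)).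
      { intros a k m Hk.
        assert (0 <= (L - k) * (a + m) ^ 2) by (apply Rmult_le_pos; [lra|apply pow2_ge_0]).
        assert (0 <= (L + k) * (a - m) ^ 2) by (apply Rmult_le_pos; [lra|apply pow2_ge_0]).
        nra. }
      assert (Y1 := Y (w s x) (q s x) (d s) B2).
      assert (Y2 := Y (w s x) (- px s x) (phi s x) ltac:(lra)).
      assert (Z0 : 0 <= w s x ^ 2) by apply pow2_ge_0.
      assert (Z1 : 0 <= (L - p s x) * w s x ^ 2) by (apply Rmult_le_pos; lra).
      assert (Z2 : 0 <= (L - q s x) * w s x ^ 2) by (apply Rmult_le_pos; lra).
      assert (Z3 : 0 <= (L - Jp s) * w s x ^ 2) by (apply Rmult_le_pos; lra).
      assert (Z4 : L * phi s x ^ 2 <= L * (2 * PI * W s)) by (apply Rmult_le_compat_l; lra).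
      clear - Y1 Y2 Z1 Z2 Z3 Z4. clearbody w d Jp phi W. lra. }
  assert (HW : forall k m, RInt (fun x => k * w s x ^ 2 + m) (- PI) PI = k * W s + 2 * PI * m).
  { intros k m. rewrite (RInt_plus_cont (fun x => k * w s x ^ 2) (fun _ => m)), RInt_scal_cont,
      RInt_const_R; auto.
    - unfold W. eqR. ring.
    - intros y. apply cont_mult; auto. }
  rewrite HW in A1.
  assert (A2 : 2 * d s * (Ip s - Iq s) <= / PI * (2 * L * W s + 2 * PI * (2 * L * d s ^ 2))).
  { rewrite <- HW.
    replace (2 * d s * (Ip s - Iq s)) with
      (/ PI * RInt (fun x => 2 * d s * (p s x + q s x) * w s x) (- PI) PI).
    - apply Rmult_le_compat_l; [apply Rlt_le, Rinv_0_lt_compat; lra|].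
      apply RInt_le_cont; [lra| | |].
      + intros y. apply cont_mult; auto. apply cont_mult; auto. now apply cont_plus.
      + intros y. apply cont_plus; auto. apply cont_mult; auto.
      + intros x Hx.
        assert (B1 := Lp s x Hs' ltac:(lra)). assert (B2 := Lq s x Hs' ltac:(lra)).
        apply Rabs_le_between in B1. apply Rabs_le_between in B2.
        assert (0 <= (2 * L - (p s x + q s x)) * (d s + w s x) ^ 2)
          by (apply Rmult_le_pos; [lra|apply pow2_ge_0]).
        assert (0 <= (2 * L + (p s x + q s x)) * (d s - w s x) ^ 2)
          by (apply Rmult_le_pos; [lra|apply pow2_ge_0]).
        nra.
    - unfold Ip, Iq.
      rewrite (RInt_ext (V := R_CompleteNormedModule) _
        (fun x => 2 * d s * p s x ^ 2 + (- 2 * d s) * q s x ^ 2)).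
      + rewrite RInt_plus_cont, !RInt_scal_cont.
        * eqR. ring.
        * intros y. now apply cont_pow.
        * intros y. now apply cont_pow.
        * intros y. apply cont_mult; auto. now apply cont_pow.
        * intros y. apply cont_mult; auto. now apply cont_pow.
      + intros x _. unfold w. simpl. eqR. ring. }
  assert (HW0 : 0 <= W s) by (apply RInt_nonneg_cont; auto using pow2_ge_0; lra).
  assert (Hd0 : 0 <= d s ^ 2) by apply pow2_ge_0.
  assert (A3 : / PI * (2 * L * W s + 2 * PI * (2 * L * d s ^ 2)) <= 2 * L * W s + 4 * L * d s ^ 2).
  { replace (/ PI * (2 * L * W s + 2 * PI * (2 * L * d s ^ 2)))
      with (/ PI * (2 * L * W s) + 4 * L * d s ^ 2) by (field; lra).
    assert (/ PI <= 1) by (rewrite <- Rinv_1; apply Rinv_le_contravar; lra).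
    assert (0 <= 2 * L * W s) by nra. nra. }
  assert (0 <= L * W s) by nra. assert (0 <= L * d s ^ 2) by nra.
  assert (0 <= PI * (L * W s)) by nra. assert (0 <= PI * (L * d s ^ 2)) by nra.
  assert (0 <= PI ^ 2 * (L * d s ^ 2)) by (apply Rmult_le_pos; [apply pow2_ge_0|auto]).
  eapply Rle_trans; [apply Rplus_le_compat; [|exact A2]|].
  - instantiate (1 := 9 * L * W s + 2 * PI * (L * (d s ^ 2 + 2 * PI * W s))). lra.
  - eapply Rle_trans; [apply Rplus_le_compat_l; exact A3|]. nra.
Qed.

Lemma clamped_solutions_agree s x : 0 <= s <= t1 -> Ix x -> p s x = q s x.
Proof.
  intros Hs Hx. assert (P := PI_RGT_0).
  assert (HW0 : forall r, 0 <= W r).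
  { intros r. apply RInt_nonneg_cont; auto using pow2_ge_0; [lra|].
    intros y. apply cont_pow. now apply slice_cont, w_cont2. }
  assert (Y : W s + d s ^ 2 = 0).
  { apply (gronwall_zero (fun s => W s + d s ^ 2)
      (fun s => RInt (fun x => 2 * w s x * (pt s x - qt s x)) (- PI) PI + 2 * d s * (Ip s - Iq s))
      (L * (15 + 2 * PI + 4 * PI ^ 2)) t1); auto.
    - intros r _. apply cont_plus; [apply sqr_RInt_cont, w_cont2|].
      apply cont_pow. eapply is_derive_cont, d_derive.
    - intros r Hr. split; [|now apply energy_inequality].
      apply is_derive_plusR; [now apply W_derive|].
      replace (2 * d r * (Ip r - Iq r)) with (INR 2 * (Ip r - Iq r) * d r ^ Init.Nat.pred 2)
        by (simpl; ring).
      apply is_derive_pow, d_derive.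
    - intros r _. generalize (HW0 r) (pow2_ge_0 (d r)). lra.
    - unfold d, Jp, Jq. rewrite !RInt_point. unfold W.
      rewrite (RInt_ext (V := R_CompleteNormedModule) _ (fun _ => 0)).
      + rewrite RInt_const_R. unfold zero; simpl. ring.
      + intros y _. unfold w. rewrite Hinit. eqR. ring. }
  assert (W s = 0) by (generalize (HW0 s) (pow2_ge_0 (d s)); lra).
  assert (Hw : forall y, continuous (w s) y) by (intros; apply slice_cont, w_cont2).
  (* A vanishing [L^2] norm gives pointwise vanishing through the primitive: [phi] is zero on the
     interval, so its derivative [w] is zero inside. *)
  assert (Z : forall y, Ix y -> phi s y = 0).
  { intros y Hy. assert (Q := phi_sqr_le s y Hy).
    assert (phi s y ^ 2 = 0) by (generalize (pow2_ge_0 (phi s y)); nra). nra. }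
  assert (Zi : forall y, - PI < y < PI -> w s y = 0).
  { intros y Hy.
    rewrite <- (is_derive_unique _ _ _ (is_derive_RInt_cont (w s) (- PI) y Hw)).
    rewrite (Derive_ext_loc _ (fun _ => 0)); [apply Derive_const|].
    assert (Lo : locally y (fun z => - PI < z < PI)).
    { apply (open_and (fun r => - PI < r) (fun r => r < PI)); auto.
      - apply open_gt.
      - apply open_lt. }
    revert Lo. apply filter_imp. intros z Hz. apply Z. unfold Ix; lra. }
  enough (w s x = 0) by (unfold w in *; lra).
  destruct (Req_dec (w s x) 0) as [E|E]; auto. exfalso.
  destruct (proj1 (continuous_eps (w s) x) (Hw x) (Rabs (w s x))) as [e [He H']].
  { now apply Rabs_pos_lt. }
  (* For an endpoint [x], the point [(1 - k) x] is interior and within [e] of [x], so continuity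
     carries the zero over. *)
  set (k := Rmin (e / (2 * PI)) (1 / 2)).
  assert (Pk : 0 < k) by (apply Rmin_glb_lt; [apply Rdiv_lt_0_compat; lra|lra]).
  assert (k1 : k <= e / (2 * PI)) by apply Rmin_l.
  assert (k2 : k <= 1 / 2) by apply Rmin_r.
  assert (k3 : k * PI < e).
  { apply Rmult_le_compat_r with (r := PI) in k1; [|lra].
    replace (e / (2 * PI) * PI) with (e / 2) in k1 by (field; lra). lra. }
  unfold Ix in Hx.
  specialize (H' ((1 - k) * x)).
  rewrite (Zi ((1 - k) * x)) in H' by nra.
  replace (0 - w s x) with (- w s x) in H' by ring. rewrite Rabs_Ropp in H'.
  apply (Rlt_irrefl (Rabs (w s x))). apply H'.
  replace ((1 - k) * x - x) with (- (k * x)) by ring.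
  rewrite Rabs_Ropp, Rabs_mult, (Rabs_right k) by lra.
  assert (Rabs x <= PI) by (apply Rabs_le; lra). nra.
Qed.

End Energy.

Lemma solution_unique T b b' : is_solution T b -> is_solution T b' ->
  (forall x, Ix x -> b 0 x = b' 0 x) ->
  forall t x, It T t -> Ix x -> b t x = b' t x.
Proof.
  intros Hb Hb' H0 t x Ht Hx.
  destruct (clamp_solution T b t Ht Hb) as [pt [px Hp]].
  destruct (clamp_solution T b' t Ht Hb') as [qt [qx Hq]].
  assert (P := PI_RGT_0). destruct Ht as [Ht0 HtT].
  set (p := fun s x => b (clamp 0 t s) (clamp (- PI) PI x)) in *.
  set (q := fun s x => b' (clamp 0 t s) (clamp (- PI) PI x)) in *.
  destruct (bounded_2d p 0 t (- PI) PI) as [L1 [P1 B1]]; try lra; [apply Hp|].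
  destruct (bounded_2d q 0 t (- PI) PI) as [L2 [P2 B2]]; try lra; [apply Hq|].
  destruct (bounded_2d px 0 t (- PI) PI) as [L3 [P3 B3]]; try lra; [apply Hp|].
  set (Jp := fun s => / PI * RInt (fun s => RInt (fun y => p s y ^ 2) (- PI) PI) 0 s).
  destruct (bounded_2d (fun s _ => Jp s) 0 t 0 0) as [L4 [P4 B4]]; try lra.
  { intros s y. apply continuity_2d_of_fst. eapply is_derive_cont.
    apply (is_derive_scal (fun s => RInt (fun s => RInt (fun y => p s y ^ 2) (- PI) PI) 0 s)).
    apply (is_derive_RInt_cont (fun s => RInt (fun y => p s y ^ 2) (- PI) PI)).
    intros r. apply sqr_RInt_cont. apply Hp. }
  set (L := L1 + L2 + L3 + L4).
  assert (E : p t x = q t x).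
  { apply (clamped_solutions_agree t L p pt px q qt qx); auto; try lra.
    - intros y. unfold p, q. rewrite clamp_id by lra. apply H0. apply Ix_clamp.
    - unfold L; lra.
    - intros s y Hs Hy. generalize (B1 s y Hs Hy). unfold L; lra.
    - intros s y Hs Hy. generalize (B2 s y Hs Hy). unfold L; lra.
    - intros s y Hs Hy. generalize (B3 s y Hs Hy). unfold L; lra.
    - intros s Hs. generalize (B4 s 0 Hs ltac:(lra)). unfold L, Jp; lra. }
  unfold p, q in E. rewrite !clamp_id in E by (auto; lra). exact E.
Qed.

Lemma is_solution_restrict T T' b : T' <= T -> is_solution T b -> is_solution T' b.
Proof.
  intros HT [bt [b1 [b2 [b3 [C0 [C1 [C2 [C3 [C4 [D [Hm He]]]]]]]]]]].
  assert (I : forall t, It T' t -> It T t) by (unfold It; intros; lra).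
  assert (C : forall g, cont2_in (It T) Ix g -> cont2_in (It T') Ix g).
  { intros g Hg t x Ht Hx eps Heps. destruct (Hg t x (I t Ht) Hx eps Heps) as [d [Hd H]].
    exists d; split; auto. }
  exists bt, b1, b2, b3. repeat (split; [now apply C|]). split; [|split; auto].
  intros t x Ht Hx. destruct (D t x (I t Ht) Hx) as [D1 [D2 [D3 D4]]].
  repeat split; auto. now apply (has_deriv_in_sub (It T)).
Qed.

(** Serves maximality: a solution that lived beyond the blow-up time would be bounded up to that
    time. *)
Lemma solution_bounded T b t1 : 0 <= t1 < T -> is_solution T b ->
  exists L, forall t x, 0 <= t <= t1 -> Ix x -> Rabs (b t x) <= L.
Proof.
  intros Ht Hb. destruct (clamp_solution T b t1 Ht Hb) as [pt [px Hp]].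
  destruct (bounded_2d _ 0 t1 (- PI) PI ltac:(lra) ltac:(generalize PI_RGT_0; lra)
    (cs_cont _ _ _ _ Hp)) as [L [_ H]].
  exists L. intros t x H1 H2. generalize (H t x H1 H2). rewrite !clamp_id; auto.
Qed.

(** * Asymptotics near the blow-up time *)

Lemma atan_le_id z : 0 <= z -> atan z <= z.
Proof.
  intros Hz.
  assert (H : atan z - z <= atan 0 - 0); [|rewrite atan_0 in H; lra].
  apply (nonincreasing_of_derive (fun z => atan z - z) (fun z => / (1 + z²) - 1)); auto.
  - intros x Hx. split.
    + apply is_derive_minusR; [apply is_derive_atan|apply (is_derive_id (K := R_AbsRing))].
    + assert (/ (1 + x²) <= 1); [|lra].
      rewrite <- Rinv_1. apply Rinv_le_contravar; [lra|]. generalize (Rle_0_sqr x); lra.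
  - intros x _. apply cont_minus; [|apply continuous_id].
    eapply is_derive_cont, is_derive_atan.
Qed.

Lemma atan_near_half_PI z : 0 < z -> PI / 2 - / z <= atan z.
Proof.
  intros Hz. assert (H := atan_inv z Hz).
  assert (H' : 0 < / z) by now apply Rinv_0_lt_compat.
  generalize (atan_le_id (/ z) ltac:(lra)). lra.
Qed.

Lemma sin_lipschitz x y : Rabs (sin x - sin y) <= Rabs (x - y).
Proof.
  rewrite <- (Rmult_1_l (Rabs (x - y))).
  apply (bounded_variation sin cos). intros t _. split.
  - apply is_derive_Reals, derivable_pt_lim_sin.
  - apply Rabs_le. generalize (COS_bound t). lra.
Qed.

(** The half-angle identity is what turns the Lorentzian profile of the slope into a sine
    exactly. *)
Lemma sin_double_atan t : sin (2 * atan t) = 2 * t / (1 + t ^ 2).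
Proof.
  rewrite sin_2a.
  assert (P : 0 < 1 + t ^ 2) by (generalize (pow2_ge_0 t); lra).
  replace (sin (atan t)) with (t * cos (atan t)).
  - replace (2 * (t * cos (atan t)) * cos (atan t)) with (2 * t * (cos (atan t) * cos (atan t))) by ring.
    rewrite cos_atan. replace (1 + t²) with (1 + t ^ 2) by (unfold Rsqr; ring).
    replace (1 / sqrt (1 + t ^ 2) * (1 / sqrt (1 + t ^ 2))) with (/ (sqrt (1 + t ^ 2) * sqrt (1 + t ^ 2))).
    + rewrite sqrt_sqrt by lra. reflexivity.
    + field. apply Rgt_not_eq. now apply sqrt_lt_R0.
  - assert (0 < cos (atan t)) by (apply cos_gt_0; generalize (atan_bound t); lra).
    rewrite <- (tan_atan t) at 1. unfold tan. field. lra.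
Qed.

Lemma RInt_lorentz (r s y0 a b : R) : 0 < r -> 0 < s -> a <= b ->
  RInt (fun x => / (s ^ 2 + r ^ 2 * (x - y0) ^ 2)) a b
  = (atan (r * (b - y0) / s) - atan (r * (a - y0) / s)) / (r * s).
Proof.
  intros Hr Hs Hab.
  assert (Q : forall x, 0 < s ^ 2 + r ^ 2 * (x - y0) ^ 2).
  { intros x. generalize (pow2_ge_0 (r * (x - y0))). nra. }
  rewrite (RInt_FTC (fun x => / (r * s) * atan (r * (x - y0) / s))).
  - eqR. field. lra.
  - auto.
  - intros x _. specialize (Q x). evar_last.
    + apply is_derive_scal.
      apply (is_derive_compR atan (fun x => r * (x - y0) / s)); [apply is_derive_atan|].
      instantiate (1 := r / s). auto_derive; auto. field. lra.
    + eqR. unfold Rsqr. field. repeat split; try lra; nra.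
  - intros x _. specialize (Q x). apply cont_inv; [|lra].
    apply (ex_derive_continuous (fun x => s ^ 2 + r ^ 2 * (x - y0) ^ 2)). auto_derive; auto.
Qed.

(** * Comparison of [1 - s b0] with a Lorentzian profile *)

Section Asymptotics.

Variables (b0 b1 : R -> R) (M B a0 k C0 c1 : R).
Hypothesis Hb0 : forall x, is_derive b0 x (b1 x).
Hypothesis HMB : forall x, Ix x -> - B <= b0 x <= M.
Hypothesis HM : 0 < M.
Hypothesis HB : 0 < B.
Hypothesis Ha0 : - PI < a0 < PI.
Hypothesis Hk : 0 < k.
Hypothesis HC0 : 0 < C0.
Hypothesis Hc1 : 0 < c1.
Hypothesis H1 : forall x, Ix x -> c1 * (x - a0) ^ 2 <= M - b0 x.
Hypothesis H2 : forall x, Ix x ->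
  Rabs (M - b0 x - k / 2 * (x - a0) ^ 2) <= C0 * (Rabs (x - a0) * (x - a0) ^ 2).
Hypothesis H3 : forall x, Ix x -> Rabs (b1 x + k * (x - a0)) <= C0 * (x - a0) ^ 2.

(** Solves [1 - s M = sg^2] for [s]. The argument is the peak width [sg]; the estimates below
    evaluate it at [rho ^ 2]. *)
Definition s_of (rho : R) := (1 - rho ^ 2) / M.

Let C1 := k / 2 + 2 * PI * C0.
(** Near the maximum [M - b0] is about [k / 2 * (x - a0)^2] and [s] is about [1 / M], so the
    denominator [D] is modelled by [D0] with this [r]; [q] is the reference size of both. *)
Let r := sqrt (k / (2 * M)).
Let D0 sg x := sg ^ 2 + r ^ 2 * (x - a0) ^ 2.
Let D sg x := 1 - s_of sg * b0 x.
Let q sg x := sg ^ 2 + (x - a0) ^ 2.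

Lemma r_pos : 0 < r.
Proof. apply sqrt_lt_R0. apply Rdiv_lt_0_compat; lra. Qed.

Lemma r_sqr : r ^ 2 = k / (2 * M).
Proof. unfold r. simpl. rewrite Rmult_1_r. apply sqrt_sqrt. left. apply Rdiv_lt_0_compat; lra. Qed.

Lemma C1_pos : 0 < C1.
Proof. unfold C1. generalize PI_RGT_0. nra. Qed.

Lemma dist_le x : Ix x -> Rabs (x - a0) <= 2 * PI.
Proof. unfold Ix. intros. apply Rabs_le. lra. Qed.

Lemma gap_le x : Ix x -> M - b0 x <= C1 * (x - a0) ^ 2.
Proof.
  intros Hx. assert (A := H2 x Hx). apply Rabs_le_between in A.
  assert (E := dist_le x Hx). assert (0 <= (x - a0) ^ 2) by apply pow2_ge_0.
  assert (Rabs (x - a0) * (x - a0) ^ 2 <= 2 * PI * (x - a0) ^ 2) by (apply Rmult_le_compat_r; auto).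
  unfold C1. nra.
Qed.

Lemma D_split sg x : D sg x = sg ^ 2 + (1 - sg ^ 2) / M * (M - b0 x).
Proof. unfold D, s_of. field. lra. Qed.

Lemma s_of_admissible sg : 0 < sg <= 1 -> admissible M B (s_of sg).
Proof.
  intros Hs. unfold admissible, s_of.
  assert (0 <= (1 - sg ^ 2) / M).
  { apply Rmult_le_pos; [nra|]. left. now apply Rinv_0_lt_compat. }
  split; [|nra].
  replace ((1 - sg ^ 2) / M * M) with (1 - sg ^ 2) by (field; lra). nra.
Qed.

Lemma D_bounds : exists c2 C5, 0 < c2 /\ 0 < C5 /\
  forall sg x, 0 < sg <= 1 -> Ix x ->
    c2 * q sg x <= D sg x <= C5 * q sg x /\ c2 * q sg x <= D0 sg x.
Proof.
  assert (P := PI_RGT_0). assert (Pr := r_pos). assert (PC := C1_pos).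
  assert (PMi : 0 < c1 / M) by (apply Rdiv_lt_0_compat; lra).
  assert (Pp : 0 < / (8 * PI ^ 2)) by (apply Rinv_0_lt_compat; nra).
  assert (Pr2 : 0 < r ^ 2) by nra.
  (* When [sg] is near 1 the factor [1 - sg^2] degenerates and [sg^2] alone has to dominate. The
     first two bounds give [c2 <= 1/2] and [c2 (x - a0)^2 <= 1/2], which is what this needs; the
     other two compare the quadratic terms of [D] and [D0]. *)
  set (c2 := Rmin (Rmin (1 / 2) (/ (8 * PI ^ 2))) (Rmin (c1 / M) (r ^ 2))).
  exists c2, (1 + C1 / M).
  assert (L1 : c2 <= 1 / 2) by (eapply Rle_trans; [apply Rmin_l|apply Rmin_l]).
  assert (L2 : c2 <= / (8 * PI ^ 2)) by (eapply Rle_trans; [apply Rmin_l|apply Rmin_r]).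
  assert (L3 : c2 <= c1 / M) by (eapply Rle_trans; [apply Rmin_r|apply Rmin_l]).
  assert (L4 : c2 <= r ^ 2) by (eapply Rle_trans; [apply Rmin_r|apply Rmin_r]).
  assert (Pc : 0 < c2) by (repeat apply Rmin_glb_lt; lra).
  assert (PCM : 0 < C1 / M) by (apply Rdiv_lt_0_compat; lra).
  split; auto. split; [lra|].
  intros sg x Hs Hx.
  assert (Y : 0 <= (x - a0) ^ 2) by apply pow2_ge_0.
  assert (S2 : 0 < sg ^ 2 <= 1) by nra.
  unfold q. rewrite D_split. repeat split.
  - assert (A : c1 / M * (x - a0) ^ 2 <= / M * (M - b0 x)).
    { replace (c1 / M * (x - a0) ^ 2) with (/ M * (c1 * (x - a0) ^ 2)) by (field; lra).
      apply Rmult_le_compat_l; [left; now apply Rinv_0_lt_compat|auto]. }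
    assert (A2 : c2 * (x - a0) ^ 2 <= / M * (M - b0 x)) by nra.
    assert (A3 : c2 * (x - a0) ^ 2 <= 1 / 2).
    { assert (E := dist_le x Hx). apply Rabs_le_between in E.
      assert ((x - a0) ^ 2 <= 4 * PI ^ 2) by nra.
      apply Rle_trans with (/ (8 * PI ^ 2) * (4 * PI ^ 2)).
      - apply Rmult_le_compat; lra.
      - right. field. lra. }
    replace ((1 - sg ^ 2) / M * (M - b0 x)) with ((1 - sg ^ 2) * (/ M * (M - b0 x))) by (field; lra).
    assert ((1 - sg ^ 2) * (c2 * (x - a0) ^ 2) <= (1 - sg ^ 2) * (/ M * (M - b0 x)))
      by (apply Rmult_le_compat_l; lra).
    nra.
  - assert (A := gap_le x Hx).
    assert (A0 : 0 <= M - b0 x) by (generalize (HMB x Hx); lra).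
    assert ((1 - sg ^ 2) / M * (M - b0 x) <= C1 / M * (x - a0) ^ 2).
    { replace ((1 - sg ^ 2) / M * (M - b0 x)) with (/ M * ((1 - sg ^ 2) * (M - b0 x))) by (field; lra).
      replace (C1 / M * (x - a0) ^ 2) with (/ M * (C1 * (x - a0) ^ 2)) by (field; lra).
      apply Rmult_le_compat_l; [left; now apply Rinv_0_lt_compat|]. nra. }
    assert (0 <= C1 / M * sg ^ 2) by (apply Rmult_le_pos; lra).
    nra.
  - unfold D0. nra.
Qed.

(** With [z = |x - a0|], the numerator [D0 - D] consists of the cubic Taylor error and [sg^2] times
    the gap, hence is of order [z q + q^2]. The product [D D0] is at least [c2^2 q^2]. *)
Lemma inverse_difference : exists C2, 0 < C2 /\
  forall sg x, 0 < sg <= 1 -> Ix x ->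
    Rabs (/ D sg x - / D0 sg x) <= C2 * (Rabs (x - a0) / q sg x + 1).
Proof.
  assert (PC := C1_pos).
  destruct D_bounds as [c2 [C5 [P2 [P5 H]]]].
  exists ((C0 + C1) / (M * c2 ^ 2)). split.
  { apply Rdiv_lt_0_compat; [lra|]. apply Rmult_lt_0_compat; [lra|now apply pow_lt]. }
  intros sg x Hs Hx. destruct (H sg x Hs Hx) as [[L1 _] L2].
  assert (Y : 0 <= (x - a0) ^ 2) by apply pow2_ge_0.
  assert (Pq : 0 < q sg x) by (unfold q; nra).
  assert (Pd : 0 < D sg x) by nra. assert (Pd0 : 0 < D0 sg x) by nra.
  replace (/ D sg x - / D0 sg x) with ((D0 sg x - D sg x) / (D sg x * D0 sg x)) by (field; lra).
  unfold Rdiv at 1. rewrite Rabs_mult, (Rabs_right (/ (_ * _))).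
  2:{ apply Rle_ge. left. apply Rinv_0_lt_compat. now apply Rmult_lt_0_compat. }
  set (z := Rabs (x - a0)).
  assert (Z : 0 <= z) by apply Rabs_pos.
  assert (Z2 : z ^ 2 = (x - a0) ^ 2) by (unfold z; apply pow2_abs).
  assert (N : Rabs (D0 sg x - D sg x) <= (C0 + C1) / M * (z * q sg x + q sg x ^ 2)).
  { assert (E : D0 sg x - D sg x =
      - / M * (M - b0 x - k / 2 * (x - a0) ^ 2) + / M * (sg ^ 2 * (M - b0 x))).
    { rewrite D_split. unfold D0. rewrite r_sqr. field. lra. }
    rewrite E. eapply Rle_trans; [apply Rabs_triang|].
    rewrite !Rabs_mult, Rabs_Ropp, (Rabs_right (/ M))
      by (apply Rle_ge; left; now apply Rinv_0_lt_compat).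
    assert (A := gap_le x Hx). assert (A0 : 0 <= M - b0 x) by (generalize (HMB x Hx); lra).
    rewrite (Rabs_right (sg ^ 2)), (Rabs_right (M - b0 x)) by (apply Rle_ge; auto; nra).
    replace ((C0 + C1) / M * (z * q sg x + q sg x ^ 2)) with
      (/ M * ((C0 + C1) * (z * q sg x)) + / M * ((C0 + C1) * q sg x ^ 2)) by (field; lra).
    apply Rplus_le_compat; (apply Rmult_le_compat_l; [left; now apply Rinv_0_lt_compat|]).
    - eapply Rle_trans; [apply H2; auto|]. fold z.
      assert (z * (x - a0) ^ 2 <= z * q sg x) by (apply Rmult_le_compat_l; auto; unfold q; nra).
      assert (0 <= z * q sg x) by nra. nra.
    - assert (sg ^ 2 * (x - a0) ^ 2 <= q sg x ^ 2).
      { unfold q. assert (0 <= sg ^ 2) by nra. nra. }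
      assert (0 <= q sg x ^ 2) by apply pow2_ge_0.
      assert (sg ^ 2 * (M - b0 x) <= sg ^ 2 * (C1 * (x - a0) ^ 2)) by (apply Rmult_le_compat_l; nra).
      nra. }
  assert (I : / (D sg x * D0 sg x) <= / (c2 ^ 2 * q sg x ^ 2)).
  { apply Rinv_le_contravar; [|].
    - apply Rmult_lt_0_compat; now apply pow_lt.
    - replace (c2 ^ 2 * q sg x ^ 2) with ((c2 * q sg x) * (c2 * q sg x)) by ring.
      apply Rmult_le_compat; nra. }
  apply Rle_trans with ((C0 + C1) / M * (z * q sg x + q sg x ^ 2) * / (c2 ^ 2 * q sg x ^ 2)).
  - apply Rmult_le_compat; auto using Rabs_pos.
    left. apply Rinv_0_lt_compat. nra.
  - right. field. lra.
Qed.

Let theta sg a := 2 * atan (r * (a - a0) / sg).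

Lemma D0_cont sg x : 0 < sg -> continuous (fun x => / D0 sg x) x.
Proof.
  intros Hs. apply cont_inv.
  - unfold D0. apply (ex_derive_continuous (fun x => sg ^ 2 + r ^ 2 * (x - a0) ^ 2)). auto_derive; auto.
  - unfold D0. assert (0 <= (r * (x - a0)) ^ 2) by apply pow2_ge_0. nra.
Qed.

Lemma q_cont sg x : 0 < sg -> continuous (fun x => / q sg x) x.
Proof.
  intros Hs. apply cont_inv.
  - unfold q. apply (ex_derive_continuous (fun x => sg ^ 2 + (x - a0) ^ 2)). auto_derive; auto.
  - unfold q. assert (0 <= (x - a0) ^ 2) by apply pow2_ge_0. nra.
Qed.

Lemma RInt_inv_q sg a b : 0 < sg -> a <= b ->
  RInt (fun x => / q sg x) a b = (atan ((b - a0) / sg) - atan ((a - a0) / sg)) / sg.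
Proof.
  intros Hs Hab.
  rewrite (RInt_ext (V := R_CompleteNormedModule) _ (fun x => / (sg ^ 2 + 1 ^ 2 * (x - a0) ^ 2))).
  - rewrite RInt_lorentz by lra. rewrite !Rmult_1_l. reflexivity.
  - intros x _. unfold q. simpl. f_equal. ring.
Qed.

(* AM-GM, [2 |y| <= y^2 / rho + rho], replaces the logarithm in the integral of
   [|y| / (sg^2 + y^2)] by a power; [sg = rho^2]. *)
Lemma Phi0_near_lorentz : exists C, 0 < C /\
  forall rho a, 0 < rho <= 1 -> Ix a ->
    Rabs (Phi b0 0 (s_of (rho ^ 2)) a - RInt (fun x => / D0 (rho ^ 2) x) (- PI) a) <= C / rho.
Proof.
  assert (P := PI_RGT_0). assert (P1 := PI2_1).
  destruct inverse_difference as [C2 [P2 H]].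
  (* The pointwise bound is [2 / rho + rho / q], where one [1 / rho] absorbs the constant 1. The
     interval has length at most [2 PI] and [1 / q] has integral at most [PI / rho^2], for a total
     of [5 PI / rho]. *)
  exists (5 * PI * C2). split; [nra|].
  intros rho a Hrho Ha. unfold Ix in Ha.
  set (sg := rho ^ 2). assert (Hs : 0 < sg <= 1) by (unfold sg; nra).
  set (f := fun x => / (1 - s_of sg * b0 (clamp (- PI) PI x)) - / D0 sg x).
  assert (Hd : forall x, continuous (fun x => / (1 - s_of sg * b0 (clamp (- PI) PI x))) x).
  { intros x. apply cont_inv.
    - apply cont_minus; [apply continuous_const|].
      apply cont_mult; [apply continuous_const|]. apply (c_cont b0 b1); auto.
    - assert (Q := clamped_denominator_pos b0 M B HMB (s_of sg) x (s_of_admissible sg Hs)). lra. }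
  assert (Hf : forall x, continuous f x).
  { intros x. apply cont_minus; auto. apply D0_cont; lra. }
  assert (Hg : forall x, continuous (fun x => C2 * (2 / rho + rho * / q sg x)) x).
  { intros x. apply cont_mult; [apply continuous_const|]. apply cont_plus; [apply continuous_const|].
    apply cont_mult; [apply continuous_const|]. apply q_cont; lra. }
  assert (E : Phi b0 0 (s_of sg) a - RInt (fun x => / D0 sg x) (- PI) a = RInt f (- PI) a).
  { unfold Phi.
    rewrite (RInt_ext (V := R_CompleteNormedModule) f
      (fun x => / (1 - s_of sg * b0 (clamp (- PI) PI x)) + - 1 * / D0 sg x))
      by (intros; unfold f; simpl; eqR; ring).
    rewrite RInt_plus_cont, RInt_scal_cont; auto.
    - rewrite (RInt_ext (V := R_CompleteNormedModule)
        (fun x => b0 (clamp (- PI) PI x) ^ 0 * (/ (1 - s_of sg * b0 (clamp (- PI) PI x))) ^ 1)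
        (fun x => / (1 - s_of sg * b0 (clamp (- PI) PI x))))
        by (intros; simpl; eqR; ring).
      eqR. ring.
    - intros; apply D0_cont; lra.
    - intros. apply cont_mult; [apply continuous_const|apply D0_cont; lra]. }
  rewrite E.
  eapply Rle_trans; [apply abs_RInt_le; [lra|now apply ex_RInt_cont]|].
  assert (Ri : 0 < / rho) by (apply Rinv_0_lt_compat; lra).
  assert (Ri1 : 1 <= / rho) by (rewrite <- Rinv_1; apply Rinv_le_contravar; lra).
  apply Rle_trans with (RInt (fun x => C2 * (2 / rho + rho * / q sg x)) (- PI) a).
  - apply RInt_le_cont; [lra| |auto|].
    + intros x. apply (cont_comp Rabs f); auto. apply continuous_Rabs.
    + intros x Hx. unfold f. rewrite clamp_id by lra.
      assert (Hx' : Ix x) by (unfold Ix; lra).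
      eapply Rle_trans; [apply (H sg x Hs Hx')|].
      apply Rmult_le_compat_l; [lra|].
      set (z := Rabs (x - a0)).
      assert (Z2 : z ^ 2 = (x - a0) ^ 2) by (unfold z; apply pow2_abs).
      assert (Pq : 0 < q sg x) by (unfold q; nra).
      assert (AG : z / q sg x <= / rho + rho * / q sg x).
      { apply Rmult_le_reg_r with (q sg x * rho); [nra|]. field_simplify; [|lra|lra].
        assert (q sg x >= z ^ 2) by (unfold q; nra). nra. }
      unfold Rdiv at 2. lra.
  - rewrite RInt_scal_cont, (RInt_plus_cont (fun _ => 2 / rho)), RInt_const_R, RInt_scal_cont,
      RInt_inv_q; try lra.
    + replace (5 * PI * C2 / rho) with (C2 * (2 * PI * (2 / rho) + rho * (PI / sg)))
        by (unfold sg; field; lra).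
      apply Rmult_le_compat_l; [lra|]. apply Rplus_le_compat.
      * apply Rmult_le_compat_r; [|lra]. unfold Rdiv. lra.
      * apply Rmult_le_compat_l; [lra|]. apply Rmult_le_compat_r.
        -- left. apply Rinv_0_lt_compat. lra.
        -- generalize (atan_bound ((a - a0) / sg)) (atan_bound ((- PI - a0) / sg)). lra.
    + intros; apply q_cont; lra.
    + intros; apply continuous_const.
    + intros. apply cont_mult; [apply continuous_const|apply q_cont; lra].
    + intros. apply cont_plus; [apply continuous_const|].
      apply cont_mult; [apply continuous_const|apply q_cont; lra].
Qed.

(** The model map reaches the endpoints only up to [O(sg)]. The distance [m] of the interior point
    [a0] from the boundary makes the arctangents close to [PI / 2] in absolute value. *)
Lemma theta_ends : exists C, 0 < C /\ forall sg, 0 < sg ->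
  - PI <= theta sg (- PI) <= - PI + C * sg /\ PI - C * sg <= theta sg PI <= PI.
Proof.
  assert (Pr := r_pos).
  set (m := Rmin (PI - a0) (PI + a0)).
  assert (Pm : 0 < m) by (apply Rmin_glb_lt; lra).
  assert (m1 : m <= PI - a0) by apply Rmin_l. assert (m2 : m <= PI + a0) by apply Rmin_r.
  exists (2 / (r * m)). split; [apply Rdiv_lt_0_compat; nra|].
  intros sg Hs.
  assert (Q : forall v, m <= v -> PI - 2 / (r * m) * sg <= 2 * atan (r * v / sg) <= PI).
  { intros v Hv. split.
    - assert (Z : 0 < r * v / sg) by (apply Rdiv_lt_0_compat; nra).
      assert (T := atan_near_half_PI _ Z).
      assert (/ (r * v / sg) <= / (r * m) * sg).
      { replace (/ (r * v / sg)) with (/ (r * v) * sg) by (field; lra).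
        apply Rmult_le_compat_r; [lra|]. apply Rinv_le_contravar; nra. }
      unfold Rdiv at 1. lra.
    - generalize (atan_bound (r * v / sg)). lra. }
  split.
  - unfold theta. replace (r * (- PI - a0) / sg) with (- (r * (PI + a0) / sg)) by (field; lra).
    rewrite atan_opp. generalize (Q (PI + a0) m2). lra.
  - apply Q; auto.
Qed.

Lemma lorentz_theta sg a : 0 < sg -> Ix a ->
  RInt (fun x => / D0 sg x) (- PI) a = (theta sg a - theta sg (- PI)) / (2 * r * sg).
Proof.
  intros Hs Ha. unfold Ix in Ha. assert (Pr := r_pos).
  unfold D0, theta. rewrite RInt_lorentz by lra. eqR. field. lra.
Qed.

Lemma Phi0_near_theta : exists C, 0 < C /\
  forall rho a, 0 < rho <= 1 -> Ix a ->
    Rabs (Phi b0 0 (s_of (rho ^ 2)) a - (theta (rho ^ 2) a + PI) / (2 * r * rho ^ 2)) <= C / rho.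
Proof.
  assert (Pr := r_pos).
  destruct Phi0_near_lorentz as [C [PC H]]. destruct theta_ends as [C' [PC' H']].
  assert (Pc : 0 < C' / (2 * r)) by (apply Rdiv_lt_0_compat; lra).
  exists (C + C' / (2 * r)). split; [lra|].
  intros rho a Hrho Ha. specialize (H rho a Hrho Ha).
  assert (Hs : 0 < rho ^ 2) by nra.
  rewrite lorentz_theta in H by auto.
  destruct (H' (rho ^ 2) Hs) as [A _].
  replace (Phi b0 0 (s_of (rho ^ 2)) a - (theta (rho ^ 2) a + PI) / (2 * r * rho ^ 2)) with
    ((Phi b0 0 (s_of (rho ^ 2)) a - (theta (rho ^ 2) a - theta (rho ^ 2) (- PI)) / (2 * r * rho ^ 2))
     + - ((theta (rho ^ 2) (- PI) + PI) * / (2 * r * rho ^ 2))) by (field; lra).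
  eapply Rle_trans; [apply Rabs_triang|].
  rewrite Rabs_Ropp, Rabs_mult, !(Rabs_right (/ _)), (Rabs_right (theta _ _ + _)).
  - assert ((theta (rho ^ 2) (- PI) + PI) * / (2 * r * rho ^ 2) <= C' * rho ^ 2 * / (2 * r * rho ^ 2)).
    { apply Rmult_le_compat_r; [|lra]. left. apply Rinv_0_lt_compat. nra. }
    replace (C' * rho ^ 2 * / (2 * r * rho ^ 2)) with (C' / (2 * r)) in H0 by (field; lra).
    assert (C' / (2 * r) <= C' / (2 * r) / rho).
    { rewrite <- (Rmult_1_r (C' / (2 * r))) at 1. apply Rmult_le_compat_l; [lra|].
      rewrite <- Rinv_1. apply Rinv_le_contravar; lra. }
    replace ((C + C' / (2 * r)) / rho) with (C / rho + C' / (2 * r) / rho) by (field; lra).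
    lra.
  - lra.
  - apply Rle_ge. left. apply Rinv_0_lt_compat. nra.
Qed.

Lemma K_near : exists C, 0 < C /\
  forall rho, 0 < rho <= 1 -> Rabs (K b0 (s_of (rho ^ 2)) - / (2 * r * rho ^ 2)) <= C / rho.
Proof.
  assert (Pr := r_pos). assert (P := PI_RGT_0). assert (P1 := PI2_1).
  destruct Phi0_near_theta as [C [PC H]]. destruct theta_ends as [C' [PC' H']].
  assert (Pc : 0 < C' / (2 * r)) by (apply Rdiv_lt_0_compat; lra).
  exists (C + C' / (2 * r)). split; [lra|].
  intros rho Hrho. specialize (H rho PI Hrho ltac:(unfold Ix; lra)).
  assert (Hs : 0 < rho ^ 2) by nra.
  destruct (H' (rho ^ 2) Hs) as [_ A].
  assert (Pi : 0 < / (2 * r * rho ^ 2)) by (apply Rinv_0_lt_compat; nra).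
  unfold K.
  replace (Phi b0 0 (s_of (rho ^ 2)) PI / (2 * PI) - / (2 * r * rho ^ 2)) with
    (/ (2 * PI) * ((Phi b0 0 (s_of (rho ^ 2)) PI - (theta (rho ^ 2) PI + PI) / (2 * r * rho ^ 2))
     + - ((PI - theta (rho ^ 2) PI) * / (2 * r * rho ^ 2)))) by (field; lra).
  rewrite Rabs_mult, (Rabs_right (/ (2 * PI))).
  2:{ apply Rle_ge. left. apply Rinv_0_lt_compat. lra. }
  assert (T : Rabs ((Phi b0 0 (s_of (rho ^ 2)) PI - (theta (rho ^ 2) PI + PI) / (2 * r * rho ^ 2))
     + - ((PI - theta (rho ^ 2) PI) * / (2 * r * rho ^ 2))) <= (C + C' / (2 * r)) / rho).
  { eapply Rle_trans; [apply Rabs_triang|].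
    rewrite Rabs_Ropp, (Rabs_mult (PI - _)), (Rabs_right (/ (2 * r * _))), (Rabs_right (PI - _)) by lra.
    assert (H0 : (PI - theta (rho ^ 2) PI) * / (2 * r * rho ^ 2) <= C' * rho ^ 2 * / (2 * r * rho ^ 2))
      by (apply Rmult_le_compat_r; lra).
    replace (C' * rho ^ 2 * / (2 * r * rho ^ 2)) with (C' / (2 * r)) in H0 by (field; lra).
    assert (C' / (2 * r) <= C' / (2 * r) / rho).
    { rewrite <- (Rmult_1_r (C' / (2 * r))) at 1. apply Rmult_le_compat_l; [lra|].
      rewrite <- Rinv_1. apply Rinv_le_contravar; lra. }
    replace ((C + C' / (2 * r)) / rho) with (C / rho + C' / (2 * r) / rho) by (field; lra).
    lra. }
  assert (/ (2 * PI) <= 1) by (rewrite <- Rinv_1; apply Rinv_le_contravar; lra).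
  assert (0 < / (2 * PI)) by (apply Rinv_0_lt_compat; lra).
  eapply Rle_trans; [|exact T]. rewrite <- Rmult_1_l.
  apply Rmult_le_compat_r; auto using Rabs_pos.
Qed.

(** [K_near] gives a positive lower bound only for small [sg], where its error is below the main
    term. This bound, from [D <= C5 q], holds on the whole range and makes later divisions by [K]
    uniform. *)
Lemma K_lower : exists c, 0 < c /\ forall sg, 0 < sg <= 1 -> c / sg <= K b0 (s_of sg).
Proof.
  assert (P := PI_RGT_0).
  destruct D_bounds as [c2 [C5 [P2 [P5 H]]]].
  assert (Pa : 0 < atan (PI - a0)) by (rewrite <- atan_0; apply atan_increasing; lra).
  exists (/ (2 * PI) * (/ C5 * atan (PI - a0))). split.
  { assert (0 < / (2 * PI)) by (apply Rinv_0_lt_compat; lra).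
    assert (0 < / C5) by now apply Rinv_0_lt_compat.
    repeat apply Rmult_lt_0_compat; auto. }
  intros sg Hs. unfold K.
  assert (A := s_of_admissible sg Hs).
  replace (/ (2 * PI) * (/ C5 * atan (PI - a0)) / sg) with
    (/ C5 * (atan (PI - a0) / sg) / (2 * PI)) by (field; lra).
  apply Rmult_le_compat_r; [left; apply Rinv_0_lt_compat; lra|].
  apply Rle_trans with (RInt (fun x => / C5 * / q sg x) (- PI) PI).
  - rewrite RInt_scal_cont by (intros; apply q_cont; lra).
    apply Rmult_le_compat_l; [left; now apply Rinv_0_lt_compat|].
    rewrite RInt_inv_q by lra. apply Rmult_le_compat_r; [left; apply Rinv_0_lt_compat; lra|].
    assert (I1 : 1 <= / sg) by (rewrite <- Rinv_1; apply Rinv_le_contravar; lra).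
    assert (atan (PI - a0) <= atan ((PI - a0) / sg)).
    { assert (L : PI - a0 <= (PI - a0) / sg) by (unfold Rdiv; nra).
      destruct L as [L|L]; [left; now apply atan_increasing|rewrite <- L; lra]. }
    assert (atan ((- PI - a0) / sg) < 0); [|lra].
    rewrite <- atan_0. apply atan_increasing.
    assert (0 < (PI + a0) / sg) by (apply Rdiv_lt_0_compat; lra).
    unfold Rdiv in *. lra.
  - unfold Phi. apply RInt_le_cont; [lra| | |].
    + intros x. apply cont_mult; [apply continuous_const|apply q_cont; lra].
    + intros x. now apply (g_cont b0 b1 M B Hb0 HMB 0).
    + intros x Hx. rewrite clamp_id by lra. simpl. rewrite Rmult_1_l, Rmult_1_r.
      destruct (H sg x Hs ltac:(unfold Ix; lra)) as [[L1 L2] _].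
      assert (Pq : 0 < q sg x) by (unfold q; generalize (pow2_ge_0 (x - a0)); nra).
      rewrite <- Rinv_mult. apply Rinv_le_contravar; [|exact L2]. unfold D in *. nra.
Qed.

(** Both [Phi 0] at the label, which is [K (x + PI)], and [K (theta + PI)] are within [O(1 / rho)]
    of [(theta + PI) / (2 r rho^2)]. Dividing by [K >= c / rho^2] leaves [O(rho)]. *)
Lemma label_near_theta : exists C, 0 < C /\
  forall rho x, 0 < rho <= 1 -> Ix x ->
    Rabs (theta (rho ^ 2) (label b0 (s_of (rho ^ 2)) x) - x) <= C * rho.
Proof.
  assert (Pr := r_pos). assert (P := PI_RGT_0).
  destruct Phi0_near_theta as [C [PC H]]. destruct K_near as [C' [PC' H']].
  destruct K_lower as [c [Pc Hc]].
  exists ((C + 2 * PI * C') / c). split; [apply Rdiv_lt_0_compat; nra|].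
  intros rho x Hrho Hx.
  assert (Hs : 0 < rho ^ 2 <= 1) by nra.
  assert (A := s_of_admissible (rho ^ 2) Hs).
  destruct (label_spec b0 b1 M B Hb0 HMB (s_of (rho ^ 2)) x A Hx) as [I _].
  assert (E := Phi0_label b0 b1 M B Hb0 HMB (s_of (rho ^ 2)) x A Hx).
  specialize (H rho _ Hrho I). specialize (H' rho Hrho). specialize (Hc (rho ^ 2) Hs).
  set (a := label b0 (s_of (rho ^ 2)) x) in *. set (k' := K b0 (s_of (rho ^ 2))) in *.
  rewrite E in H.
  assert (Th : 0 <= theta (rho ^ 2) a + PI <= 2 * PI).
  { unfold theta. generalize (atan_bound (r * (a - a0) / rho ^ 2)). lra. }
  assert (T : Rabs (k' * (theta (rho ^ 2) a - x)) <= (C + 2 * PI * C') / rho).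
  { replace (k' * (theta (rho ^ 2) a - x)) with
      ((k' - / (2 * r * rho ^ 2)) * (theta (rho ^ 2) a + PI)
       - (k' * (x + PI) - (theta (rho ^ 2) a + PI) / (2 * r * rho ^ 2))) by (field; lra).
    eapply Rle_trans; [apply Rabs_triang|]. rewrite Rabs_Ropp, Rabs_mult.
    rewrite (Rabs_right (theta _ _ + _)) by lra.
    replace ((C + 2 * PI * C') / rho) with (C' / rho * (2 * PI) + C / rho) by (field; lra).
    apply Rplus_le_compat; auto. apply Rmult_le_compat; auto using Rabs_pos; lra. }
  assert (Pk : 0 < c / rho ^ 2) by (apply Rdiv_lt_0_compat; lra).
  rewrite Rabs_mult, (Rabs_right k') in T by lra.
  apply Rmult_le_reg_l with (c / rho ^ 2); auto.
  replace (c / rho ^ 2 * ((C + 2 * PI * C') / c * rho)) with ((C + 2 * PI * C') / rho) by (field; lra).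
  eapply Rle_trans; [|exact T]. apply Rmult_le_compat_r; auto using Rabs_pos.
Qed.

(** Replacing [b1 / D] by [- k (a - a0) / D0] costs only [O(1)], and the latter is exactly
    [- (M r / rho^2) sin theta]. Replacing [theta] by [x] costs the amplitude [M r / rho^2] times
    [O(rho)], which is the dominant error. *)
Lemma slope_near : exists C, 0 < C /\
  forall rho x, 0 < rho <= 1 -> Ix x ->
    Rabs (u1 b0 b1 (s_of (rho ^ 2)) x + M * r / rho ^ 2 * sin x) <= C / rho.
Proof.
  assert (Pr := r_pos). assert (P := PI_RGT_0).
  destruct D_bounds as [c2 [C5 [P2 [P5 H]]]].
  destruct inverse_difference as [C2 [PC2 H']].
  destruct label_near_theta as [C [PC Hl]].
  assert (PMr : 0 < M * r) by nra.
  set (C6 := C0 / c2 + k * (C2 * (1 + 2 * PI))).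
  assert (P6 : 0 < C6).
  { apply Rplus_lt_0_compat; [apply Rdiv_lt_0_compat; lra|].
    repeat apply Rmult_lt_0_compat; lra. }
  exists (C6 + M * r * C). split; [nra|].
  intros rho x Hrho Hx.
  assert (Hs : 0 < rho ^ 2 <= 1) by nra.
  assert (A := s_of_admissible (rho ^ 2) Hs).
  destruct (label_spec b0 b1 M B Hb0 HMB (s_of (rho ^ 2)) x A Hx) as [I _].
  specialize (Hl rho x Hrho Hx). unfold u1, den.
  set (a := label b0 (s_of (rho ^ 2)) x) in *.
  change (1 - s_of (rho ^ 2) * b0 a) with (D (rho ^ 2) a).
  destruct (H (rho ^ 2) a Hs I) as [[L1 _] L2]. specialize (H' (rho ^ 2) a Hs I).
  assert (Y : 0 <= (a - a0) ^ 2) by apply pow2_ge_0.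
  assert (Pq : 0 < q (rho ^ 2) a) by (unfold q; nra).
  assert (Pd : 0 < D (rho ^ 2) a) by nra. assert (Pd0 : 0 < D0 (rho ^ 2) a) by nra.
  assert (Es : M * r / rho ^ 2 * sin (theta (rho ^ 2) a) = k * (a - a0) / D0 (rho ^ 2) a).
  { unfold theta. rewrite sin_double_atan.
    assert (Ek : k = 2 * M * r ^ 2) by (rewrite r_sqr; field; lra).
    rewrite Ek. unfold D0 in *. field. repeat split; lra. }
  assert (T1 : Rabs (b1 a / D (rho ^ 2) a + k * (a - a0) / D0 (rho ^ 2) a) <= C6).
  { replace (b1 a / D (rho ^ 2) a + k * (a - a0) / D0 (rho ^ 2) a) with
      ((b1 a + k * (a - a0)) * / D (rho ^ 2) a - k * (a - a0) * (/ D (rho ^ 2) a - / D0 (rho ^ 2) a))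
      by (field; lra).
    eapply Rle_trans; [apply Rabs_triang|]. rewrite Rabs_Ropp, !Rabs_mult.
    rewrite (Rabs_right (/ D _ _)) by (apply Rle_ge; left; now apply Rinv_0_lt_compat).
    rewrite (Rabs_right k) by lra. set (z := Rabs (a - a0)) in *.
    assert (Z2 : z ^ 2 = (a - a0) ^ 2) by (unfold z; apply pow2_abs).
    assert (Z0 : 0 <= z) by apply Rabs_pos.
    assert (Z1 : z <= 2 * PI) by now apply dist_le.
    unfold C6. apply Rplus_le_compat.
    - apply Rle_trans with (C0 * q (rho ^ 2) a * / (c2 * q (rho ^ 2) a)).
      + apply Rmult_le_compat; auto using Rabs_pos.
        * left; now apply Rinv_0_lt_compat.
        * eapply Rle_trans; [now apply H3|]. apply Rmult_le_compat_l; [lra|]. unfold q; nra.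
        * apply Rinv_le_contravar; auto. nra.
      + right. field. lra.
    - rewrite Rmult_assoc. apply Rmult_le_compat_l; [lra|].
      eapply Rle_trans; [apply Rmult_le_compat_l; [exact Z0|exact H']|].
      replace (z * (C2 * (z / q (rho ^ 2) a + 1))) with (C2 * (z ^ 2 / q (rho ^ 2) a + z)) by (field; lra).
      apply Rmult_le_compat_l; [lra|]. apply Rplus_le_compat; auto.
      apply Rmult_le_reg_r with (q (rho ^ 2) a); auto. unfold Rdiv.
      rewrite Rmult_assoc, Rinv_l by lra. unfold q. nra. }
  replace (b1 a / D (rho ^ 2) a + M * r / rho ^ 2 * sin x) with
    ((b1 a / D (rho ^ 2) a + k * (a - a0) / D0 (rho ^ 2) a)
     - M * r / rho ^ 2 * (sin (theta (rho ^ 2) a) - sin x)) by (rewrite <- Es; ring).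
  eapply Rle_trans; [apply Rabs_triang|]. rewrite Rabs_Ropp, Rabs_mult.
  assert (PR : 0 < M * r / rho ^ 2) by (apply Rdiv_lt_0_compat; lra).
  rewrite (Rabs_right (M * r / rho ^ 2)) by lra.
  assert (T2 : M * r / rho ^ 2 * Rabs (sin (theta (rho ^ 2) a) - sin x) <= M * r / rho ^ 2 * (C * rho)).
  { apply Rmult_le_compat_l; [lra|]. eapply Rle_trans; [apply sin_lipschitz|exact Hl]. }
  replace (M * r / rho ^ 2 * (C * rho)) with (M * r * C / rho) in T2 by (field; lra).
  assert (C6 <= C6 / rho).
  { rewrite <- (Rmult_1_r C6) at 1. apply Rmult_le_compat_l; [lra|].
    rewrite <- Rinv_1. apply Rinv_le_contravar; lra. }
  replace ((C6 + M * r * C) / rho) with (C6 / rho + M * r * C / rho) by (field; lra).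
  lra.
Qed.

End Asymptotics.

(** * The blow-up solution *)

(** A continuous function of mean zero vanishes somewhere, by the mean value theorem for its
    primitive. From that point the derivative bound is integrated over a length of at most
    [2 PI]. *)
Lemma mean_zero_bound (f f' : R -> R) A :
  (forall x, Ix x -> is_derive f x (f' x)) -> (forall x, Ix x -> Rabs (f' x) <= A) ->
  RInt f (- PI) PI = 0 -> forall x, Ix x -> Rabs (f x) <= 2 * PI * A.
Proof.
  intros Hd Hb Hm x Hx. assert (P := PI_RGT_0).
  assert (Hc : forall y, continuous (fun z => f (clamp (- PI) PI z)) y).
  { intros y. apply cont_in_clamp. intros z Hz.
    apply continuous_eps_within. eapply is_derive_cont. now apply Hd. }
  destruct (mvt_is_derive (fun y => RInt (fun z => f (clamp (- PI) PI z)) (- PI) y)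
    (fun z => f (clamp (- PI) PI z)) (- PI) PI) as [c [Ic Ec]].
  - lra.
  - intros y _. now apply (is_derive_RInt_cont (fun z => f (clamp (- PI) PI z))).
  - intros y _. eapply is_derive_cont.
    now apply (is_derive_RInt_cont (fun z => f (clamp (- PI) PI z))).
  - rewrite (RInt_ext (V := R_CompleteNormedModule) _ f (- PI) PI), Hm in Ec.
    2:{ intros y Hy. rewrite Rmin_left, Rmax_right in Hy by lra. now rewrite clamp_id by lra. }
    rewrite RInt_point in Ec. unfold zero in Ec; simpl in Ec. rewrite clamp_id in Ec by lra.
    assert (Fc : f c = 0) by nra.
    assert (HA : 0 <= A) by (eapply Rle_trans; [apply Rabs_pos|apply (Hb x Hx)]).
    assert (L : forall u v, - PI <= u -> u < v -> v <= PI -> Rabs (f v - f u) <= 2 * PI * A).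
    { intros u v Hu Huv Hv.
      destruct (mvt_is_derive f f' u v Huv) as [e [Ie Ee]].
      - intros y Hy. apply Hd. unfold Ix; lra.
      - intros y Hy. eapply is_derive_cont. apply Hd. unfold Ix; lra.
      - rewrite Ee, Rabs_mult, (Rabs_right (v - u)) by lra.
        assert (Rabs (f' e) <= A) by (apply Hb; unfold Ix; lra).
        generalize (Rabs_pos (f' e)). nra. }
    unfold Ix in Hx. destruct (Rtotal_order x c) as [H|[H|H]].
    + replace (f x) with (- (f c - f x)) by lra. rewrite Rabs_Ropp. apply L; lra.
    + subst x. rewrite Fc, Rabs_R0. nra.
    + replace (f x) with (f x - f c) by lra. apply L; lra.
Qed.

Section Blowup.

Variables (b0 b1 b2 b3 : R -> R) (M B a0 k C0 c1 : R).
Hypothesis Hb0 : forall x, is_derive b0 x (b1 x).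
Hypothesis Hb1 : forall x, is_derive b1 x (b2 x).
Hypothesis Hb2 : forall x, is_derive b2 x (b3 x).
Hypothesis Hb3 : forall x, continuous b3 x.
Hypothesis Hmean : RInt b0 (- PI) PI = 0.
Hypothesis HMB : forall x, Ix x -> - B <= b0 x <= M.
Hypothesis HM : 0 < M.
Hypothesis HB : 0 < B.
Hypothesis Ha0 : - PI < a0 < PI.
Hypothesis Hk : 0 < k.
Hypothesis HC0 : 0 < C0.
Hypothesis Hc1 : 0 < c1.
Hypothesis H1 : forall x, Ix x -> c1 * (x - a0) ^ 2 <= M - b0 x.
Hypothesis H2 : forall x, Ix x ->
  Rabs (M - b0 x - k / 2 * (x - a0) ^ 2) <= C0 * (Rabs (x - a0) * (x - a0) ^ 2).
Hypothesis H3 : forall x, Ix x -> Rabs (b1 x + k * (x - a0)) <= C0 * (x - a0) ^ 2.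

Let r := sqrt (k / (2 * M)).
Let Ks sg := K b0 (s_of M sg).

(* With [s = (1 - sg^2) / M] one has [- dt / dsg = (2 / M) sg K(s)], which extends
   continuously to the blow-up time [sg = 0]. *)
Let m v := if Rle_dec v 0 then / (2 * r) else v * Ks v.
(** Freezing the argument at 1, as [m] is frozen below 0, gives a positive continuous function on
    the whole line. Its primitive [remaining], the time left before blow-up, is then strictly
    increasing everywhere, and [sigma] inverts it. *)
Let speed sg := 2 / M * m (Rmin sg 1).
Let remaining sg : R := RInt speed 0 sg.
Let sigma y := epsilon (inhabits 0) (fun sg => remaining sg = y).

Lemma decay_rate_pos : 0 < r.
Proof. apply (r_pos M k); auto. Qed.

Lemma admissible_sg sg : 0 < sg <= 1 -> admissible M B (s_of M sg).
Proof. apply s_of_admissible; auto. Qed.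

Lemma m_near : exists C, 0 < C /\
  forall rho v, 0 < rho <= 1 -> v <= rho ^ 2 -> Rabs (m v - / (2 * r)) <= C * rho.
Proof.
  destruct (K_near b0 b1 M B a0 k C0 c1 Hb0 HMB HM HB Ha0 Hk HC0 Hc1 H1 H2) as [C [PC H]].
  exists C. split; auto. intros rho v Hrho Hv. assert (Pr := decay_rate_pos).
  unfold m. destruct (Rle_dec v 0) as [Hv0|Hv0].
  - rewrite Rminus_eq_0, Rabs_R0. nra.
  - assert (Q : 0 < sqrt v) by (apply sqrt_lt_R0; lra).
    assert (Q2 : sqrt v ^ 2 = v) by (simpl; rewrite Rmult_1_r; apply sqrt_sqrt; lra).
    assert (QR : sqrt v <= rho).
    { replace rho with (sqrt (rho ^ 2)) by (apply sqrt_pow2; lra). now apply sqrt_le_1_alt. }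
    specialize (H (sqrt v) ltac:(lra)). rewrite Q2 in H. fold r in H. fold (Ks v) in H.
    replace (v * Ks v - / (2 * r)) with (v * (Ks v - / (2 * r * v))) by (field; lra).
    rewrite Rabs_mult, (Rabs_right v) by lra.
    apply Rle_trans with (v * (C / sqrt v)); [apply Rmult_le_compat_l; lra|].
    rewrite <- Q2 at 1. replace (sqrt v ^ 2 * (C / sqrt v)) with (C * sqrt v) by (field; lra).
    apply Rmult_le_compat_l; lra.
Qed.

Lemma m_cont v : v <= 1 -> continuous m v.
Proof.
  intros Hv. destruct (Rtotal_order v 0) as [L|[->|L]].
  - apply (continuous_ext_loc _ (fun _ => / (2 * r))); [|apply continuous_const].
    generalize (open_lt 0 v L). apply filter_imp. intros y Hy.
    unfold m. destruct (Rle_dec y 0); lra.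
  - destruct m_near as [C [PC H]].
    assert (M0 : m 0 = / (2 * r)) by (unfold m; destruct (Rle_dec 0 0); lra).
    apply continuous_eps. intros eps He. rewrite M0.
    set (rho := Rmin 1 (eps / (2 * C))).
    assert (PR : 0 < rho) by (apply Rmin_glb_lt; [lra|apply Rdiv_lt_0_compat; lra]).
    assert (R1 : rho <= 1) by apply Rmin_l.
    assert (R2 : rho <= eps / (2 * C)) by apply Rmin_r.
    exists (rho ^ 2). split; [now apply pow_lt|].
    intros y Hy. rewrite Rminus_0_r in Hy.
    eapply Rle_lt_trans; [apply (H rho); auto|].
    + generalize (Rle_abs y). lra.
    + apply Rle_lt_trans with (C * (eps / (2 * C))); [apply Rmult_le_compat_l; lra|].
      replace (C * (eps / (2 * C))) with (eps / 2) by (field; lra). lra.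
  - apply (continuous_ext_loc _ (fun v => v * Ks v)).
    + generalize (open_gt 0 v L). apply filter_imp. intros y Hy.
      unfold m. destruct (Rle_dec y 0); lra.
    + apply cont_mult; [apply continuous_id|]. unfold Ks.
      apply (cont_comp (K b0) (s_of M)).
      * apply (ex_derive_continuous (s_of M)). unfold s_of. auto_derive; lra.
      * eapply is_derive_cont. apply (K_derive b0 b1 M B); auto. apply admissible_sg; lra.
Qed.

Lemma m_pos v : v <= 1 -> 0 < m v.
Proof.
  intros Hv. unfold m. destruct (Rle_dec v 0).
  - apply Rinv_0_lt_compat. generalize decay_rate_pos; lra.
  - apply Rmult_lt_0_compat; [lra|]. apply (K_pos b0 b1 M B); auto. apply admissible_sg; lra.
Qed.

Lemma speed_cont x : continuous speed x.
Proof.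
  unfold speed. apply cont_mult; [apply continuous_const|].
  apply (cont_comp m (fun x => Rmin x 1)).
  - apply continuous_eps. intros eps He. exists eps. split; auto. intros y Hy.
    eapply Rle_lt_trans; [|exact Hy]. unfold Rmin, Rabs.
    destruct (Rle_dec y 1), (Rle_dec x 1); repeat destruct (Rcase_abs _); lra.
  - apply m_cont. apply Rmin_r.
Qed.

Lemma speed_pos x : 0 < speed x.
Proof.
  apply Rmult_lt_0_compat; [apply Rdiv_lt_0_compat; lra|]. apply m_pos, Rmin_r.
Qed.

Lemma remaining_derive x : is_derive remaining x (speed x).
Proof. apply is_derive_RInt_cont, speed_cont. Qed.

Lemma remaining_cont x : continuous remaining x.
Proof. eapply is_derive_cont, remaining_derive. Qed.

Lemma remaining_increasing u v : u < v -> remaining u < remaining v.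
Proof. apply strictly_increasing_antideriv; [apply speed_cont|apply speed_pos]. Qed.

Lemma remaining_zero : remaining 0 = 0.
Proof. exact (RInt_point (V := R_CompleteNormedModule) 0 speed). Qed.

Lemma sigma_remaining sg : sigma (remaining sg) = sg.
Proof.
  unfold sigma.
  assert (E := epsilon_spec (inhabits 0) (fun x => remaining x = remaining sg)
    (ex_intro _ sg eq_refl)). simpl in E.
  set (a := epsilon _ _) in *. clearbody a.
  destruct (Rtotal_order a sg) as [L|[L|L]]; auto; apply remaining_increasing in L; lra.
Qed.

(** The initial time corresponds to [s = 0], that is to [sg = 1]. *)
Definition blowup_time : R := remaining 1.

Lemma blowup_time_pos : 0 < blowup_time.
Proof. rewrite <- remaining_zero. apply remaining_increasing. lra. Qed.

Lemma sigma_spec y : 0 < y <= blowup_time -> 0 < sigma y <= 1 /\ remaining (sigma y) = y.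
Proof.
  intros Hy. destruct (Req_dec y blowup_time) as [->|Hne].
  - unfold blowup_time. rewrite sigma_remaining. split; auto; lra.
  - destruct (inverse_between remaining sigma 0 1 y) as [A E].
    + apply remaining_cont.
    + apply sigma_remaining.
    + lra.
    + rewrite remaining_zero. unfold blowup_time in *. lra.
    + split; auto; lra.
Qed.

Definition S_of t := s_of M (sigma (blowup_time - t)).

Lemma S_of_admissible t : It blowup_time t -> admissible M B (S_of t).
Proof.
  intros Ht. apply admissible_sg. apply sigma_spec. unfold It in Ht. lra.
Qed.

Lemma S_of_derive t : It blowup_time t -> is_derive S_of t (/ K b0 (S_of t)).
Proof.
  intros Ht. unfold It in Ht.
  destruct (sigma_spec (blowup_time - t) ltac:(lra)) as [I E].
  assert (A := admissible_sg _ I).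
  assert (PK := K_pos b0 b1 M B Hb0 HMB _ A).
  set (sg := sigma (blowup_time - t)) in *.
  assert (D : is_derive sigma (blowup_time - t) (/ speed sg)).
  { rewrite <- E. apply inverse_derive.
    - apply remaining_cont.
    - apply remaining_increasing.
    - apply sigma_remaining.
    - apply remaining_derive.
    - generalize (speed_pos sg). lra. }
  assert (Sp : speed sg = 2 / M * (sg * K b0 (S_of t))).
  { unfold speed. rewrite Rmin_left by lra. unfold m. destruct (Rle_dec sg 0); [lra|reflexivity]. }
  unfold S_of at 1.
  evar_last.
  - apply (is_derive_compR (s_of M) (fun t => sigma (blowup_time - t))).
    + instantiate (1 := - (2 * sg) / M). unfold s_of. fold sg. auto_derive; [lra|field; lra].
    + apply (is_derive_compR sigma (fun t => blowup_time - t)); [exact D|].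
      instantiate (1 := - 1). auto_derive; auto; ring.
  - rewrite Sp. eqR. unfold S_of. fold sg. field. lra.
Qed.

Lemma S_of_zero : S_of 0 = 0.
Proof.
  unfold S_of. rewrite Rminus_0_r. unfold blowup_time. rewrite sigma_remaining.
  unfold s_of. field. lra.
Qed.

Definition blowup_solution t x := u b0 (S_of t) x.

Lemma blowup_solution_is_solution : is_solution blowup_time blowup_solution.
Proof.
  apply (explicit_solution b0 b1 b2 b3 M B); auto.
  - apply S_of_admissible.
  - apply S_of_derive.
  - apply S_of_zero.
Qed.

Lemma blowup_solution_initial x : Ix x -> blowup_solution 0 x = b0 x.
Proof.
  intros Hx. apply (u_initial b0 b1 M B); auto using S_of_zero.
Qed.

(** On [[0, rho^2]] the speed is [(2 / M) / (2 r) = 1 / (M r)] up to [O(rho)], so integration gains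
    [rho^2]. The lower bound comes from [K_lower] because it must hold for all [rho] up to 1. *)
Lemma remaining_asymptotics : exists C c, 0 < C /\ 0 < c /\
  forall rho, 0 < rho <= 1 ->
    Rabs (remaining (rho ^ 2) - rho ^ 2 / (M * r)) <= C * rho ^ 3 /\ c * rho ^ 2 <= remaining (rho ^ 2).
Proof.
  assert (Pr := decay_rate_pos).
  destruct m_near as [C [PC H]].
  destruct (K_lower b0 b1 M B a0 k C0 c1 Hb0 HMB HM HB Ha0 Hk HC0 Hc1 H1 H2) as [c [Pc Hc]].
  set (c' := Rmin c (/ (2 * r))).
  assert (Pc' : 0 < c') by (apply Rmin_glb_lt; [lra|apply Rinv_0_lt_compat; lra]).
  assert (P2M : 0 < 2 / M) by (apply Rdiv_lt_0_compat; lra).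
  assert (PM : 0 < M * r) by nra.
  exists (2 / M * C), (2 / M * c'). split; [nra|]. split; [nra|].
  intros rho Hrho. assert (Hrho2 : 0 < rho ^ 2 <= 1) by nra. split.
  - replace (rho ^ 2 / (M * r)) with (RInt (fun _ => / (M * r)) 0 (rho ^ 2)).
    2:{ rewrite RInt_const_R. unfold Rdiv. eqR. ring. }
    replace (remaining (rho ^ 2) - RInt (fun _ => / (M * r)) 0 (rho ^ 2))
      with (RInt (fun x => speed x + - 1 * / (M * r)) 0 (rho ^ 2)).
    2:{ rewrite (RInt_plus_cont speed (fun _ => - 1 * / (M * r))), !RInt_const_R.
        - unfold remaining. eqR. ring.
        - apply speed_cont.
        - intros; apply continuous_const. }
    replace (2 / M * C * rho ^ 3) with ((rho ^ 2 - 0) * (2 / M * C * rho)) by ring.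
    apply abs_RInt_le_const; [lra| |].
    + apply ex_RInt_cont. intros. apply cont_plus; [apply speed_cont|apply continuous_const].
    + intros v Hv. unfold speed. rewrite Rmin_left by lra.
      replace (2 / M * m v + - 1 * / (M * r)) with (2 / M * (m v - / (2 * r))) by (field; lra).
      rewrite Rabs_mult, (Rabs_right (2 / M)), Rmult_assoc by lra.
      apply Rmult_le_compat_l; [lra|]. apply H; lra.
  - replace (2 / M * c' * rho ^ 2) with (RInt (fun _ => 2 / M * c') 0 (rho ^ 2)).
    2:{ rewrite RInt_const_R. eqR. ring. }
    apply RInt_le_cont; [lra| | |].
    + intros; apply continuous_const.
    + apply speed_cont.
    + intros v Hv. unfold speed. rewrite Rmin_left by lra.
      apply Rmult_le_compat_l; [lra|]. unfold m. destruct (Rle_dec v 0); [lra|].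
      eapply Rle_trans; [apply Rmin_l|].
      specialize (Hc v ltac:(lra)). apply Rmult_le_compat_l with (r := v) in Hc; [|lra].
      replace (v * (c / v)) with c in Hc by (field; lra). exact Hc.
Qed.

Let bx t x := u1 b0 b1 (S_of t) x + sin x / (blowup_time - t).

Lemma slope_remainder : exists C, 0 < C /\ forall t x, It blowup_time t -> Ix x ->
  Rabs (bx t x) <= C / sqrt (blowup_time - t).
Proof.
  assert (Pr := decay_rate_pos).
  destruct remaining_asymptotics as [C [c [PC [Pc H]]]].
  destruct (slope_near b0 b1 M B a0 k C0 c1 Hb0 HMB HM HB Ha0 Hk HC0 Hc1 H1 H2 H3) as [C' [PC' H']].
  assert (PM : 0 < M * r) by nra.
  assert (PMi : 0 < / (M * r)) by now apply Rinv_0_lt_compat.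
  set (Cu := / (M * r) + C). assert (PCu : 0 < sqrt Cu) by (apply sqrt_lt_R0; unfold Cu; lra).
  assert (PCc : 0 < M * r * C / c) by (apply Rdiv_lt_0_compat; nra).
  exists ((C' + M * r * C / c) * sqrt Cu). split; [nra|].
  intros t x Ht Hx. unfold It in Ht.
  destruct (sigma_spec (blowup_time - t) ltac:(lra)) as [I E].
  unfold bx, S_of. set (sg := sigma (blowup_time - t)) in *. set (tau := blowup_time - t) in *.
  assert (Ptau : 0 < tau) by (unfold tau; lra).
  set (rho := sqrt sg).
  assert (PR : 0 < rho) by (apply sqrt_lt_R0; lra).
  assert (ER : rho ^ 2 = sg) by (unfold rho; simpl; rewrite Rmult_1_r; apply sqrt_sqrt; lra).
  assert (R1 : rho <= 1) by nra.
  destruct (H rho ltac:(lra)) as [A1 A2]. specialize (H' rho x ltac:(lra) Hx).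
  rewrite ER, E in A1, A2. rewrite ER in H'. fold r in H'.
  (* The amplitude is exchanged for [1 / tau]: the difference is of order [rho^3] divided by
     [sg * tau], and [sg * tau >= c rho^4]. *)
  assert (T1 : Rabs (/ tau - M * r / sg) <= M * r * C / c / rho).
  { replace (/ tau - M * r / sg) with (- (M * r * (tau - sg / (M * r))) / (sg * tau)) by (field; lra).
    unfold Rdiv at 1. rewrite Rabs_mult, Rabs_Ropp, Rabs_mult.
    rewrite (Rabs_right (M * r)), (Rabs_right (/ (sg * tau))) by
      (first [lra | apply Rle_ge; left; apply Rinv_0_lt_compat; nra]).
    apply Rle_trans with (M * r * (C * rho ^ 3) * / (sg * (c * sg))).
    - apply Rmult_le_compat.
      + apply Rmult_le_pos; [lra|apply Rabs_pos].
      + left. apply Rinv_0_lt_compat. nra.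
      + apply Rmult_le_compat_l; [lra|auto].
      + apply Rinv_le_contravar; [repeat apply Rmult_lt_0_compat; lra|].
        apply Rmult_le_compat_l; lra.
    - right. rewrite <- ER. field. lra. }
  assert (T2 : Rabs (u1 b0 b1 (s_of M sg) x + sin x / tau) <= (C' + M * r * C / c) / rho).
  { replace (u1 b0 b1 (s_of M sg) x + sin x / tau) with
      ((u1 b0 b1 (s_of M sg) x + M * r / sg * sin x) + (/ tau - M * r / sg) * sin x) by (field; lra).
    eapply Rle_trans; [apply Rabs_triang|]. rewrite Rabs_mult.
    assert (Rabs (sin x) <= 1) by (apply Rabs_le; apply SIN_bound).
    assert (Rabs (/ tau - M * r / sg) * Rabs (sin x) <= M * r * C / c / rho * 1)
      by (apply Rmult_le_compat; auto using Rabs_pos).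
    replace ((C' + M * r * C / c) / rho) with (C' / rho + M * r * C / c / rho) by (field; lra). lra. }
  eapply Rle_trans; [exact T2|].
  assert (T3 : sqrt tau <= sqrt Cu * rho).
  { replace (sqrt Cu * rho) with (sqrt (Cu * sg)).
    - apply sqrt_le_1_alt. apply Rabs_le_between in A1. unfold Cu.
      assert (rho ^ 3 <= sg) by (rewrite <- ER; nra).
      assert (C * rho ^ 3 <= C * sg) by (apply Rmult_le_compat_l; lra).
      unfold Rdiv in A1. lra.
    - unfold rho. apply sqrt_mult_alt. unfold Cu; lra. }
  assert (Pst : 0 < sqrt tau) by now apply sqrt_lt_R0.
  apply Rmult_le_reg_r with (rho * sqrt tau); [nra|].
  replace ((C' + M * r * C / c) / rho * (rho * sqrt tau)) with ((C' + M * r * C / c) * sqrt tau)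
    by (field; lra).
  replace ((C' + M * r * C / c) * sqrt Cu / sqrt tau * (rho * sqrt tau))
    with ((C' + M * r * C / c) * (sqrt Cu * rho)) by (field; lra).
  apply Rmult_le_compat_l; lra.
Qed.

Lemma remainder_derive t x : It blowup_time t -> Ix x ->
  is_derive (fun x => blowup_solution t x - cos x / (blowup_time - t)) x (bx t x).
Proof.
  intros Ht Hx. assert (A := S_of_admissible t Ht). unfold It in Ht.
  unfold bx, blowup_solution. evar_last.
  - apply is_derive_minusR.
    + now apply (u_dx b0 b1 M B).
    + instantiate (1 := - sin x / (blowup_time - t)). auto_derive; [lra|field; lra].
  - eqR. field. lra.
Qed.

Lemma remainder_slope_cont t x : It blowup_time t -> Ix x -> continuous (bx t) x.
Proof.
  intros Ht Hx. assert (A := S_of_admissible t Ht). unfold It in Ht.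
  unfold bx. apply cont_plus.
  - eapply is_derive_cont. now apply (u1_dx b0 b1 b2 M B).
  - apply (ex_derive_continuous (fun x => sin x / (blowup_time - t))). auto_derive; lra.
Qed.

Lemma remainder_mean t : It blowup_time t ->
  RInt (fun x => blowup_solution t x - cos x / (blowup_time - t)) (- PI) PI = 0.
Proof.
  intros Ht. assert (A := S_of_admissible t Ht). assert (P := PI_RGT_0).
  assert (E0 := RInt_u b0 b1 M B Hb0 HMB (S_of t) (- PI) A ltac:(unfold Ix; lra)).
  assert (E1 := RInt_u b0 b1 M B Hb0 HMB (S_of t) PI A ltac:(unfold Ix; lra)).
  rewrite RInt_point in E0. rewrite (RInt_u_total b0 b1 M B) in E1 by auto.
  rewrite (RInt_FTC (fun x => F b0 (S_of t) x - sin x / (blowup_time - t))).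
  - rewrite <- E0, <- E1, sin_neg, sin_PI. unfold zero; simpl. unfold Rdiv. ring.
  - lra.
  - intros x Hx. unfold It in Ht. apply is_derive_minusR.
    + apply (F_dx b0 b1 M B); auto.
    + auto_derive; [lra|field; lra].
  - intros x Hx. eapply is_derive_cont. now apply remainder_derive.
Qed.

(** The remainder has mean zero, so a bound [A] on its slope bounds it by [2 PI A]; the C^1 norm, a
    sum of suprema, is at most [(2 PI + 1) A]. *)
Lemma decomposition : exists C, 0 < C /\ forall t, It blowup_time t ->
  (forall x, Ix x -> Rabs (blowup_solution t x - cos x / (blowup_time - t))
                     <= C / sqrt (blowup_time - t)) /\
  Ck_norm_le 1 (fun x => blowup_solution t x - cos x / (blowup_time - t))
    (C / sqrt (blowup_time - t)).
Proof.
  assert (P := PI_RGT_0).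
  destruct slope_remainder as [C [PC H]].
  exists ((2 * PI + 1) * C). split; [nra|]. intros t Ht.
  set (A := C / sqrt (blowup_time - t)).
  assert (PA : 0 < A).
  { apply Rdiv_lt_0_compat; auto. apply sqrt_lt_R0. unfold It in Ht; lra. }
  replace ((2 * PI + 1) * C / sqrt (blowup_time - t)) with (2 * PI * A + A).
  2:{ unfold A. field. apply Rgt_not_eq. apply sqrt_lt_R0. unfold It in Ht; lra. }
  assert (Hf : forall x, Ix x -> Rabs (blowup_solution t x - cos x / (blowup_time - t)) <= 2 * PI * A).
  { apply (mean_zero_bound _ (bx t)).
    - intros x Hx. now apply remainder_derive.
    - intros x Hx. now apply H.
    - now apply remainder_mean. }
  split.
  - intros x Hx. generalize (Hf x Hx). lra.
  - exists (fun i => match i with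
      | O => fun x => blowup_solution t x - cos x / (blowup_time - t) | _ => bx t end).
    split.
    + split; [reflexivity|]. split.
      * intros [|i] _ x Hx;
          [apply (continuous_eps_within Ix (fun x => blowup_solution t x - cos x / (blowup_time - t)))
          |apply (continuous_eps_within Ix (bx t))].
        -- apply (is_derive_cont (fun x => blowup_solution t x - cos x / (blowup_time - t)) _ (bx t x)).
           now apply remainder_derive.
        -- now apply remainder_slope_cont.
      * intros i Hi x Hx. replace i with O by lia.
        apply is_derive_has_deriv_in. now apply remainder_derive.
    + exists (fun i => match i with O => 2 * PI * A | _ => A end). split; [simpl; lra|].
      intros [|i] _ x Hx; [now apply Hf|now apply H].
Qed.

Lemma blowup_solution_unbounded N : exists t, It blowup_time t /\ N < Rabs (blowup_solution t 0).
Proof.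
  assert (P := PI_RGT_0). assert (PT := blowup_time_pos).
  destruct decomposition as [C [PC H]].
  (* At distance [z^2] from the blow-up time and at [x = 0] the solution is at least
     [1 / z^2 - C / z]. With [1 / z >= Q] this is at least [|N| + 1]. *)
  set (Q := C + Rabs N + 1). assert (PQ : 1 <= Q) by (unfold Q; generalize (Rabs_pos N); lra).
  set (z := Rmin (sqrt blowup_time) (/ Q)).
  assert (Pz : 0 < z) by (apply Rmin_glb_lt; [now apply sqrt_lt_R0|apply Rinv_0_lt_compat; lra]).
  assert (z1 : z <= sqrt blowup_time) by apply Rmin_l. assert (z2 : z <= / Q) by apply Rmin_r.
  assert (z3 : z ^ 2 <= blowup_time).
  { rewrite <- (sqrt_sqrt blowup_time) by lra. nra. }
  assert (Ht : It blowup_time (blowup_time - z ^ 2)).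
  { unfold It. assert (0 < z ^ 2) by now apply pow_lt. lra. }
  exists (blowup_time - z ^ 2). split; auto.
  destruct (H _ Ht) as [H0 _]. specialize (H0 0 ltac:(unfold Ix; lra)).
  replace (blowup_time - (blowup_time - z ^ 2)) with (z ^ 2) in H0 by ring.
  rewrite sqrt_pow2, cos_0 in H0 by lra.
  assert (Zi : Q <= / z).
  { rewrite <- (Rinv_inv Q). apply Rinv_le_contravar; auto. }
  assert (T := Rabs_triang_inv (1 / z ^ 2) (blowup_solution (blowup_time - z ^ 2) 0)).
  rewrite Rabs_minus_sym in T.
  assert (E : 1 / z ^ 2 = / z * / z) by (field; lra).
  rewrite (Rabs_right (1 / z ^ 2)) in T by (rewrite E; nra).
  rewrite E in *. unfold Rdiv in H0.
  assert (Rabs N < / z * / z - C * / z).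
  { unfold Q in Zi. generalize (Rabs_pos N). nra. }
  generalize (Rle_abs N). lra.
Qed.

End Blowup.

(** * Nondegeneracy of the initial datum *)

Lemma segment_bound (h h' : R -> R) a x D :
  (forall t, Rmin a x <= t <= Rmax a x -> is_derive h t (h' t) /\ Rabs (h' t) <= D) ->
  Rabs (h x - h a) <= D * Rabs (x - a).
Proof.
  intros H. destruct (MVT_gen h a x h') as [c [Hc E]].
  - intros t Ht. apply H. lra.
  - intros t Ht. apply continuity_pt_filterlim. eapply is_derive_cont. now apply H.
  - rewrite E, Rabs_mult. apply Rmult_le_compat_r; [apply Rabs_pos|]. now apply H.
Qed.

Lemma segment_in_Ix a x t : Ix a -> Ix x -> Rmin a x <= t <= Rmax a x ->
  Ix t /\ Rabs (t - a) <= Rabs (x - a).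
Proof.
  unfold Ix, Rmin, Rmax, Rabs. intros Ha Hx Ht.
  destruct (Rle_dec a x); repeat destruct (Rcase_abs _); lra.
Qed.

Lemma interior_maximum (f : R -> R) l a : - PI < a < PI -> is_derive f a l ->
  (forall x, Ix x -> f x <= f a) -> l = 0.
Proof.
  intros Ha Hd Hm.
  assert (pr : derivable_pt f a) by (apply ex_derive_Reals_0; now exists l).
  rewrite <- (is_derive_unique f a l Hd), <- (Derive_Reals f a pr).
  apply (deriv_maximum f (- PI) PI); try lra.
  intros x H1 H2. apply Hm. unfold Ix; lra.
Qed.

Lemma cos_ge_half t : Rabs t <= PI / 3 -> 1 / 2 <= cos t.
Proof.
  intros Ht. assert (P := PI_RGT_0). assert (H0 := Rabs_pos t).
  replace (cos t) with (cos (Rabs t)).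
  - rewrite <- cos_PI3. destruct Ht as [H|H]; [|rewrite H; lra].
    left. apply cos_decreasing_1; lra.
  - unfold Rabs. destruct (Rcase_abs t); [apply cos_neg|reflexivity].
Qed.

Lemma cos_le_half x : Ix x -> PI / 3 < Rabs x -> cos x <= 1 / 2.
Proof.
  intros Hx Ht. assert (P := PI_RGT_0).
  assert (Rabs x <= PI) by (apply Rabs_le; exact Hx).
  replace (cos x) with (cos (Rabs x)).
  - rewrite <- cos_PI3. left. apply cos_decreasing_1; lra.
  - unfold Rabs. destruct (Rcase_abs x); [apply cos_neg|reflexivity].
Qed.

Section Data.

Variables (b0 b1 b2 b3 : R -> R) (mu : R).
Hypothesis Hmu : 0 < mu.
Hypothesis Hb0 : forall x, is_derive b0 x (b1 x).
Hypothesis Hb1 : forall x, is_derive b1 x (b2 x).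
Hypothesis Hb2 : forall x, is_derive b2 x (b3 x).
Hypothesis E0 : forall x, Ix x -> Rabs (b0 x - mu * cos x) <= / 8 * mu.
Hypothesis E2 : forall x, Ix x -> Rabs (b2 x + mu * cos x) <= / 8 * mu.
Hypothesis E3 : forall x, Ix x -> Rabs (b3 x - mu * sin x) <= / 8 * mu.

(** At the maximum [b0 a0 >= b0 0 >= 7/8 mu], so [cos a0 >= 3/4]: the point is interior, lies in
    [|x| <= PI / 3], and [- b2 a0] is positive. On that range [b2 <= - 3/8 mu] gives the quadratic
    gap by concavity. Outside it [b0 <= 5/8 mu], so the gap is at least [mu / 4]. *)
Lemma nondegenerate_maximum : exists a0,
  - PI < a0 < PI /\ b1 a0 = 0 /\ 0 < b0 a0 /\ 0 < - b2 a0 /\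
  (forall x, Ix x -> b0 x <= b0 a0) /\
  (forall x, Ix x -> mu / (16 * PI ^ 2) * (x - a0) ^ 2 <= b0 a0 - b0 x).
Proof.
  assert (P := PI_RGT_0). assert (P1 : 1 < PI) by (generalize PI2_1; lra).
  destruct (continuity_ab_maj b0 (- PI) PI) as [a0 [Hmax Ia]].
  { lra. }
  { intros c _. apply continuity_pt_filterlim. eapply is_derive_cont, Hb0. }
  assert (M0 := Hmax 0 ltac:(lra)).
  assert (A0 := E0 0 ltac:(unfold Ix; lra)). rewrite cos_0 in A0.
  assert (A1 := E0 a0 Ia). apply Rabs_le_between in A0. apply Rabs_le_between in A1.
  assert (Ca : 3 / 4 <= cos a0) by nra.
  assert (Ia' : - PI < a0 < PI).
  { destruct (Req_dec a0 PI) as [E|E]; [rewrite E, cos_PI in Ca; lra|].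
    destruct (Req_dec a0 (- PI)) as [E'|E']; [rewrite E', cos_neg, cos_PI in Ca; lra|]. lra. }
  assert (Z : b1 a0 = 0).
  { apply (interior_maximum b0 _ a0); auto. }
  assert (A2 := E2 a0 Ia). apply Rabs_le_between in A2.
  exists a0. repeat (split; [solve [auto | nra]|]).
  assert (Pc : 0 < mu / (16 * PI ^ 2)) by (apply Rdiv_lt_0_compat; nra).
  intros x Hx. destruct (Rle_dec (Rabs x) (PI / 3)) as [Hin|Hout].
  - assert (Hin0 : Rabs a0 <= PI / 3).
    { destruct (Rle_dec (Rabs a0) (PI / 3)); auto.
      generalize (cos_le_half a0 Ia ltac:(lra)). lra. }
    apply Rabs_le_between in Hin. apply Rabs_le_between in Hin0.
    (* The added parabola uses up the guaranteed concavity: [h'' = b2 + 3 mu / 8 <= 0] on the range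
       and [h' a0 = 0], so [h] is largest at [a0]. *)
    set (h := fun t => b0 t + 3 * mu / 16 * (t - a0) ^ 2).
    set (h' := fun t => b1 t + 3 * mu / 8 * (t - a0)).
    assert (Dh : forall t, is_derive h t (h' t)).
    { intros t. apply is_derive_plusR; auto. auto_derive; auto. field. }
    assert (Dh' : forall t, is_derive h' t (b2 t + 3 * mu / 8)).
    { intros t. apply is_derive_plusR; auto. auto_derive; auto. field. }
    assert (Ch : forall t, continuous h t) by (intros; eapply is_derive_cont, Dh).
    assert (Ch' : forall t, continuous h' t) by (intros; eapply is_derive_cont, Dh').
    assert (Ng : forall t, - (PI / 3) <= t <= PI / 3 -> b2 t + 3 * mu / 8 <= 0).
    { intros t Ht. assert (Q := E2 t ltac:(unfold Ix; lra)). apply Rabs_le_between in Q.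
      assert (C := cos_ge_half t ltac:(apply Rabs_le; lra)). nra. }
    assert (Zh : h' a0 = 0) by (unfold h'; rewrite Z; ring).
    assert (Hh : h x <= h a0).
    { destruct (Rle_dec a0 x) as [L|L].
      - apply (nonincreasing_of_derive h h'); auto. intros t Ht. split; auto.
        rewrite <- Zh. apply (nonincreasing_of_derive h' (fun t => b2 t + 3 * mu / 8)); auto; [lra|].
        intros v Hv. split; auto. apply Ng; lra.
      - apply Ropp_le_cancel.
        apply (nonincreasing_of_derive (fun t => - h t) (fun t => - h' t)); [lra| |].
        + intros t Ht. split.
          * apply (is_derive_opp (K := R_AbsRing) (V := R_NormedModule)), Dh.
          * assert (h' a0 <= h' t); [|lra].
            apply (nonincreasing_of_derive h' (fun t => b2 t + 3 * mu / 8)); auto; [lra|].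
            intros v Hv. split; auto. apply Ng; lra.
        + intros t _. now apply cont_opp. }
    unfold h in Hh. rewrite Rminus_eq_0 in Hh.
    assert (mu / (16 * PI ^ 2) <= 3 * mu / 16).
    { unfold Rdiv. replace (3 * mu * / 16) with (mu * (3 / 16)) by field.
      apply Rmult_le_compat_l; [lra|]. replace (3 / 16) with (/ (16 / 3)) by field.
      apply Rinv_le_contravar; nra. }
    assert (0 <= (x - a0) ^ 2) by apply pow2_ge_0. nra.
  - assert (C := cos_le_half x Hx ltac:(lra)).
    assert (Q := E0 x Hx). apply Rabs_le_between in Q.
    assert (D : (x - a0) ^ 2 <= 4 * PI ^ 2) by (unfold Ix in Hx; nra).
    (* Two points of the interval are at most [2 PI] apart. The constant in the statement is chosen
       so that this worst case equals [mu / 4]. *)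
    apply Rle_trans with (mu / (16 * PI ^ 2) * (4 * PI ^ 2)).
    + apply Rmult_le_compat_l; lra.
    + replace (mu / (16 * PI ^ 2) * (4 * PI ^ 2)) with (mu / 4) by (field; lra). nra.
Qed.

(** The bound [|b3| <= 2 mu] is integrated three times from [a0] by the mean value theorem. The
    factors [1/2] and [1/6] of Taylor's formula are given away. *)
Lemma taylor_at_maximum a0 : - PI < a0 < PI -> b1 a0 = 0 ->
  (forall x, Ix x -> Rabs (b0 a0 - b0 x - - b2 a0 / 2 * (x - a0) ^ 2)
    <= 2 * mu * (Rabs (x - a0) * (x - a0) ^ 2)) /\
  (forall x, Ix x -> Rabs (b1 x + - b2 a0 * (x - a0)) <= 2 * mu * (x - a0) ^ 2).
Proof.
  intros Ha Z. assert (Ia : Ix a0) by (unfold Ix; lra).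
  assert (T2 : forall x, Ix x -> Rabs (b2 x - b2 a0) <= 2 * mu * Rabs (x - a0)).
  { intros x Hx. apply (segment_bound b2 b3). intros t Ht.
    destruct (segment_in_Ix a0 x t Ia Hx Ht) as [It _]. split; auto.
    assert (Q := E3 t It). apply Rabs_le_between in Q. generalize (SIN_bound t). intro.
    apply Rabs_le. nra. }
  assert (T1 : forall x, Ix x -> Rabs (b1 x + - b2 a0 * (x - a0)) <= 2 * mu * (x - a0) ^ 2).
  { intros x Hx.
    replace (b1 x + - b2 a0 * (x - a0)) with
      ((b1 x - b2 a0 * (x - a0)) - (b1 a0 - b2 a0 * (a0 - a0))) by (rewrite Z; ring).
    replace (2 * mu * (x - a0) ^ 2) with (2 * mu * Rabs (x - a0) * Rabs (x - a0))
      by (rewrite <- (pow2_abs (x - a0)); ring).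
    apply (segment_bound (fun t => b1 t - b2 a0 * (t - a0)) (fun t => b2 t - b2 a0)).
    intros t Ht. destruct (segment_in_Ix a0 x t Ia Hx Ht) as [It D]. split.
    - apply is_derive_minusR; auto. auto_derive; auto. ring.
    - eapply Rle_trans; [now apply T2|]. apply Rmult_le_compat_l; lra. }
  split; auto. intros x Hx.
  replace (b0 a0 - b0 x - - b2 a0 / 2 * (x - a0) ^ 2) with
    (- ((b0 x - b2 a0 / 2 * (x - a0) ^ 2) - (b0 a0 - b2 a0 / 2 * (a0 - a0) ^ 2))) by field.
  rewrite Rabs_Ropp.
  replace (2 * mu * (Rabs (x - a0) * (x - a0) ^ 2)) with (2 * mu * (x - a0) ^ 2 * Rabs (x - a0)) by ring.
  apply (segment_bound (fun t => b0 t - b2 a0 / 2 * (t - a0) ^ 2)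
    (fun t => b1 t + - b2 a0 * (t - a0))).
  intros t Ht. destruct (segment_in_Ix a0 x t Ia Hx Ht) as [It D]. split.
  - replace (b1 t + - b2 a0 * (t - a0)) with (b1 t - b2 a0 * (t - a0)) by ring.
    apply is_derive_minusR; auto. auto_derive; auto. field.
  - eapply Rle_trans; [now apply T1|]. apply Rmult_le_compat_l; [lra|].
    rewrite <- (pow2_abs (t - a0)), <- (pow2_abs (x - a0)).
    apply pow_incr. split; auto using Rabs_pos.
Qed.

End Data.

(** The difference [b0 - mu cos] is continued and [mu cos] is added back, so that the derivatives of
    the continuation are compared with those of [mu cos] directly. Each supremum is below the norm
    since the other summands are nonnegative. *)
Lemma extended_data (b0 : R -> R) mu delta :
  Ck_norm_le 3 (fun x => b0 x - mu * cos x) (delta * mu) ->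
  exists c0 c1 c2 c3 : R -> R,
    (forall x, is_derive c0 x (c1 x)) /\ (forall x, is_derive c1 x (c2 x)) /\
    (forall x, is_derive c2 x (c3 x)) /\ (forall x, continuous c3 x) /\
    (forall x, Ix x -> c0 x = b0 x) /\
    (forall x, Ix x -> Rabs (c0 x - mu * cos x) <= delta * mu) /\
    (forall x, Ix x -> Rabs (c2 x + mu * cos x) <= delta * mu) /\
    (forall x, Ix x -> Rabs (c3 x - mu * sin x) <= delta * mu).
Proof.
  intros [gs [Hg [Ms [HMs Hb]]]].
  destruct (deriv_chain_extension 3 _ gs Hg) as [es [D [C E]]].
  assert (MI : forall i, (i <= 3)%nat -> Ms i <= delta * mu).
  { assert (Mp : forall i, (i <= 3)%nat -> 0 <= Ms i).
    { intros i Hi. eapply Rle_trans; [apply Rabs_pos|].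
      apply (Hb i Hi 0). unfold Ix. generalize PI_RGT_0; lra. }
    assert (Q0 := Mp 0%nat ltac:(lia)). assert (Q1 := Mp 1%nat ltac:(lia)).
    assert (Q2 := Mp 2%nat ltac:(lia)). assert (Q3 := Mp 3%nat ltac:(lia)).
    simpl in HMs. intros i Hi. assert (Hc : (i = 0 \/ i = 1 \/ i = 2 \/ i = 3)%nat) by lia.
    destruct Hc as [->|[->|[->| ->]]]; lra. }
  assert (B : forall i x, (i <= 3)%nat -> Ix x -> Rabs (es i x) <= delta * mu).
  { intros i x Hi Hx. rewrite E by auto. eapply Rle_trans; [now apply Hb|]. now apply MI. }
  exists (fun x => es 0%nat x + mu * cos x), (fun x => es 1%nat x - mu * sin x),
    (fun x => es 2%nat x - mu * cos x), (fun x => es 3%nat x + mu * sin x).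
  split; [|split; [|split; [|split; [|split; [|split; [|split]]]]]].
  - intros x. replace (es 1%nat x - mu * sin x) with (es 1%nat x + - mu * sin x) by ring.
    apply is_derive_plusR; [apply D; lia|]. auto_derive; auto. ring.
  - intros x. apply is_derive_minusR; [apply D; lia|]. auto_derive; auto. ring.
  - intros x. replace (es 3%nat x + mu * sin x) with (es 3%nat x - - mu * sin x) by ring.
    apply is_derive_minusR; [apply D; lia|]. auto_derive; auto. ring.
  - intros x. apply cont_plus; [apply C; lia|].
    apply (ex_derive_continuous (fun x => mu * sin x)). auto_derive; auto.
  - intros x Hx. rewrite E by (auto; lia). rewrite (proj1 Hg) by auto. ring.
  - intros x Hx. replace (es 0%nat x + mu * cos x - mu * cos x) with (es 0%nat x) by ring.
    apply B; auto.
  - intros x Hx. replace (es 2%nat x - mu * cos x + mu * cos x) with (es 2%nat x) by ring.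
    apply B; auto.
  - intros x Hx. replace (es 3%nat x + mu * sin x - mu * sin x) with (es 3%nat x) by ring.
    apply B; auto.
Qed.

(** The surplus factor [tau^(1/4)] in [tau^(-1/2) = tau^(1/4) tau^(-3/4)] is at most [T^(1/4)]. *)
Lemma inv_sqrt_le_Rpower tau T : 0 < tau <= T ->
  / sqrt tau <= Rpower T (1 / 4) * Rpower tau (- (3 / 4)).
Proof.
  intros H. rewrite <- Rpower_sqrt, <- Rpower_Ropp by lra.
  replace (- / 2) with (1 / 4 + - (3 / 4)) by field.
  rewrite Rpower_plus. apply Rmult_le_compat_r.
  - left. apply exp_pos.
  - apply Rle_Rpower_l; lra.
Qed.

Lemma Ck_norm_le_weaken k f A A' : A <= A' -> Ck_norm_le k f A -> Ck_norm_le k f A'.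
Proof.
  intros H [fs [Hf [Ms [H1 H2]]]]. exists fs. split; auto. exists Ms. split; auto. lra.
Qed.

Theorem theorem1p1 :
  exists delta : R, 0 < delta /\
  forall mu : R, 0 < mu ->
  forall b0 : R -> R,
    Ck 3 b0 ->
    RInt b0 (- PI) PI = 0 ->
    Ck_norm_le 3 (fun x => b0 x - mu * cos x) (delta * mu) ->
    exists tstar : R, 0 < tstar /\
    exists b : R -> R -> R,
      (* b is a C^3 solution on [0, tstar) with initial datum b0 *)
      is_solution tstar b /\
      (forall x, Ix x -> b 0 x = b0 x) /\
      (* uniqueness and maximality: every solution with the same datum lives
         at most up to tstar and coincides with b *)
      (forall (T : R) (b' : R -> R -> R), 0 < T ->
         is_solution T b' -> (forall x, Ix x -> b' 0 x = b0 x) ->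
         T <= tstar /\ (forall t x, It T t -> Ix x -> b' t x = b t x)) /\
      (* blow-up at tstar *)
      (forall M : R, exists t x, It tstar t /\ Ix x /\ M < Rabs (b t x)) /\
      (* decomposition b = cos x / (tstar - t) + btilde *)
      (exists C : R, 0 < C /\
         forall t, It tstar t ->
           Ck_norm_le 1 (fun x => b t x - cos x / (tstar - t))
             (C * Rpower (tstar - t) (- (3 / 4)))).
Proof.
  exists (/ 8). split; [lra|]. intros mu Hmu b0 _ Hmean Hclose.
  assert (P := PI_RGT_0).
  destruct (extended_data b0 mu (/ 8) Hclose)
    as [d0 [d1 [d2 [d3 [D0 [D1 [D2 [D3 [Eq [E0 [E2 E3]]]]]]]]]]].
  destruct (nondegenerate_maximum d0 d1 d2 mu Hmu D0 D1 E0 E2) as [a0 [Ia [Z [HM [Hk [Hmax H1]]]]]].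
  destruct (taylor_at_maximum d0 d1 d2 d3 mu Hmu D0 D1 D2 E3 a0 Ia Z) as [H2 H3].
  set (M := d0 a0) in *. set (k := - d2 a0) in *.
  set (c1 := mu / (16 * PI ^ 2)) in *. set (C0 := 2 * mu) in *.
  (* A generous lower bound for the data, which satisfy [|d0| <= 9/8 mu]. *)
  set (B := 2 * mu). assert (HB : 0 < B) by (unfold B; lra).
  assert (HC0 : 0 < C0) by (unfold C0; lra).
  assert (Hc1 : 0 < c1) by (apply Rdiv_lt_0_compat; nra).
  assert (HMB : forall x, Ix x -> - B <= d0 x <= M).
  { intros x Hx. split; auto. assert (Q := E0 x Hx). apply Rabs_le_between in Q.
    generalize (COS_bound x). unfold B. nra. }
  assert (Hm : RInt d0 (- PI) PI = 0).
  { rewrite <- Hmean. apply (RInt_ext (V := R_CompleteNormedModule)).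
    intros x Hx. rewrite Rmin_left, Rmax_right in Hx by lra. apply Eq. unfold Ix; lra. }
  set (ts := blowup_time d0 M k). set (b := blowup_solution d0 M k).
  assert (Hts : 0 < ts) by (apply (blowup_time_pos d0 d1 M B a0 k C0 c1); auto).
  assert (Hsol : is_solution ts b).
  { apply (blowup_solution_is_solution d0 d1 d2 d3 M B a0 k C0 c1); auto. }
  assert (Hinit : forall x, Ix x -> b 0 x = b0 x).
  { intros x Hx. rewrite <- Eq by auto.
    apply (blowup_solution_initial d0 d1 M B a0 k C0 c1); auto. }
  assert (Hblow : forall N, exists t x, It ts t /\ Ix x /\ N < Rabs (b t x)).
  { intros N.
    destruct (blowup_solution_unbounded d0 d1 d2 M B a0 k C0 c1 D0 D1 HMB HM HB Ia Hk HC0 Hc1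
      H1 H2 H3 N) as [t [Ht HN]].
    exists t, 0. split; [exact Ht|]. split; [unfold Ix; lra|exact HN]. }
  exists ts. split; auto. exists b. split; auto. split; auto. split; [|split; auto].
  - intros T b' HT Hb' H0.
    assert (Agree : forall T', 0 < T' -> T' <= T -> T' <= ts ->
      forall t x, It T' t -> Ix x -> b' t x = b t x).
    { intros T' HT' L1 L2. apply solution_unique.
      - now apply (is_solution_restrict T).
      - now apply (is_solution_restrict ts).
      - intros x Hx. rewrite H0, Hinit; auto. }
    (* Otherwise [b'] would be bounded on [[0, ts]], while it agrees on [[0, ts)] with the unbounded
       [b]. *)
    assert (HTs : T <= ts).
    { destruct (Rle_dec T ts) as [L|L]; auto. exfalso.
      destruct (solution_bounded T b' ts ltac:(lra) Hb') as [L0 HL].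
      destruct (Hblow L0) as [t [x [Ht [Hx Hlt]]]].
      rewrite <- (Agree ts) in Hlt; auto; try lra.
      unfold It in Ht. generalize (HL t x ltac:(lra) Hx). lra. }
    split; auto. intros t x Ht Hx. apply (Agree T); auto; lra.
  - destruct (decomposition d0 d1 d2 M B a0 k C0 c1 D0 D1 HMB HM HB Ia Hk HC0 Hc1 H1 H2 H3)
      as [C [PC H]].
    (* The factor [ts^(1/4)] is the price of passing from the exponent [-1/2] to [-3/4] on a time
       span of length at most [ts]. *)
    exists (C * Rpower ts (1 / 4)). split.
    + apply Rmult_lt_0_compat; auto. apply exp_pos.
    + intros t Ht. destruct (H t Ht) as [_ Hn].
      eapply Ck_norm_le_weaken; [|exact Hn].
      unfold It in Ht. fold ts. unfold Rdiv. rewrite Rmult_assoc.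
      apply Rmult_le_compat_l; [lra|]. apply inv_sqrt_le_Rpower. lra.
Qed.
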